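(* Let $X$ be a separable Banach space, let $T:X\to X$ be a bounded linear operator and let $\omega:\mathbb N\to(1,+\infty)$ with $\omega(k)\to+\infty$. Suppose there exist $\alpha>1$, a dense set $\mathcal D\subset X$ and maps $S_n:\mathcal D\to X$, $n\geq0$, such that for every $x\in\mathcal D$: (i) $T^nS_nx=x$ for all $n$ and $T^mS_nx=S_{n-m}x$ for all $n>m$; (ii) $\|T^nx\|=O(n^{-\alpha})$ and $\|S_nx\|=O(n^{-\alpha})$ as $n\to\infty$. Then there exists a $T$-invariant Borel probability measure $\mu$ on $X$ with full support, with respect to which $T$ is strongly mixing, such that $E_\omega\subset L^2(X,\mathcal B,\mu)$ and such that for any $f,g\in E_\omega$ there is $C_{f,g,\alpha}$ with $|\mathrm{Cov}(f\circ T^n,g)|\leq C_{f,g,\alpha}n^{-\alpha}$ for all $n\geq1$. Moreover, for every $f\in E_\omega$ with $\int f\,d\mu=0$, the sequence $\frac1{\sqrt n}(f+f\circ T+\dots+f\circ T^{n-1})$ converges in distribution to a Gaussian random variable with zero mean and finite variance.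
   Context: $E_\omega$ denotes the set of functions $f:X\to\mathbb R$ which are infinitely (Fréchet) differentiable at $0$, satisfy $f(x)=\sum_{\kappa=0}^{\infty}\frac{D^\kappa f(0)}{\kappa!}(x,\dots,x)$ for all $x\in X$, and satisfy $\sup_{\kappa\geq0}\|D^\kappa f(0)\|\,\omega(\kappa)^\kappa<+\infty$. $T$-invariant: $\mu(T^{-1}A)=\mu(A)$ for Borel $A$; full support: $\mu(U)>0$ for every nonempty open $U$; strongly mixing: $\mu(A\cap T^{-n}B)\to\mu(A)\mu(B)$ for all Borel $A,B$. $\mathrm{Cov}(f,g)=\int fg\,d\mu-\int f\,d\mu\int g\,d\mu$. *)

(* Defs.v *)
From HB Require Import structures.
From mathcomp Require Import all_boot all_order all_algebra.
From mathcomp Require Import all_classical all_reals all_analysis.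
Set Implicit Arguments. Unset Strict Implicit. Unset Printing Implicit Defensive.
Import Order.TTheory GRing.Theory Num.Theory.
Import numFieldNormedType.Exports.
Local Open Scope classical_set_scope.
Local Open Scope ring_scope.

Definition borel (X : pointedType) (tX : set (set X)) := g_sigma_algebraType tX.
Definition borelX {R : realType} (X : normedModType R) := @borel X (@open X).

Section Frechet.
Context {R : realType} (X : normedModType R).

Definition upd k (v : 'I_k -> X) (i : 'I_k) (x : X) : 'I_k -> X :=
  fun j => if j == i then x else v j.

Definition multilinear k (A : ('I_k -> X) -> R) :=
  forall (i : 'I_k) (v : 'I_k -> X) (a : R) (x y : X),
    A (upd v i (a *: x + y)) = a * A (upd v i x) + A (upd v i y).

Definition mlnorm k (A : ('I_k -> X) -> R) : \bar R :=
  ereal_sup [set (`|A v|)%:E | v in [set v : 'I_k -> X | forall i, `|v i| <= 1]].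

Definition vcons k (h : X) (v : 'I_k -> X) : 'I_k.+1 -> X :=
  fun j => if unlift ord0 j is Some j' then v j' else h.

(* L is the Frechet derivative at y of the map G : X -> L^k(X;R),
   L being identified with a bounded (k+1)-linear form via
   L(h, v) = (DG(y) h)(v). *)
Definition frechet_deriv k (G : X -> ('I_k -> X) -> R) (y : X)
    (L : ('I_k.+1 -> X) -> R) :=
  multilinear L /\ (mlnorm L < +oo)%E /\
  forall eps : R, 0 < eps ->
    \forall h \near (0 : X),
      (mlnorm (fun v => G (y + h) v - G y v - L (vcons h v))%R
        <= (eps * `|h|)%:E)%E.

Definition inf_frechet_at0 (f : X -> R)
    (Df : forall k, X -> ('I_k -> X) -> R) :=
  (forall x v, Df 0%N x v = f x) /\
  forall k, \forall y \near (0 : X), frechet_deriv (Df k) y (Df k.+1 y).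

Definition E_omega (omega : nat -> R) (f : X -> R) :=
  exists Df : forall k, X -> ('I_k -> X) -> R,
    inf_frechet_at0 f Df /\
    (forall x : X,
      (fun n => \sum_(0 <= k < n) Df k 0 (fun _ => x) / (k`!)%:R) @ \oo
        --> f x) /\
    exists M : R, forall k,
      (mlnorm (Df k 0%R) * (omega k ^+ k)%:E <= M%:E)%E.

End Frechet.

Section Prob.
Context {R : realType} {d : measure_display} {T : measurableType d}.

Definition cov (mu : probability T R) (f g : T -> R) : R :=
  Rintegral mu setT (fun x => f x * g x)
  - Rintegral mu setT f * Rintegral mu setT g.

(* E[h(N)] for N a centred Gaussian with standard deviation sigma >= 0
   (sigma = 0: the degenerate Gaussian, i.e. the Dirac mass at 0). *)
Definition gauss_expect (sigma : R) (h : R -> R) : R :=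
  if sigma == 0 then h 0
  else Rintegral lebesgue_measure setT (fun x => h x * normal_pdf 0 sigma x).

Definition cvg_dist_gauss (mu : probability T R) (Y : nat -> T -> R)
    (sigma : R) :=
  forall h : R -> R, continuous h -> (exists M, forall x, `|h x| <= M) ->
    (fun n => Rintegral mu setT (fun x => h (Y n x))) @ \oo
      --> gauss_expect sigma h.

End Prob.

(* Main.v *)
Require Import Defs.
From HB Require Import structures.
From mathcomp Require Import all_boot all_order all_algebra.
From mathcomp Require Import all_classical all_reals all_analysis.
From mathcomp Require Import measurable_realfun zify ring lra.
Import Order.TTheory GRing.Theory Num.Theory.
Import numFieldNormedType.Exports.
Local Open Scope classical_set_scope.
Local Open Scope ring_scope.

Set Implicit Arguments.
Unset Strict Implicit.
Unset Printing Implicit Defensive.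

(* The measure is the law of a random series.  A dense sequence of points of D is encoded
   by letters k, each with its bi-infinite orbit e i k (S_i x for i >= 0, T^-i x for i < 0),
   so that T (e i k) = e (i - 1) k and |e i k| = O(|i|^-alpha).  For independent letters w_i
   with geometric law, penalised so that the sizes kappa k of the orbits have large exponential
   moments, phi w = sum_i e i (w_i) converges almost surely and T phi = phi o shift: its law is
   invariant and mixing, and it charges every open set because w_0 = k and w_i = 0 for the other
   small i has positive probability, the tail being small.

   A function f of E_omega satisfies |f x - f y| <= M exp(r) |x - y| on balls of radius r.
   Hence resampling the letter w_i moves f o phi by O(|i|^-alpha) in L^2.  Replacing the letters
   one at a time bounds the covariance of F o shift^n and G by half the sum over i of the
   products of the influences of w_i, a convolution of order n^-alpha.

   For the central limit theorem, f o phi is approximated by bounded centred functions of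
   finitely many letters; since the covariances are summable the error on the normalised sums
   is small uniformly in n.  For those functions the partial sums are compared with a Gaussian
   by adding one term at a time while running the heat semigroup backwards on a smooth test
   function.  Staircases of cubic splines then give all bounded continuous test functions. *)

(** Two demands on the letters pull apart: every orbit needs positive probability, for full support,
    while a function of [E_omega] may grow like [exp |x|], so the random point needs exponential
    moments. Admitting an orbit of size [C] only at letters [k] with [C = O(k)] reconciles them,
    because a geometric letter has exponential moments. When one letter is resampled, the increment
    is bounded by an exponential of two costs times the sizes of two letters; squaring and splitting
    by AM-GM leaves fourth powers of both factors, and separating the two copies doubles the
    exponent once more: hence [exp (8 cost)].

    The rate [n^-alpha] survives the convolution because one of [|i|], [|i - n|] is at least [n/2];
    that weight pays the rate and the other is summable.

    For the limit theorem, closeness of f and its approximant in L^2 does not by itself control sums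
    of n terms, whose error must be [o(sqrt n)] uniformly. Short lags are controlled by the L^2
    distance, long lags by influence bounds common to all approximants.

    The series converges only almost surely, so [T phi = phi o shift] holds on a set of full
    measure, and all identities are transported through that set. *)

(** * Expectations, and the classes of bounded, L^1 and L^2 functions *)

Section Mean.
Context d (T : measurableType d) (R : realType) (P : probability T R).
Implicit Types F G : T -> R.

Definition mean F : R := Rintegral P setT F.
Definition L1 F := P.-integrable setT (EFin \o F).
Definition bdd F := measurable_fun setT F /\ exists M, forall w, `|F w| <= M.
Definition L2 F := measurable_fun setT F /\ L1 (fun w => F w ^+ 2).

Lemma mean_cst (c : R) : mean (fun=> c) = c.
Proof. by rewrite /mean Rintegral_cst// [X in fine X](_ : _ = 1%E) ?mulr1//; exact: probability_setT. Qed.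

Lemma L1_measurable F : L1 F -> measurable_fun setT F.
Proof. by move=> /(measurable_int _) /measurable_EFinP. Qed.

Lemma L1_le F G : measurable_fun setT F -> L1 G -> (forall w, `|F w| <= G w) -> L1 F.
Proof.
move=> mF iG FG; apply: (le_integrable _ _ _ iG) => //.
  exact/measurable_EFinP.
by move=> w _ /=; rewrite lee_fin (le_trans (FG w))// ler_norm.
Qed.

Lemma L1_cst (c : R) : L1 (fun=> c).
Proof.
rewrite /L1; apply: (finite_measure_integrable_cst P c) => //.
Qed.

Lemma L1_bdd F : bdd F -> L1 F.
Proof. by move=> [mF [M FM]]; apply: (L1_le mF (L1_cst M)). Qed.

Lemma L1D F G : L1 F -> L1 G -> L1 (fun w => F w + G w).
Proof. by move=> iF iG; exact: (integrableD _ iF iG). Qed.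

Lemma L1Z (c : R) F : L1 F -> L1 (fun w => c * F w).
Proof. by move=> iF; exact: (integrableZl _ c iF). Qed.

Lemma L1N F : L1 F -> L1 (fun w => - F w).
Proof. by move=> /(L1Z (-1)); under [fun=> _]funext do rewrite mulN1r. Qed.

Lemma L1B F G : L1 F -> L1 G -> L1 (fun w => F w - G w).
Proof. by move=> iF /L1N; exact: L1D. Qed.

Lemma L1_norm F : L1 F -> L1 (fun w => `|F w|).
Proof. by move=> iF; exact: (integrable_norm iF). Qed.

Lemma L1_sum (I : Type) (s : seq I) (F : I -> T -> R) :
  (forall i, L1 (F i)) -> L1 (fun w => \sum_(i <- s) F i w).
Proof.
move=> iF; elim: s => [|i s ih].
  by under [fun=> _]funext do rewrite big_nil; exact: L1_cst.
by under [fun=> _]funext do rewrite big_cons; exact: L1D.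
Qed.

Lemma meanD F G : L1 F -> L1 G -> mean (fun w => F w + G w) = mean F + mean G.
Proof. exact: RintegralD. Qed.

Lemma meanB F G : L1 F -> L1 G -> mean (fun w => F w - G w) = mean F - mean G.
Proof. exact: RintegralB. Qed.

Lemma meanZ (c : R) F : L1 F -> mean (fun w => c * F w) = c * mean F.
Proof. by move=> iF; exact: RintegralZl. Qed.

Lemma mean_sum (I : Type) (s : seq I) (F : I -> T -> R) :
  (forall i, L1 (F i)) ->
  mean (fun w => \sum_(i <- s) F i w) = \sum_(i <- s) mean (F i).
Proof.
move=> iF; elim: s => [|i s ih].
  by rewrite big_nil; under [fun=> _]funext do rewrite big_nil; exact: mean_cst.
rewrite big_cons; under [fun=> _]funext do rewrite big_cons.
by rewrite meanD ?ih//; exact: L1_sum.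
Qed.

Lemma le_mean F G : L1 F -> L1 G -> (forall w, F w <= G w) -> mean F <= mean G.
Proof. by move=> iF iG FG; apply: le_Rintegral. Qed.

Lemma mean_ge0 F : (forall w, 0 <= F w) -> 0 <= mean F.
Proof. by move=> F0; apply: Rintegral_ge0. Qed.

Lemma norm_mean F : L1 F -> `|mean F| <= mean (fun w => `|F w|).
Proof. exact: le_normr_Rintegral. Qed.

Lemma norm_mean_le F G : L1 F -> L1 G -> (forall w, `|F w| <= G w) ->
  `|mean F| <= mean G.
Proof.
move=> iF iG FG; apply: le_trans (norm_mean iF) _.
by apply: le_mean => //; exact: L1_norm.
Qed.

Lemma norm_mean_cst F (c : R) : L1 F -> (forall w, `|F w| <= c) -> `|mean F| <= c.
Proof. by move=> iF Fc; rewrite -(mean_cst c); apply: norm_mean_le => //; exact: L1_cst. Qed.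

Lemma bdd_cst (c : R) : bdd (fun=> c).
Proof. by split=> //; exists `|c|. Qed.

Lemma bddD F G : bdd F -> bdd G -> bdd (fun w => F w + G w).
Proof.
move=> [mF [M FM]] [mG [N GN]]; split; first exact: measurable_funD.
by exists (M + N) => w; rewrite (le_trans (ler_normD _ _))// lerD.
Qed.

Lemma bddM F G : bdd F -> bdd G -> bdd (fun w => F w * G w).
Proof.
move=> [mF [M FM]] [mG [N GN]]; split; first exact: measurable_funM.
by exists (M * N) => w; rewrite normrM ler_pM.
Qed.

Lemma bddZ (c : R) F : bdd F -> bdd (fun w => c * F w).
Proof. exact/bddM/bdd_cst. Qed.

Lemma bddB F G : bdd F -> bdd G -> bdd (fun w => F w - G w).
Proof.
move=> bF /(bddZ (-1)) bG; have := bddD bF bG.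
by under [fun=> _]funext do rewrite mulN1r.
Qed.

Lemma bddX F n : bdd F -> bdd (fun w => F w ^+ n).
Proof.
move=> bF; elim: n => [|n ih].
  by under [fun=> _]funext do rewrite expr0; exact: bdd_cst.
by under [fun=> _]funext do rewrite exprS; exact: bddM.
Qed.

Lemma bdd_sum (I : Type) (s : seq I) (F : I -> T -> R) :
  (forall i, bdd (F i)) -> bdd (fun w => \sum_(i <- s) F i w).
Proof.
move=> iF; elim: s => [|i s ih].
  by under [fun=> _]funext do rewrite big_nil; exact: bdd_cst.
by under [fun=> _]funext do rewrite big_cons; exact: bddD.
Qed.

Lemma L2_bdd F : bdd F -> L2 F.
Proof. by move=> bF; split; [case: bF|exact/L1_bdd/bddX]. Qed.

Lemma L2_mul F G : L2 F -> L2 G -> L1 (fun w => F w * G w).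
Proof.
move=> [mF iF] [mG iG]; apply: (L1_le _ (L1D iF iG)); first exact: measurable_funM.
move=> w; have : 0 <= (`|F w| - `|G w|) ^+ 2 by exact: sqr_ge0.
have := sqr_ge0 (F w); have := sqr_ge0 (G w).
by rewrite normrM sqrrB !real_normK ?num_real//; move: (F w ^+ 2) => a; nra.
Qed.

Lemma L2_L1 F : L2 F -> L1 F.
Proof.
move=> iF; have := L2_mul iF (L2_bdd (bdd_cst 1)).
by under [fun=> _]funext do rewrite mulr1.
Qed.

Lemma L2D F G : L2 F -> L2 G -> L2 (fun w => F w + G w).
Proof.
move=> iF iG; split; first by apply: measurable_funD; [case: iF|case: iG].
rewrite [X in L1 X](_ : _ = fun w => F w ^+ 2 + 2 * (F w * G w) + G w ^+ 2); last first.
  by apply: funext => w; ring.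
by apply: L1D; [apply: L1D; [case: iF|exact/L1Z/L2_mul]|case: iG].
Qed.

Lemma L2Z (c : R) F : L2 F -> L2 (fun w => c * F w).
Proof.
move=> iF; split; first by apply: measurable_funM => //; case: iF.
by under [fun=> _]funext do rewrite exprMn; apply: L1Z; case: iF.
Qed.

Lemma L2B F G : L2 F -> L2 G -> L2 (fun w => F w - G w).
Proof.
move=> bF /(L2Z (-1)) bG; have := L2D bF bG.
by under [fun=> _]funext do rewrite mulN1r.
Qed.

Lemma L2_sum (I : Type) (s : seq I) (F : I -> T -> R) :
  (forall i, L2 (F i)) -> L2 (fun w => \sum_(i <- s) F i w).
Proof.
move=> iF; elim: s => [|i s ih].
  by under [fun=> _]funext do rewrite big_nil; exact/L2_bdd/bdd_cst.
by under [fun=> _]funext do rewrite big_cons; exact: L2D.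
Qed.

Lemma L2_cst (c : R) : L2 (fun=> c).
Proof. exact/L2_bdd/bdd_cst. Qed.

(** Integrate the pointwise inequality [|xy| <= (b/a) x^2/2 + (a/b) y^2/2]: second moments at most
    [a^2] and [b^2] turn the right side into [ab]. *)
Lemma mean_mul_le F G (a b : R) : L2 F -> L2 G -> 0 < a -> 0 < b ->
  mean (fun w => F w ^+ 2) <= a ^+ 2 -> mean (fun w => G w ^+ 2) <= b ^+ 2 ->
  `|mean (fun w => F w * G w)| <= a * b.
Proof.
move=> iF iG a0 b0 Fa Gb.
have iF2 : L1 (fun w => F w ^+ 2) by case: iF.
have iG2 : L1 (fun w => G w ^+ 2) by case: iG.
apply: (@le_trans _ _ (mean (fun w => (b / a / 2) * F w ^+ 2 + (a / b / 2) * G w ^+ 2))).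
  apply: norm_mean_le; [exact: L2_mul|by apply: L1D; exact: L1Z|move=> w].
  rewrite normrM -(real_normK (num_real (F w))) -(real_normK (num_real (G w))).
  set x := `|F w|; set y := `|G w|.
  rewrite -subr_ge0 [X in 0 <= X](_ : _ = (b * x - a * y) ^+ 2 / (2 * a * b)).
    by rewrite divr_ge0 ?sqr_ge0 ?mulr_ge0// ltW.
  by field; rewrite !gt_eqF.
rewrite meanD ?meanZ//; try exact: L1Z.
apply: (@le_trans _ _ (b / a / 2 * a ^+ 2 + a / b / 2 * b ^+ 2)).
  by rewrite lerD// ler_wpM2l// !divr_ge0// ltW.
by rewrite [leLHS](_ : _ = a * b)//; field; rewrite !gt_eqF.
Qed.

Lemma sqr_mean_le F : L2 F -> mean F ^+ 2 <= mean (fun w => F w ^+ 2).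
Proof.
move=> iF; have iF1 := L2_L1 iF; have iF2 : L1 (fun w => F w ^+ 2) by case: iF.
have : 0 <= mean (fun w => (F w - mean F) ^+ 2) by apply: mean_ge0 => w; exact: sqr_ge0.
rewrite [X in mean X](_ : _ = fun w => F w ^+ 2 - 2 * mean F * F w + mean F ^+ 2).
  have iZ : L1 (fun w => 2 * mean F * F w) by exact: L1Z.
  by rewrite meanD ?meanB ?meanZ ?mean_cst//; first [lra|exact: L1B|exact: L1_cst].
by apply: funext => w; ring.
Qed.

Lemma mean_abs_le F (a : R) : L2 F -> 0 <= a -> mean (fun w => F w ^+ 2) <= a ^+ 2 ->
  mean (fun w => `|F w|) <= a.
Proof.
move=> iF a0 Fa; have iF1 := L2_L1 iF.
have iA : L2 (fun w => `|F w|).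
  case: (iF) => mF iF2; split; first exact: measurableT_comp.
  by under [fun=> _]funext do rewrite real_normK ?num_real//.
rewrite -ler_sqr ?nnegrE ?mean_ge0//; apply: le_trans (sqr_mean_le iA) _.
by under [fun=> _]funext do rewrite real_normK ?num_real//.
Qed.

End Mean.

Arguments mean {d T R} P F.
Arguments L1 {d T R} P F.
Arguments L2 {d T R} P F.
Arguments bdd {d T R} F.

Lemma measurable_preimage d1 d2 (T1 : measurableType d1) (T2 : measurableType d2) (f : T1 -> T2) B :
  measurable_fun setT f -> measurable B -> measurable (f @^-1` B).
Proof. by move=> mf mB; rewrite -[X in measurable X]setTI; exact: mf. Qed.

(** * Measure-preserving maps and image laws *)

Section MeasurePreserving.
Context d1 d2 (T1 : measurableType d1) (T2 : measurableType d2) (R : realType).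
Variables (P : probability T1 R) (Q : probability T2 R) (phi : T1 -> T2).

Definition mpres := measurable_fun setT phi /\
  forall A, measurable A -> Q A = P (phi @^-1` A).

Hypothesis mp : mpres.

Let mphi : measurable_fun setT phi. Proof. by case: mp. Qed.

Lemma mpres_integral_ge0 (f : T2 -> \bar R) : measurable_fun setT f ->
  (forall x, 0 <= f x)%E -> (\int[Q]_x f x = \int[P]_x f (phi x))%E.
Proof.
move=> mf f0.
rewrite (@eq_measure_integral _ _ _ setT (pushforward P phi)).
  by rewrite ge0_integral_pushforward.
by move=> A mA _; exact: (proj2 mp).
Qed.

Lemma mpres_L1 (F : T2 -> R) : measurable_fun setT F ->
  L1 Q F <-> L1 P (F \o phi).
Proof.
move=> mF; rewrite /L1; split=> /integrableP[m i]; apply/integrableP; split.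
- by apply/measurable_EFinP; exact: measurableT_comp.
- by rewrite mpres_integral_ge0 in i => //; exact: measurableT_comp.
- exact/measurable_EFinP.
- rewrite mpres_integral_ge0//; apply: measurableT_comp => //.
  exact/measurable_EFinP.
Qed.

Lemma mpres_mean (F : T2 -> R) : measurable_fun setT F ->
  mean Q F = mean P (F \o phi).
Proof.
move=> mF; have mF' : measurable_fun setT (EFin \o F) by exact/measurable_EFinP.
congr fine; rewrite integralE [RHS]integralE; congr (_ - _)%E.
- rewrite (mpres_integral_ge0 (measurable_funepos mF')).
    by apply: eq_integral => x _; rewrite !funeposE.
  exact: funepos_ge0.
- rewrite (mpres_integral_ge0 (measurable_funeneg mF')).
    by apply: eq_integral => x _; rewrite !funenegE.
  exact: funeneg_ge0.
Qed.

Lemma mpres_L2 (F : T2 -> R) : L2 Q F -> L2 P (F \o phi).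
Proof.
move=> [mF iF]; split; first exact: measurableT_comp.
by apply/(@mpres_L1 (fun x => F x ^+ 2)) => //; exact: measurable_funX.
Qed.

End MeasurePreserving.

Section Law.
Context d1 d2 (T1 : measurableType d1) (T2 : measurableType d2) (R : realType).
Variables (P : probability T1 R) (phi : T1 -> T2) (mphi : measurable_fun setT phi).

Definition law : probability T2 R := distribution P (mfun_Sub (mem_set mphi)).

Lemma lawE A : law A = P (phi @^-1` A).
Proof. by []. Qed.

Lemma mpres_law : mpres P law phi.
Proof. by []. Qed.

End Law.

(** * Sequences of letters and cylinder sets *)

Section SequenceSpace.
Variable I : choiceType.

Definition cylinder (s : seq I) (k : I -> nat) : set (I -> nat) :=
  [set w | forall i, i \in s -> w i = k i].

(** The empty set is added for stability under intersection: two cylinders that prescribe different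
    values of the same letter are disjoint. *)
Definition cylinders : set (set (I -> nat)) :=
  [set A | A = set0 \/ exists s k, A = cylinder s k].

Definition letters := g_sigma_algebraType cylinders.

Lemma setI_closed_cylinders : setI_closed cylinders.
Proof.
move=> A B [->|[s [k ->]]]; first by rewrite set0I; left.
move=> [->|[t [l ->]]]; first by rewrite setI0; left.
have [kl|] := pselect (forall i, i \in s -> i \in t -> k i = l i).
  right; exists (s ++ t), (fun i => if i \in s then k i else l i).
  apply/seteqP; split=> w /=.
    move=> [ws wt] i; rewrite mem_cat; case: ifP => [si _|_ /= ti]; first exact: ws.
    exact: wt.
  move=> wst; split=> i si.
    by rewrite wst ?mem_cat ?si.
  rewrite wst ?mem_cat ?si ?orbT//; case: ifP => // ss; exact: kl.
move=> kl; left; apply/seteqP; split=> // w [ws wt]; apply: kl => i si ti.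
by rewrite -ws// wt.
Qed.

Lemma measurable_cylinder s k : measurable (cylinder s k : set letters).
Proof. by apply: sub_sigma_algebra; right; exists s, k. Qed.

Lemma measurable_coord (i : I) : measurable_fun setT (fun w : letters => w i).
Proof.
move=> _ B _; rewrite setTI.
rewrite [X in measurable X](_ : _ = \bigcup_(n in B) (cylinder [:: i] (fun=> n) : set letters)).
  by apply: bigcup_measurable => n _; exact: measurable_cylinder.
apply/seteqP; split=> [w Bw|w [n Bn /(_ i)]] /=.
  by exists (w i) => // j; rewrite inE => /eqP ->.
by rewrite inE eqxx => ->.
Qed.

Lemma measurable_letters d (T : measurableType d) (f : T -> letters) :
  (forall i, measurable_fun setT (fun t => f t i)) -> measurable_fun setT f.
Proof.
move=> mf; apply: (@measurability _ _ T letters setT f cylinders) => //.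
move=> _ [A [->|[s [k ->]]] <-]; first by rewrite preimage_set0 setI0.
rewrite setTI; elim: s => [|i s ih].
  by rewrite [X in measurable X](_ : _ = setT)//; apply/seteqP; split.
rewrite [X in measurable X](_ : _ = (fun t => f t i) @^-1` [set k i] `&` f @^-1` cylinder s k).
  by apply: measurableI => //; exact: measurable_preimage (mf i) _.
apply/seteqP; split=> [t ft|t /= [fi fs] j].
  by split=> /= [|j js]; apply: ft; rewrite inE ?eqxx ?js ?orbT.
by rewrite inE => /predU1P[->//|]; exact: fs.
Qed.

End SequenceSpace.

(** Induction on [s]: cut the event according to the value [n] of one letter, countably many cases,
    and freeze that letter at [n] in each slice. *)
Lemma measurable_finite_letters (I : choiceType) (s : seq I) (A : set (letters I)) :
  (forall w w', (forall i, i \in s -> w i = w' i) -> A w -> A w') -> measurable A.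
Proof.
elim: s A => [|i s ih] A sA.
  have [[w Aw]|nA] := pselect (exists w, A w).
    by rewrite (_ : A = setT)//; apply/seteqP; split=> // w' _; apply: sA Aw.
  by rewrite (_ : A = set0)//; apply/seteqP; split=> // w Aw; apply: nA; exists w.
pose put n (w : letters I) : letters I := fun j => if j == i then n else w j.
rewrite (_ : A = \bigcup_n ((fun w : letters I => w i) @^-1` [set n] `&` [set w | A (put n w)])).
  apply: bigcupT_measurable => n; apply: measurableI.
    exact: measurable_preimage (measurable_coord i) _.
  apply: ih => w w' ww'; apply: sA => j; rewrite inE /put.
  by case: eqP => //= _ js; exact: ww'.
have putE (w : letters I) : put (w i) w = w by apply: funext => j; rewrite /put; case: eqP => [->|].
apply/seteqP; split=> [w Aw|w [n _ [/= <-]]]; last by rewrite putE.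
by exists (w i) => //; split=> //=; rewrite putE.
Qed.

Lemma measurable_finite_letters_fun (I : choiceType) (s : seq I) d (T : measurableType d) (F : letters I -> T) :
  (forall w w', (forall i, i \in s -> w i = w' i) -> F w = F w') -> measurable_fun setT F.
Proof.
move=> sF _ B _; rewrite setTI; apply: (@measurable_finite_letters _ s) => w w' ww' /=.
by rewrite (sF w w').
Qed.

(** * Independent geometric letters *)

Definition geom {R : realType} (k : nat) : R := (2 ^+ k.+1)^-1.

(** Repetitions in [s] are excluded because a repeated index would be counted twice in the
    product. *)
Definition iid {R : realType} (I : choiceType) (P : probability (letters I) R) :=
  forall (s : seq I) k, uniq s -> P (cylinder s k) = (\prod_(i <- s) geom (k i))%:E.

Section Iid.
Variable R : realType.

(** Cylinders generate and are stable under intersection, so they determine a probability; every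
    later invariance of the letters is checked on them. *)
Lemma mpres_iid d (T : measurableType d) (Q : probability T R) (I : choiceType)
    (P : probability (letters I) R) (f : T -> letters I) :
  iid P -> measurable_fun setT f ->
  (forall s k, uniq s -> Q (f @^-1` cylinder s k) = (\prod_(i <- s) geom (k i))%:E) ->
  mpres Q P f.
Proof.
move=> iP mf fs; split=> // A mA; change (P A = law Q mf A).
refine (@measure_unique _ R (letters I) (@cylinders I) (fun=> setT) _ _ _ _ P (law Q mf) _ _ A mA) => //.
- exact: setI_closed_cylinders.
- by move=> _; right; exists [::], (fun=> 0%N); apply/seteqP; split.
- by rewrite bigcup_const//; exists 0%N.
- move=> _ [->|[s [k ->]]]; first by rewrite !measure0.
  rewrite (_ : cylinder s k = cylinder (undup s) k); last first.
    by apply/seteqP; split=> w /= ws i si; apply: ws; rewrite ?mem_undup// -mem_undup.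
  apply: (etrans (iP _ k (undup_uniq s))); apply: esym.
  exact: (fs _ k (undup_uniq s)).
- move=> _; apply: (@le_lt_trans _ _ 1%E); first exact: (@probability_le1 _ _ _ P).
  exact: ltry.
Qed.

Lemma measurable_reindex (I J : choiceType) (th : J -> I) :
  measurable_fun setT (fun w : letters I => (w \o th : letters J)).
Proof. by apply: measurable_letters => j; exact: measurable_coord. Qed.

Lemma cylinder_reindex (I J : choiceType) (th : J -> I) (k0 : nat) : injective th ->
  forall s k, exists l, (fun w : I -> nat => w \o th) @^-1` cylinder s k =
    cylinder (map th s) l /\ forall j, l (th j) = k j.
Proof.
move=> thI s k.
(* [l] undoes [th] on its range; the default [k0] is never read, since the cylinder only looks at
   indices [th j]. *)
pose l i := if pselect (exists j, th j = i) is left e then k (projT1 (cid e)) else k0.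
have lth j : l (th j) = k j.
  rewrite /l; case: pselect => [e|[]]; last by exists j.
  by case: cid => /= j' /thI ->.
exists l; split=> //; apply/seteqP; split=> w /= ws.
  by move=> _ /mapP[j js ->]; rewrite lth -ws.
by move=> j js /=; rewrite ws ?lth//; exact: map_f.
Qed.

Lemma iid_reindex (I J : choiceType) (th : J -> I)
    (P : probability (letters I) R) (Q : probability (letters J) R) :
  injective th -> iid P -> iid Q -> mpres P Q (fun w => (w \o th : letters J)).
Proof.
move=> thI iP iQ; apply: mpres_iid => //; first exact: measurable_reindex.
move=> s k us; have [l [-> lth]] := cylinder_reindex 0 thI s k.
rewrite iP ?map_inj_uniq// big_map; congr EFin.
by apply: eq_bigr => j _; rewrite lth.
Qed.

Lemma iid_law_reindex (I J : choiceType) (th : J -> I) (P : probability (letters I) R) :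
  injective th -> iid P -> iid (law P (measurable_reindex th)).
Proof.
move=> thI iP s k us; rewrite lawE; have [l [-> lth]] := cylinder_reindex 0 thI s k.
rewrite iP ?map_inj_uniq// big_map; congr EFin.
by apply: eq_bigr => j _; rewrite lth.
Qed.

Definition merge (I : choiceType) (J : pred I) (w : letters I * letters I) : letters I :=
  fun i => if J i then w.1 i else w.2 i.

(** This is the independence of the letters inside and outside [J], phrased on a product space so
    that Fubini can be used. *)
Lemma mpres_merge (I : choiceType) (J : pred I) (P : probability (letters I) R) :
  iid P -> mpres (P \x P)%E P (merge J).
Proof.
move=> iP; apply: mpres_iid => //.
  apply: measurable_letters => i; rewrite /merge; case: (J i).
    exact: (measurableT_comp (measurable_coord i) measurable_fst).
  exact: (measurableT_comp (measurable_coord i) measurable_snd).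
move=> s k us.
rewrite [X in _ X = _](_ : _ = cylinder (seq.filter J s) k `*` cylinder (seq.filter (predC J) s) k).
  apply: (etrans (product_measure1E P P (measurable_cylinder _ _) (measurable_cylinder _ _))).
  apply: (etrans (congr2 mule (iP _ k (filter_uniq J us)) (iP _ k (filter_uniq (predC J) us)))).
  rewrite -EFinM; congr EFin.
  by rewrite !big_filter [RHS](bigID J).
apply/seteqP; split=> -[w0 w1] /=; rewrite /cylinder /merge /=.
  move=> H; split=> i; rewrite mem_filter => /andP[Ji si].
    by have := H i si; rewrite Ji.
  by have := H i si; move: Ji => /= /negbTE ->.
move=> [H0 H1] i si; case: ifPn => Ji.
  by apply: H0; rewrite mem_filter Ji.
by apply: H1; rewrite mem_filter /= Ji.
Qed.

Definition depends (I : choiceType) (J : pred I) (F : letters I -> R) :=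
  forall w w', (forall i, J i -> w i = w' i) -> F w = F w'.

(** After merging two independent copies, [F] reads only the first factor and [G] only the
    second. *)
Lemma mean_indep (I : choiceType) (J : pred I) (P : probability (letters I) R) F G :
  iid P -> bdd F -> bdd G -> depends J F -> depends (predC J) G ->
  mean P (fun w => F w * G w) = mean P F * mean P G.
Proof.
move=> iP bF bG dF dG; have [mF _] := bF; have [mG _] := bG.
rewrite (mpres_mean (mpres_merge J iP)); last exact: measurable_funM.
rewrite (_ : _ \o _ = fun w => F w.1 * G w.2); last first.
  apply: funext => -[w0 w1] /=; congr (_ * _).
    by apply: dF => i Ji; rewrite /merge Ji.
  by apply: dG => i /= /negbTE Ji; rewrite /merge Ji.
have bFG : bdd (fun w : letters I * letters I => F w.1 * G w.2).
  apply: bddM.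
    by case: bF => _ [M FM]; split; [exact: measurableT_comp|exists M].
  by case: bG => _ [M GM]; split; [exact: measurableT_comp|exists M].
have iFG := L1_bdd (P \x P)%E bFG.
rewrite {1}/mean /Rintegral -(integral12_prod_meas1 iFG)/= /fubini_F/=.
under eq_integral => x _.
  under eq_integral do rewrite EFinM.
  rewrite integralZl//; last exact: (L1_bdd P bG).
  over.
have fG : (\int[P]_x (G x)%:E)%E = (mean P G)%:E.
  by rewrite /mean /Rintegral fineK//; apply: integrable_fin_num => //; exact: (L1_bdd P bG).
rewrite fG integralZr//; last exact: (L1_bdd P bF).
rewrite fineM//; apply: integrable_fin_num => //; exact: (L1_bdd P bF).
Qed.

End Iid.

(** * Existence of independent geometric letters, from a uniform variable *)

Section Expansion.
Variable R : realType.
Implicit Types (x : R) (n k : nat) (c : nat -> nat).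

(* Expansion of x in [0, 1[ along the cells [1 - 2^-k, 1 - 2^-(k+1)[: the
   letters of a uniform x are independent and geometric. *)
Definition cell_left k : R := 1 - (2 ^+ k)^-1.

(** The cells partition [[0, 1[]; elsewhere [xget] returns its default letter 0. *)
Definition first_letter x : nat :=
  xget 0%N [set k | cell_left k <= x < cell_left k + geom k].

Definition rescale x : R := (x - cell_left (first_letter x)) / geom (first_letter x).

Definition expansion x : letters nat := fun n => first_letter (iter n rescale x).

Lemma geom_gt0 k : 0 < geom k :> R.
Proof. by rewrite invr_gt0 exprn_gt0. Qed.

Lemma cell_leftS k : cell_left k.+1 = cell_left k + geom k.
Proof.
rewrite /cell_left /geom exprS; field.
by rewrite expf_neq0// pnatr_eq0.
Qed.

Lemma cell_left_homo : {homo cell_left : k l / (k <= l)%N >-> k <= l}.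
Proof.
move=> k l kl; rewrite lerD2l lerN2 lef_pV2 ?posrE ?exprn_gt0//.
by rewrite ler_eXn2l// ltr1n.
Qed.

Lemma cell_left_ge0 k : 0 <= cell_left k.
Proof. by rewrite subr_ge0 invf_le1 ?exprn_gt0// exprn_ege1// ler1n. Qed.

Lemma cell_right_le1 k : cell_left k + geom k <= 1.
Proof. by rewrite -cell_leftS gerBl invr_ge0 exprn_ge0. Qed.

Lemma cell_uniq k l x : cell_left k <= x < cell_left k + geom k ->
  cell_left l <= x < cell_left l + geom l -> k = l.
Proof.
rewrite -!cell_leftS => /andP[k1 k2] /andP[l1 l2].
apply/eqP; rewrite eqn_leq; apply/andP; split; rewrite leqNgt; apply/negP.
  by move=> /cell_left_homo lk; have := lt_le_trans l2 (le_trans lk k1); rewrite ltxx.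
by move=> /cell_left_homo kl; have := lt_le_trans k2 (le_trans kl l1); rewrite ltxx.
Qed.

Lemma first_letterE k x : cell_left k <= x < cell_left k + geom k -> first_letter x = k.
Proof.
move=> kx; rewrite /first_letter; apply: xget_unique => // l lx.
exact: cell_uniq lx kx.
Qed.

Lemma first_letterP x : 0 <= x < 1 ->
  cell_left (first_letter x) <= x < cell_left (first_letter x) + geom (first_letter x).
Proof.
move=> /andP[x0 x1].
have [n xn] : exists n, x < cell_left n.+1.
  have e0 : 0 < 1 - x by rewrite subr_gt0.
  have [n _ /(_ n (leqnn n)) xn] := near_infty_natSinv_expn_lt (PosNum e0).
  exists n; rewrite /cell_left ltrBrDl -ltrBrDr; apply: le_lt_trans xn.
  rewrite /= div1r lef_pV2 ?posrE ?exprn_gt0//.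
  by rewrite ler_eXn2l// ltr1n.
have [k xk kmin] := ex_minnP (ex_intro (fun n => x < cell_left n.+1) n xn).
have kx : cell_left k <= x.
  case: k xk kmin => [|k] xk kmin; first by rewrite /cell_left expr0 invr1 subrr.
  by rewrite leNgt; apply/negP => /kmin; rewrite ltnn.
by rewrite (@first_letterE k) -cell_leftS xk andbT.
Qed.

(** Left end of the interval of points whose first [n] letters are [c]; its length is the product of
    the [geom (c i)]. *)
Fixpoint prefix_left n c : R := if n is m.+1 then
  prefix_left m c + (\prod_(i < m) geom (c i)) * cell_left (c m) else 0.

Lemma prefix_lenS n c : \prod_(i < n.+1) geom (c i) = \prod_(i < n) geom (c i) * geom (c n) :> R.
Proof. by rewrite big_ord_recr. Qed.

Lemma prefix_len_gt0 n c : 0 < \prod_(i < n) geom (c i) :> R.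
Proof. by apply: prodr_gt0 => i _; exact: geom_gt0. Qed.

Lemma expansion_prefixE n c x : 0 <= x < 1 -> (forall i, (i < n)%N -> expansion x i = c i) ->
  (prefix_left n c <= x < prefix_left n c + \prod_(i < n) geom (c i)) /\
  iter n rescale x = (x - prefix_left n c) / \prod_(i < n) geom (c i).
Proof.
move=> x01; elim: n => [|n ih] xc; first by rewrite big_ord0 /= subr0 divr1 add0r.
have [/andP[x1 x2] e] := ih (fun i hi => xc i (leqW hi)).
have p0 := prefix_len_gt0 n c; set p := \prod_(i < n) _ in x2 e p0.
have y01 : 0 <= iter n rescale x < 1.
  by rewrite e divr_ge0 ?subr_ge0 ?(ltW p0)//= ltr_pdivrMr// mul1r ltrBlDl.
have := first_letterP y01; have -> : first_letter (iter n rescale x) = c n by exact: xc.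
rewrite e => /andP[]; rewrite ler_pdivlMr// ltr_pdivrMr// => l1 l2.
rewrite prefix_lenS /= -/p; split.
  by apply/andP; split; nra.
rewrite {1}/rescale; have -> : first_letter (iter n rescale x) = c n by exact: xc.
by rewrite e -/p; field; rewrite !gt_eqF ?geom_gt0.
Qed.

Lemma expansion_prefix n c x :
  prefix_left n c <= x < prefix_left n c + \prod_(i < n) geom (c i) ->
  0 <= x < 1 /\ forall i, (i < n)%N -> expansion x i = c i.
Proof.
elim: n => [|n ih]; first by rewrite big_ord0 /= add0r.
have p0 := prefix_len_gt0 n c.
rewrite prefix_lenS /=; set p := \prod_(i < n) _ in ih p0 * => /andP[x1 x2].
have a0 := cell_left_ge0 (c n); have a1 := cell_right_le1 (c n).
have pa := mulr_ge0 (ltW p0) a0; have pb := ler_wpM2l (ltW p0) a1.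
have [|x01 xc] := ih.
  by clear -x1 x2 pa pb; clearbody p; apply/andP; split; lra.
split=> // i; rewrite ltnS leq_eqVlt => /predU1P[->|]; last exact: xc.
have [_ e] := expansion_prefixE x01 xc.
apply: first_letterE; rewrite e ler_pdivlMr// ltr_pdivrMr//.
clear -x1 x2; rewrite -/p; clearbody p.
by apply/andP; split; lra.
Qed.

Lemma measurable_first_letter : measurable_fun setT first_letter.
Proof.
move=> _ B _; rewrite setTI.
rewrite [X in measurable X](_ : _ = \bigcup_(k in B) (first_letter @^-1` [set k])); last first.
  by apply/seteqP; split=> [x Bx|x [k Bk /= ->]//]; exists (first_letter x).
apply: bigcup_measurable => k _.
pose cl : set R := [set` `[cell_left k, cell_left k + geom k[].
rewrite [X in measurable X](_ : _ = cl `|` (~` [set` `[0, 1[] `&` [set x | first_letter x = k])).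
  apply: measurableU; first exact: measurable_itv.
  (* The default letter outside [[0, 1[] is 0: the preimage of 0 contains the whole complement, the
     other preimages do not meet it. *)
  have [k0|k0] := eqVneq k 0%N.
    rewrite setIidl; first exact: measurableC.
    move=> x /= xn; rewrite k0 /first_letter; case: xgetP => // l _ /andP[l1 l2].
    exfalso; apply: xn; rewrite in_itv /=; have := cell_left_ge0 l; have := cell_right_le1 l.
    by move=> ? ?; apply/andP; split; lra.
  rewrite (_ : _ `&` _ = set0)//; apply/seteqP; split=> // x [/= xn xk].
  move: k0; rewrite -xk /first_letter; case: xgetP; last by rewrite eqxx.
  move=> l _ /andP[l1 l2]; exfalso; apply: xn; rewrite in_itv /=.
  have := cell_left_ge0 l; have := cell_right_le1 l.
  by move=> ? ?; apply/andP; split; lra.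
apply/seteqP; split=> x /=.
  move=> xk; have [x01|x01] := boolP (0 <= x < 1); last by right; split=> //; exact/negP.
  by left; rewrite /cl /= in_itv /= -xk; exact: first_letterP.
by case=> [|[]//]; rewrite /cl /= in_itv /=; exact: first_letterE.
Qed.

Lemma measurable_rescale : measurable_fun setT rescale.
Proof.
have mf (f : nat -> R) : measurable_fun setT (fun x => f (first_letter x)).
  exact: (measurableT_comp (f := f)) measurable_first_letter.
by apply: measurable_funM; [exact: measurable_funB|exact: (mf (fun k => (geom k)^-1))].
Qed.

Lemma measurable_expansion : measurable_fun setT expansion.
Proof.
apply: measurable_letters => n; apply: (measurableT_comp measurable_first_letter).
elim: n => [|n ih]; first exact: measurable_id.
exact: (measurableT_comp measurable_rescale).
Qed.

Definition unit_measure := mrestr (@lebesgue_measure R) (measurable_itv `[0, 1[%R).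

HB.instance Definition _ := Measure.on unit_measure.

Let unit_measureT : unit_measure setT = 1%E.
Proof. by rewrite /unit_measure /mrestr setTI lebesgue_measure_itv/= lte01 oppr0 adde0. Qed.

HB.instance Definition _ := Measure_isProbability.Build _ _ _ unit_measure unit_measureT.

Lemma unit_measure_prefix n c :
  unit_measure [set x | forall i, (i < n)%N -> expansion x i = c i] =
  (\prod_(i < n) geom (c i))%:E.
Proof.
rewrite /unit_measure /mrestr.
rewrite (_ : _ `&` _ = [set` `[prefix_left n c, prefix_left n c + \prod_(i < n) geom (c i)[ ]).
  rewrite lebesgue_measure_itv/= lte_fin ltrDl prefix_len_gt0; congr EFin; ring.
apply/seteqP; split=> x /=; rewrite !in_itv /=.
  by move=> [xc x01]; case: (expansion_prefixE x01 xc).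
by move=> /expansion_prefix[].
Qed.

(** The full prefix [c] is what makes the induction on [m] work: a letter in [s] lengthens the
    prefix, while a free letter is summed over all its values, whose weights [2^-(l+1)] add up to
    1. *)
Lemma unit_measure_partial_prefix (s : pred nat) (k : nat -> nat) (m : nat) : forall n c,
  unit_measure [set x | (forall i, (i < n)%N -> expansion x i = c i) /\
    (forall i, (n <= i < n + m)%N -> s i -> expansion x i = k i)] =
  (\prod_(i < n) geom (c i) * \prod_(n <= i < n + m | s i) geom (k i))%:E.
Proof.
elim: m => [|m ih] n c.
  rewrite addn0 big_geq// mulr1 -unit_measure_prefix; congr unit_measure.
  apply/seteqP; split=> x /=; first by case.
  by move=> xc; split=> // i /andP[ni]; rewrite ltnNge ni.
pose c' l i := if i == n then l else c i.
have c'E l i : (i < n)%N -> c' l i = c i by move=> hi; rewrite /c' ltn_eqF.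
have prodc' l : \prod_(i < n.+1) geom (c' l i) = \prod_(i < n) geom (c i) * geom l :> R.
  rewrite prefix_lenS {2}/c' eqxx; congr (_ * _); apply: eq_bigr => i _.
  by rewrite c'E.
have nE l x : (forall i, (i < n.+1)%N -> expansion x i = c' l i) <->
    expansion x n = l /\ forall i, (i < n)%N -> expansion x i = c i.
  split=> [H|[xl H] i].
    split=> [|i hi]; first by rewrite H// /c' eqxx.
    by rewrite H ?c'E// ltnW.
  rewrite ltnS leq_eqVlt => /predU1P[->|hi]; first by rewrite xl /c' eqxx.
  by rewrite H ?c'E.
have [sn|sn] := boolP (s n).
  rewrite big_ltn_cond ?sn; last by lia.
  rewrite mulrA -prodc' addnS -addSn -ih; congr unit_measure.
  apply/seteqP; split=> x /= [].
    move=> xc xs; split=> [|i hi]; last by apply: xs; lia.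
    by apply/nE; split=> //; apply: xs => //; lia.
  move=> /nE[xn xc] xs; split=> // i hi si; have [->//|ni] := eqVneq i n.
  by apply: xs => //; lia.
rewrite big_ltn_cond ?(negbTE sn); last by lia.
set q := \prod_(n.+1 <= i < _ | _) _.
pose A l := [set x | (forall i, (i < n.+1)%N -> expansion x i = c' l i) /\
    (forall i, (n.+1 <= i < n.+1 + m)%N -> s i -> expansion x i = k i)].
rewrite (_ : [set x | _] = \bigcup_l A l); last first.
  apply/seteqP; split=> x /=.
    move=> [xc xs]; exists (expansion x n) => //; split; first exact/nE.
    by move=> i hi; apply: xs; lia.
  move=> [l _ [/nE[xn xc] xs]]; split=> // i hi si.
  have [ni|ni] := eqVneq i n; first by rewrite ni (negbTE sn) in si.
  by apply: xs => //; lia.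
have mA l : measurable (A l).
  pose C : set (letters nat) := [set w | (forall i, (i < n.+1)%N -> w i = c' l i) /\
    (forall i, (n.+1 <= i < n.+1 + m)%N -> s i -> w i = k i)].
  apply: (measurable_preimage (B := C) measurable_expansion).
  apply: (@measurable_finite_letters _ (iota 0 (n.+1 + m))) => w w' ww' [w1 w2].
  by split=> i hi; rewrite -ww' ?mem_iota; [exact: w1|lia|exact: w2|lia].
have tA : trivIset setT A.
  apply/trivIsetP => l l' _ _ ll'; apply/seteqP; split=> // x [[/nE[xl _] _] [/nE[xl' _] _]].
  by move: ll'; rewrite -xl -xl' eqxx.
have AE l : unit_measure (A l) = ((\prod_(i < n) geom (c i) * q) / (2 ^ (l + 1))%:R)%:E.
  by rewrite ih prodc' /geom addn1 natrX /q addSn -addnS; congr EFin; ring.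
apply: (etrans (measure_bigcup unit_measure _ A (fun i _ => mA i) tA)).
apply/cvg_lim => //.
rewrite -[X in _ --> X%:E]divr1 -[X in _ / X](expr0 2).
have := @cvg_geometric_eseries_half R (\prod_(i < n) geom (c i) * q) 0.
apply: cvg_trans; rewrite /eseries /=; apply: near_eq_cvg; apply: nearW => N.
apply: eq_big => [i|i _]; last exact/esym/AE.
by rewrite in_setT.
Qed.

Lemma iid_expansion : iid (law unit_measure measurable_expansion).
Proof.
move=> s k us; rewrite lawE.
pose m := (\max_(i <- s) i.+1)%N.
have ms i : i \in s -> (i < m)%N by move=> si; exact: (@leq_bigmax_seq _ s xpredT succn).
have := @unit_measure_partial_prefix (fun i => i \in s) k m 0 (fun=> 0%N).
rewrite big_ord0 mul1r add0n.
rewrite [in RHS](_ : \prod_(0 <= i < m | i \in s) geom (k i) = \prod_(i <- s) geom (k i)); last first.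
  rewrite -big_filter; apply: perm_big; apply: uniq_perm => //; first by rewrite filter_uniq// iota_uniq.
  move=> i; rewrite mem_filter mem_index_iota /=.
  by have [/ms ->|//] := boolP (i \in s).
move=> <-; congr unit_measure; apply/seteqP; split=> x /=.
  by move=> xs; split=> // i _; exact: xs.
by move=> [_ xs] i si; apply: xs => //; rewrite ms.
Qed.

End Expansion.

(** A countable index set injects into [nat], and a subfamily of independent letters is again
    independent. *)
Lemma exists_iid (R : realType) (I : countType) : exists P : probability (letters I) R, iid P.
Proof.
exists (law (law (@unit_measure R) (@measurable_expansion R)) (measurable_reindex (@pickle I))).
apply: iid_law_reindex; first exact: (pcan_inj (@pickleK I)).
exact: iid_expansion.
Qed.

(** * Windows of integers and summable power weights *)

Definition window (m : nat) : pred int := fun i => - m%:Z <= i < m%:Z.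

(** [Negz k] is [-(k+1)], so this lists [[-m, m)] and pairs [k] with [-(k+1)]: two-sided sums become
    ordinary series ([sum_rows]). *)
Definition rows (m : nat) : seq int := map Posz (iota 0 m) ++ map Negz (iota 0 m).

Lemma uniq_rows m : uniq (rows m).
Proof.
rewrite cat_uniq !map_inj_uniq ?iota_uniq ?andbT/=; try by move=> ? ? [].
by apply/hasPn => _ /mapP[k _ ->]; apply/negP => /mapP[].
Qed.

Lemma mem_rows m i : (i \in rows m) = window m i.
Proof.
rewrite mem_cat /window; apply/orP/idP => [[] /mapP[k]|].
- by rewrite mem_iota /= => km ->; lia.
- by rewrite mem_iota /= => km ->; lia.
case: i => k hk; [left|right]; apply: map_f; rewrite mem_iota /=; lia.
Qed.

Lemma sum_rows (V : nmodType) (a : int -> V) m :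
  \sum_(i <- rows m) a i = \sum_(0 <= k < m) (a (Posz k) + a (Negz k)).
Proof. by rewrite big_cat !big_map big_split /index_iota subn0. Qed.

Section PowerWeights.
Variables (R : realType) (alpha : R).
Hypothesis alpha1 : 1 < alpha.

Definition weight (k : nat) : R := k.+1%:R `^ (- alpha).

Definition zweight (i : int) : R := match i with Posz k => weight k | Negz k => weight k end.

(** Sum of the geometric series of ratio [2^(1 - alpha)], the dyadic upper bound for
    [zeta(alpha)]. *)
Definition zeta_bound : R := (1 - 2 `^ (1 - alpha))^-1.

Lemma weight_gt0 k : 0 < weight k. Proof. exact: powR_gt0. Qed.

Lemma zweight_gt0 i : 0 < zweight i. Proof. by case: i => k; exact: weight_gt0. Qed.

Lemma powRN_homo (x y : R) : 0 < x -> x <= y -> y `^ (- alpha) <= x `^ (- alpha).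
Proof.
move=> x0 xy; have a0 : 0 < alpha by exact: lt_trans alpha1.
rewrite !powRN lef_pV2 ?posrE ?powR_gt0//; last exact: lt_le_trans xy.
by rewrite ge0_ler_powR ?nnegrE ?(ltW x0) ?(ltW a0)// (le_trans (ltW x0)).
Qed.

Let r := 2 `^ (1 - alpha) : R.

Let r_lt1 : r < 1.
Proof.
rewrite /r /powR ifF ?pnatr_eq0// expR_lt1 nmulr_rlt0 ?subr_lt0//.
by apply: ln_gt0; rewrite ltr1n.
Qed.

Let r_gt0 : 0 < r. Proof. exact: powR_gt0. Qed.

(** Cauchy condensation: the block [[2^m - 1, 2^(m+1) - 1)] has [2^m] terms, each at most
    [(2^m)^-alpha]. *)
Lemma sum_weight_le n : \sum_(0 <= k < n) weight k <= zeta_bound.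
Proof.
have w0 k : 0 <= weight k by exact/ltW/weight_gt0.
have dy m : \sum_(0 <= k < (2 ^ m).-1) weight k <= \sum_(0 <= j < m) r ^+ j.
  elim: m => [|m ih]; first by rewrite !big_geq.
  have p0 : (0 < 2 ^ m)%N by rewrite expn_gt0.
  rewrite (@big_cat_nat _ _ _ (2 ^ m).-1)//=; last by rewrite expnS; lia.
  rewrite big_nat_recr//= lerD//.
  apply: (@le_trans _ _ (\sum_((2 ^ m).-1 <= k < (2 ^ m.+1).-1) (2 ^ m)%:R `^ (- alpha))).
    apply: ler_sum_nat => k /andP[k1 _]; apply: powRN_homo; first by rewrite ltr0n.
    by rewrite ler_nat; lia.
  rewrite sumr_const_nat (_ : (_ - _)%N = (2 ^ m)%N); last by rewrite expnS; lia.
  rewrite [leLHS](_ : _ = (2 ^ m)%:R `^ 1 * (2 ^ m)%:R `^ (- alpha)); last first.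
    by rewrite powRr1 ?ler0n// mulr_natl.
  rewrite -powRD; last by rewrite pnatr_eq0 -lt0n p0 implybT.
  by rewrite natrX -powR_mulrn// -powRrM mulrC powRrM powR_mulrn// powR_ge0.
have geo m : \sum_(0 <= j < m) r ^+ j <= zeta_bound.
  rewrite /zeta_bound -/r -[leRHS]mul1r ler_pdivlMr ?subr_gt0//.
  have -> : (\sum_(0 <= j < m) r ^+ j) * (1 - r) = 1 - r ^+ m.
    elim: m => [|m ih]; first by rewrite big_geq// mul0r expr0 subrr.
    by rewrite big_nat_recr//= mulrDl ih exprS; ring.
  by rewrite gerBl exprn_ge0// ltW.
apply: le_trans (le_trans (dy n) (geo n)).
have nn : (n <= (2 ^ n).-1)%N by have := ltn_expl n (ltnSn 1); lia.
by rewrite [leRHS](@big_cat_nat _ _ _ n)//= lerDl sumr_ge0.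
Qed.

Lemma zeta_bound_ge1 : 1 <= zeta_bound.
Proof.
have := sum_weight_le 1; rewrite big_nat1; apply: le_trans.
by rewrite /weight powR1.
Qed.

Lemma sum_zweight_le (s : seq int) : uniq s -> \sum_(i <- s) zweight i <= 2 * zeta_bound.
Proof.
move=> us.
have [n sn] : exists n, forall i, i \in s -> (`|i| < n)%N.
  exists (\max_(i <- s) (absz i).+1)%N => i si.
  exact: (@leq_bigmax_seq _ s xpredT (fun i => (absz i).+1)).
have st : {subset s <= rows n} by move=> i /sn; rewrite mem_rows /window; lia.
apply: (@le_trans _ _ (\sum_(i <- rows n) zweight i)).
  rewrite [leRHS](bigID (mem s))/=.
  rewrite (_ : \sum_(i <- rows n | i \in s) zweight i = \sum_(i <- s) zweight i); last first.
    rewrite -big_filter; apply: perm_big; apply: uniq_perm; rewrite ?filter_uniq ?uniq_rows// => i.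
    by rewrite mem_filter; have [/st ->|//] := boolP (i \in s).
  by rewrite lerDl sumr_ge0// => i _; exact/ltW/zweight_gt0.
rewrite sum_rows big_split mulr2n mulrDl mul1r.
by rewrite lerD//; exact: sum_weight_le.
Qed.

Definition conv_const : R := 2 `^ alpha * (4 * zeta_bound).

Lemma conv_const_ge0 : 0 <= conv_const.
Proof.
rewrite mulr_ge0 ?powR_ge0// mulr_ge0//; exact: le_trans zeta_bound_ge1.
Qed.

(** One of [i] and [i - n] lies at distance at least [n/2] from 0, so one weight is at most
    [2^alpha n^-alpha] and the other is summed. *)
Lemma sum_zweight_conv (n : nat) (s : seq int) : (0 < n)%N -> uniq s ->
  \sum_(i <- s) zweight i * zweight (i - n%:Z) <= conv_const * n%:R `^ (- alpha).
Proof.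
move=> n0 us.
pose m := 2 `^ alpha * n%:R `^ (- alpha) : R.
have m0 : 0 <= m by rewrite mulr_ge0 ?powR_ge0.
(* With this correction [zweight i] is [(|i| + c i)^-alpha] on both sides, because [|Negz k|] is
   already [k+1]. *)
pose c (i : int) : R := if i is Posz _ then 1 else 0.
have c0 i : 0 <= c i by case: i.
have small (i : int) : n%:R / 2 <= (absz i)%:R + c i -> zweight i <= m.
  move=> hi.
  have -> : m = (n%:R / 2) `^ (- alpha).
    rewrite /m powRM// ?invr_ge0// -[2^-1](@powR_inv1 R 2)// -powRrM mulrC.
    by congr (_ * 2 `^ _); ring.
  have n2 : 0 < n%:R / 2 :> R by rewrite divr_gt0// ltr0n.
  have := powRN_homo n2 hi.
  case: i {hi} => k /=; rewrite /weight.
    by rewrite -(natr1 k).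
  by rewrite addr0.
have small2 (i : int) : zweight i * zweight (i - n%:Z) <= m * (zweight i + zweight (i - n%:Z)).
  have z1 := zweight_gt0 i; have z2 := zweight_gt0 (i - n%:Z).
  have [h|h] := leP (n%:R / 2) ((absz i)%:R + c i).
    by have := small _ h => ?; nra.
  have h2 : n%:R / 2 <= (absz (i - n%:Z))%:R + c (i - n%:Z).
    have h3 : n%:R <= (absz i)%:R + (absz (i - n%:Z))%:R :> R.
      by rewrite -natrD ler_nat; lia.
    have h4 := c0 i; have h5 := c0 (i - n%:Z).
    by clear -h h3 h4 h5; clearbody c; lra.
  by have := small _ h2 => ?; nra.
apply: le_trans (ler_sum _ (fun i _ => small2 i)) _.
rewrite -mulr_sumr big_split/=.
have h1 := sum_zweight_le us.
have h2 : \sum_(i <- s) zweight (i - n%:Z) <= 2 * zeta_bound.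
  rewrite -(big_map (fun i => i - n%:Z) xpredT zweight).
  by apply: sum_zweight_le; rewrite map_inj_uniq// => x y; lia.
rewrite (_ : conv_const * _ = m * (4 * zeta_bound)); last by rewrite /conv_const mulrAC.
by rewrite ler_wpM2l//; lra.
Qed.

End PowerWeights.

Lemma cvg_dist_le (R : realType) (u v : nat -> R) (l : R) :
  (forall n, `|u n - l| <= v n) -> v @ \oo --> (0 : R) -> u @ \oo --> l.
Proof.
move=> uv /cvgrPdist_lt v0; apply/cvgrPdist_lt => e /v0; apply: filterS => n.
rewrite sub0r normrN distrC; apply: le_lt_trans.
exact: le_trans (uv n) (ler_norm _).
Qed.

Lemma eq_cvgn (T : topologicalType) (u v : nat -> T) (l : T) :
  u =1 v -> v @ \oo --> l -> u @ \oo --> l.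
Proof. by move=> /funext ->. Qed.

(** * The L^2 seminorm and passage to the limit in products *)

Section CauchySchwarz.
Context d (T : measurableType d) (R : realType) (P : probability T R).
Implicit Types F G : T -> R.

Definition norm2 F := Num.sqrt (mean P (fun w => F w ^+ 2)).

Lemma norm2_ge0 F : 0 <= norm2 F. Proof. exact: sqrtr_ge0. Qed.

Lemma sqr_norm2 F : norm2 F ^+ 2 = mean P (fun w => F w ^+ 2).
Proof. by rewrite sqr_sqrtr// mean_ge0// => w; exact: sqr_ge0. Qed.

Lemma norm2_le F (a : R) : 0 <= a -> (norm2 F <= a) = (mean P (fun w => F w ^+ 2) <= a ^+ 2).
Proof. by move=> a0; rewrite -sqr_norm2 ler_sqr// nnegrE norm2_ge0. Qed.

Lemma mean_mul_norm2 F G : L2 P F -> L2 P G ->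
  `|mean P (fun w => F w * G w)| <= norm2 F * norm2 G.
Proof.
move=> iF iG; have F0 := norm2_ge0 F; have G0 := norm2_ge0 G.
apply/ler_addgt0Pr => e e0.
(* [mean_mul_le] wants positive bounds, so both norms are enlarged by [t]; as [t <= 1], the product
   grows by at most [t (norm2 F + norm2 G + 1) <= e]. *)
pose t := Num.min 1 (e / (norm2 F + norm2 G + 1)).
have s0 : 0 < norm2 F + norm2 G + 1 by lra.
have t0 : 0 < t by rewrite lt_min ltr01 divr_gt0.
have t1 : t <= 1 by rewrite ge_min lexx.
have te : t * (norm2 F + norm2 G + 1) <= e by rewrite -ler_pdivlMr// ge_min lexx orbT.
have := @mean_mul_le _ _ _ P F G (norm2 F + t) (norm2 G + t) iF iG.
rewrite -!norm2_le; [|by lra..].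
move=> /(_ _ _ _ _)/le_trans; apply; [lra|lra|lra|lra|].
clearbody t; nra.
Qed.

Lemma norm_mean_norm2 F : L2 P F -> `|mean P F| <= norm2 F.
Proof.
move=> iF; have n1 : norm2 (fun=> 1) = 1.
  rewrite /norm2 (_ : (fun=> _) = fun=> 1) ?mean_cst ?sqrtr1//.
  by apply: funext => w; rewrite expr1n.
have := mean_mul_norm2 iF (L2_cst P 1); rewrite n1 mulr1.
by rewrite (_ : (fun w => F w * 1) = F)//; apply: funext => w; rewrite mulr1.
Qed.

Lemma norm2_triangle F G : L2 P F -> L2 P G ->
  norm2 (fun w => F w + G w) <= norm2 F + norm2 G.
Proof.
move=> iF iG; rewrite norm2_le ?addr_ge0 ?norm2_ge0//.
rewrite [X in mean P X](_ : _ = fun w => F w ^+ 2 + 2 * (F w * G w) + G w ^+ 2); last first.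
  by apply: funext => w; ring.
have [_ iF2] := iF; have [_ iG2] := iG; have iFG := L2_mul iF iG.
have iZ := L1Z 2 iFG.
rewrite meanD//; last exact: L1D.
rewrite meanD// meanZ// -!sqr_norm2.
have := le_trans (ler_norm _) (mean_mul_norm2 iF iG).
have := norm2_ge0 F; have := norm2_ge0 G; nra.
Qed.

Lemma mean_mul_diff F G F' G' : L2 P F -> L2 P G -> L2 P F' -> L2 P G' ->
  `|mean P (fun w => F' w * G' w) - mean P (fun w => F w * G w)| <=
  norm2 (fun w => F' w - F w) * norm2 (fun w => G' w - G w) +
  norm2 (fun w => F' w - F w) * norm2 G + norm2 F * norm2 (fun w => G' w - G w).
Proof.
move=> iF iG iF' iG'; have iF'F := L2B iF' iF; have iG'G := L2B iG' iG.
rewrite (_ : _ - _ = mean P (fun w => (F' w - F w) * (G' w - G w)) +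
  mean P (fun w => (F' w - F w) * G w) + mean P (fun w => F w * (G' w - G w))); last first.
  have i1 := L2_mul iF'F iG'G; have i2 := L2_mul iF'F iG; have i3 := L2_mul iF iG'G.
  rewrite -meanD// -meanD//; last exact: L1D.
  rewrite -meanB; [|exact: L2_mul..].
  by congr mean; apply: funext => w; ring.
apply: le_trans (ler_normD _ _) _; apply: lerD; last exact: mean_mul_norm2.
by apply: le_trans (ler_normD _ _) _; apply: lerD; exact: mean_mul_norm2.
Qed.

Lemma cvg_mean_mul (F G : nat -> T -> R) F0 G0 :
  L2 P F0 -> L2 P G0 -> (forall n, L2 P (F n)) -> (forall n, L2 P (G n)) ->
  (fun n => norm2 (fun w => F n w - F0 w)) @ \oo --> (0 : R) ->
  (fun n => norm2 (fun w => G n w - G0 w)) @ \oo --> (0 : R) ->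
  (fun n => mean P (fun w => F n w * G n w)) @ \oo --> mean P (fun w => F0 w * G0 w).
Proof.
move=> iF0 iG0 iF iG cF cG.
apply: (cvg_dist_le (fun n => mean_mul_diff iF0 iG0 (iF n) (iG n))).
rewrite [X in _ --> X](_ : 0 = 0 * 0 + 0 * norm2 G0 + norm2 F0 * 0); last by ring.
by apply: cvgD; [apply: cvgD; [exact: cvgM|exact: cvgMl]|exact: cvgMr].
Qed.

Lemma cvg_mean_norm2 (F : nat -> T -> R) F0 : L2 P F0 -> (forall n, L2 P (F n)) ->
  (fun n => norm2 (fun w => F n w - F0 w)) @ \oo --> (0 : R) ->
  (fun n => mean P (F n)) @ \oo --> mean P F0.
Proof.
move=> iF0 iF; apply: cvg_dist_le => n.
rewrite -meanB; [|exact: L2_L1..].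
by apply: norm_mean_norm2; exact: L2B.
Qed.

End CauchySchwarz.

(** * Gaussian averages: semigroup property and moments *)

Section Gaussian.
Variable R : realType.
Local Notation leb := (@lebesgue_measure R).

Definition gauss : probability (measurableTypeR R) R := normal_prob (0 : R) 1.

(** The Radon-Nikodym derivative and [normal_pdf] have the same integral over every measurable set,
    hence agree almost everywhere. *)
Lemma integral_normal_prob (m s : R) (f : R -> \bar R) :
  measurable_fun setT f -> (forall x, 0 <= f x)%E ->
  (\int[normal_prob m s]_x f x = \int[leb]_x (f x * (normal_pdf m s x)%:E))%E.
Proof.
move=> mf f0; have dom := normal_prob_dominates m s.
rewrite -(@Radon_Nikodym_SigmaFinite.change_of_variables _ _ _ (normal_prob m s) leb dom f setT)//.
have pE : ae_eq leb setT (Radon_Nikodym_SigmaFinite.f (normal_prob m s) leb) (EFin \o normal_pdf m s).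
  apply: integral_ae_eq => //.
  - exact: Radon_Nikodym_SigmaFinite.f_integrable.
  - by apply/measurable_EFinP; exact: measurable_normal_pdf.
  - by move=> E _ mE; rewrite -Radon_Nikodym_SigmaFinite.f_integral.
apply: ae_eq_integral => //.
- apply: emeasurable_funM => //.
  exact: measurable_int (Radon_Nikodym_SigmaFinite.f_integrable _).
- apply: emeasurable_funM => //; apply/measurable_EFinP; exact: measurable_normal_pdf.
- exact: ae_eqe_mul2l.
Qed.

Lemma continuous_affine (m s : R) : continuous (fun z : R => m + s * z).
Proof. by move=> z; apply: cvgD; [exact: cvg_cst|apply: cvgM; [exact: cvg_cst|exact: cvg_id]]. Qed.

Lemma integral_affine (m s : R) (G : R -> R) : 0 < s -> continuous G -> (forall x, 0 <= G x) ->
  (\int[leb]_x (G x)%:E = \int[leb]_z (G (m + s * z) * s)%:E)%E.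
Proof.
move=> s0 cG G0.
have dF (x : R) : is_derive x 1 (fun z : R => m + s * z) s.
  by apply: is_derive_eq; rewrite /GRing.scale/=; ring.
have F'E : (fun z : R => m + s * z)^`()%classic = cst s.
  by apply: funext => x; rewrite derive1E; case: (dF x).
rewrite (@increasing_ge0_integration_by_substitutionT R (fun z => m + s * z) G) ?F'E//.
- by move=> x y xy; rewrite ltrD2l ltr_pM2l.
- by move=> x; exact: cvg_cst.
- exact: is_cvg_cst.
- exact: is_cvg_cst.
- apply/cvgrNyPle => A; near=> x.
  rewrite -lerBrDl -ler_pdivlMl//; near: x; apply: nbhs_ninfty_le; exact: num_real.
- apply/cvgryPge => A; near=> x.
  rewrite -lerBlDl -ler_pdivrMl//; near: x; apply: nbhs_pinfty_ge; exact: num_real.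
Unshelve. all: by end_near. Qed.

Lemma normal_pdf_gt0E (m s x : R) : 0 < s ->
  normal_pdf m s x = normal_peak s * expR (- (x - m) ^+ 2 / (s ^+ 2 *+ 2)).
Proof. by move=> s0; rewrite normal_pdfE ?gt_eqF. Qed.

Lemma normal_peakM (s t : R) : 0 < s -> normal_peak (s * t) = s^-1 * normal_peak t.
Proof.
move=> s0; rewrite /normal_peak exprMn -mulrA -mulrnAr sqrtrM ?sqr_ge0//.
by rewrite sqrtr_sqr gtr0_norm// invfM.
Qed.

Lemma normal_pdf_affine (m s z : R) : 0 < s ->
  normal_pdf m s (m + s * z) * s = normal_pdf 0 1 z.
Proof.
move=> s0; rewrite !normal_pdf_gt0E// -(mulr1 s) normal_peakM// mulr1 subr0.
rewrite addrC addKr (_ : - (s * z) ^+ 2 / _ = - z ^+ 2 / (1 ^+ 2 *+ 2)).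
  by field; rewrite gt_eqF.
by field; rewrite gt_eqF.
Qed.

Lemma integral_gauss_affine (m s : R) (h : R -> R) : 0 < s -> continuous h ->
  (forall x, 0 <= h x) ->
  (\int[gauss]_z (h (m + s * z))%:E = \int[leb]_x (h x * normal_pdf m s x)%:E)%E.
Proof.
move=> s0 ch h0; have ca := @continuous_affine m s.
rewrite integral_normal_prob; last 2 first.
- apply/measurable_EFinP; apply: continuous_measurable_fun => z.
  by apply: (continuous_comp (ca z)); exact: ch.
- by move=> z; rewrite lee_fin.
rewrite [RHS](@integral_affine m s)//.
- apply: eq_integral => z _; rewrite -EFinM -(normal_pdf_affine m z s0); congr EFin; ring.
- by move=> x; apply: cvgM; [exact: ch|apply: continuous_normal_pdf; rewrite gt_eqF].
- by move=> x; rewrite mulr_ge0// normal_pdf_ge0.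
Qed.

(* Completing the square. *)
Lemma normal_pdf_mul (x a b w z : R) : 0 < a -> 0 < b ->
  let c := Num.sqrt (a ^+ 2 + b ^+ 2) in
  normal_pdf (x + a * z) b w * normal_pdf 0 1 z =
  normal_pdf x c w * normal_pdf ((w - x) * a / c ^+ 2) (b / c) z.
Proof.
move=> a0 b0 c; have c2 : c ^+ 2 = a ^+ 2 + b ^+ 2.
  by rewrite sqr_sqrtr// addr_ge0 ?sqr_ge0.
have c0 : 0 < c by rewrite sqrtr_gt0 addr_gt0// exprn_gt0.
rewrite !normal_pdf_gt0E ?divr_gt0//.
have -> : normal_peak (b / c) = normal_peak 1 * (c / b) :> R.
  by rewrite -[b / c]mulr1 normal_peakM ?divr_gt0// invf_div mulrC.
have -> : normal_peak b = normal_peak 1 / b :> R by rewrite -[b in LHS]mulr1 normal_peakM// mulrC.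
have -> : normal_peak c = normal_peak 1 / c :> R by rewrite -[c in LHS]mulr1 normal_peakM// mulrC.
rewrite mulrACA -expRD [RHS]mulrACA -expRD; congr (_ * expR _).
  by field; rewrite !gt_eqF.
have c20 : 0 < c ^+ 2 by rewrite exprn_gt0.
rewrite expr_div_n c2; rewrite c2 in c20.
by field; rewrite !gt_eqF.
Qed.

(** Variances of independent Gaussians add. Positivity of [h] allows Tonelli; after completing the
    square the inner integral is that of a normal density, equal to 1. *)
Lemma integral_gauss_semigroup (a b x : R) (h : R -> R) : 0 < a -> 0 < b ->
  continuous h -> (forall y, 0 <= h y) ->
  (\int[gauss]_z \int[gauss]_z' (h (x + a * z + b * z'))%:E =
   \int[gauss]_z (h (x + Num.sqrt (a ^+ 2 + b ^+ 2) * z))%:E)%E.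
Proof.
move=> a0 b0 ch h0; set c := Num.sqrt _.
have c0 : 0 < c by rewrite sqrtr_gt0 addr_gt0// exprn_gt0.
rewrite (integral_gauss_affine x c0 ch h0).
under eq_integral do rewrite (integral_gauss_affine _ b0 ch h0).
have mh : measurable_fun setT h by exact: continuous_measurable_fun.
pose f (zw : R * R) := h zw.2 * normal_pdf (x + a * zw.1) b zw.2.
have mf : measurable_fun setT f.
  apply: measurable_funM; first exact: measurableT_comp.
  rewrite (_ : (fun _ => _) = fun zw : R * R => normal_pdf 0 b (zw.2 - (x + a * zw.1))).
    apply: (measurableT_comp (measurable_normal_pdf 0 b)).
    apply: measurable_funB => //; apply: measurable_funD => //.
    exact: measurable_funM.
  by apply: funext => -[z w] /=; rewrite !normal_pdf_gt0E// subr0.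
have mEf : measurable_fun setT (EFin \o f) by exact/measurable_EFinP.
have f0 zw : (0 <= (EFin \o f) zw)%E by rewrite lee_fin mulr_ge0// normal_pdf_ge0.
transitivity (\int[leb]_w \int[gauss]_z (f (z, w))%:E)%E.
  exact: (@fubini_tonelli _ _ (measurableTypeR R) (measurableTypeR R) R gauss leb (EFin \o f) mEf f0).
apply: eq_integral => w _.
rewrite integral_normal_prob; last 2 first.
- exact: (measurableT_comp mEf (pair2_measurable w)).
- by move=> z; exact: (f0 (z, w)).
rewrite /f /=.
under eq_integral => z _.
  rewrite -EFinM -mulrA normal_pdf_mul// -/c mulrA EFinM; over.
rewrite ge0_integralZl//.
- by rewrite integral_normal_pdf mule1.
- by apply/measurable_EFinP; exact: measurable_normal_pdf.
- by move=> z _; rewrite lee_fin normal_pdf_ge0.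
- by rewrite lee_fin mulr_ge0// normal_pdf_ge0.
Qed.

Lemma mean_EFin (d : measure_display) (T : measurableType d) (P : probability T R) (F : T -> R) : L1 P F ->
  (\int[P]_x (F x)%:E = (mean P F)%:E)%E.
Proof. by move=> iF; rewrite /mean /Rintegral fineK//; exact: integrable_fin_num. Qed.

Lemma bdd_affine (h : R -> R) (m s : R) : continuous h -> (exists M, forall x, `|h x| <= M) ->
  bdd (fun z : measurableTypeR R => h (m + s * z)).
Proof.
move=> ch [M hM]; split; last by exists M.
apply: continuous_measurable_fun => z.
by apply: (continuous_comp (@continuous_affine m s z)); exact: ch.
Qed.

(** The heat semigroup, parametrised by the standard deviation [a]; the degenerate value [a = 0] is
    included and gives [h] back. *)
Definition gauss_avg (a : R) (h : R -> R) (x : R) : R := mean gauss (fun z => h (x + a * z)).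

Lemma gauss_avg0 h x : gauss_avg 0 h x = h x.
Proof.
rewrite /gauss_avg (_ : (fun z => _) = fun=> h x) ?mean_cst//.
by apply: funext => z; rewrite mul0r addr0.
Qed.

Lemma gauss_expectE (s : R) (h : R -> R) : 0 <= s -> continuous h ->
  (exists M, forall x, `|h x| <= M) -> gauss_expect s h = gauss_avg s h 0.
Proof.
move=> s0 ch [M hM]; rewrite /gauss_expect; case: eqVneq => [->|sn0].
  by rewrite gauss_avg0.
have {sn0} s_gt0 : 0 < s by rewrite lt_neqAle eq_sym sn0.
have hM' x : - M <= h x <= M by rewrite -ler_norml.
(* The shift by [M] makes the function nonnegative, as the change of variables requires; its
   contribution is subtracted at the end. *)
pose g x := h x + M.
have cg : continuous g by move=> x; apply: cvgD; [exact: ch|exact: cvg_cst].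
have g0 x : 0 <= g x by have /andP[] := hM' x; rewrite /g; lra.
have iA : L1 gauss (fun z => h (0 + s * z)) by apply: L1_bdd; apply: bdd_affine => //; exists M.
have e := integral_gauss_affine 0 s_gt0 cg g0.
have iB : L1 gauss (fun z => g (0 + s * z)) by apply: L1D => //; exact: L1_cst.
rewrite mean_EFin// in e.
have mp := @measurable_normal_pdf R 0 s.
have mg : measurable_fun setT g by exact: continuous_measurable_fun.
have mh : measurable_fun setT h by exact: continuous_measurable_fun.
have ip := @integrable_normal_pdf R 0 s.
have ig : leb.-integrable setT (EFin \o (fun x => g x * normal_pdf 0 s x)).
  apply/integrableP; split; first by apply/measurable_EFinP; exact: measurable_funM.
  under eq_integral => x _ do rewrite /= ger0_norm ?mulr_ge0 ?normal_pdf_ge0//.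
  by rewrite -e ltry.
have iMp : leb.-integrable setT (EFin \o (fun x => M * normal_pdf 0 s x)).
  exact: (integrableZl _ M ip).
rewrite (_ : (fun x => _) = fun x => g x * normal_pdf 0 s x - M * normal_pdf 0 s x); last first.
  by apply: funext => x; rewrite /g; ring.
rewrite RintegralB// RintegralZl// /Rintegral -e /= integral_normal_pdf /= mulr1.
rewrite (_ : (fun z => _) = fun z => h (0 + s * z) + M)//.
by rewrite meanD ?mean_cst ?addrK//; exact: L1_cst.
Qed.

Lemma gauss_avg_semigroup (a b : R) (h : R -> R) (x : R) : 0 <= a -> 0 <= b ->
  continuous h -> (exists M, forall x, `|h x| <= M) -> continuous (gauss_avg b h) ->
  gauss_avg a (gauss_avg b h) x = gauss_avg (Num.sqrt (a ^+ 2 + b ^+ 2)) h x.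
Proof.
move=> a0 b0 ch [M hM] cGh.
have [->|an0] := eqVneq a 0.
  by rewrite gauss_avg0 expr0n add0r sqrtr_sqr ger0_norm.
have [->|bn0] := eqVneq b 0.
  rewrite expr0n addr0 sqrtr_sqr ger0_norm//; congr mean; apply: funext => z.
  by rewrite gauss_avg0.
have {a0 an0} a0 : 0 < a by rewrite lt_neqAle eq_sym an0.
have {b0 bn0} b0 : 0 < b by rewrite lt_neqAle eq_sym bn0.
have hM' y : - M <= h y <= M by rewrite -ler_norml.
pose g y := h y + M.
have cg : continuous g by move=> y; apply: cvgD; [exact: ch|exact: cvg_cst].
have g0 y : 0 <= g y by have /andP[] := hM' y; rewrite /g; lra.
have i1 y c : L1 gauss (fun z => h (y + c * z)).
  by apply: L1_bdd; apply: bdd_affine => //; exists M.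
have i1g y c : L1 gauss (fun z => g (y + c * z)) by apply: L1D => //; exact: L1_cst.
have mgE y c : mean gauss (fun z => g (y + c * z)) = gauss_avg c h y + M.
  by rewrite meanD ?mean_cst//; exact: L1_cst.
have i2 : L1 gauss (fun z => gauss_avg b h (x + a * z)).
  apply: L1_bdd; apply: bdd_affine => //; exists M => y.
  by apply: norm_mean_cst.
have := integral_gauss_semigroup x a0 b0 cg g0.
under eq_integral => z _ do rewrite mean_EFin// mgE.
rewrite !mean_EFin//; last by apply: L1D => //; exact: L1_cst.
rewrite mgE meanD ?mean_cst//; last exact: L1_cst.
by move=> [] /addIr.
Qed.

(** The standard density times [e^(tz)] is [e^(t^2/2)] times the density centred at [t]. All moments
    needed below are extracted from this identity. *)
Lemma L1_gauss_exp (t : R) : L1 gauss (fun z => expR (t * z)) /\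
  mean gauss (fun z => expR (t * z)) = expR (t ^+ 2 / 2).
Proof.
have mf : measurable_fun setT (fun z : measurableTypeR R => expR (t * z)).
  by apply: measurableT_comp => //; exact: measurable_funM.
have e : (\int[gauss]_z (expR (t * z))%:E = (expR (t ^+ 2 / 2))%:E)%E.
  rewrite integral_normal_prob; last 2 first.
  - exact/measurable_EFinP.
  - by move=> z; rewrite lee_fin expR_ge0.
  transitivity (\int[leb]_z ((expR (t ^+ 2 / 2))%:E * (normal_pdf t 1 z)%:E))%E.
    apply: eq_integral => z _; rewrite -!EFinM !normal_pdf_gt0E//; congr EFin.
    rewrite mulrCA -expRD [RHS]mulrCA -expRD.
    by congr (_ * expR _); field.
  rewrite ge0_integralZl//.
  - by rewrite integral_normal_pdf mule1.
  - by apply/measurable_EFinP; exact: measurable_normal_pdf.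
  - by move=> z _; rewrite lee_fin normal_pdf_ge0.
have i : L1 gauss (fun z => expR (t * z)).
  apply/integrableP; split; first exact/measurable_EFinP.
  under eq_integral => x _ do rewrite /= ger0_norm ?expR_ge0//.
  by rewrite e ltry.
by split=> //; move: e; rewrite mean_EFin// => -[].
Qed.

Lemma exp_normD_ge (z : R) n : `|z| ^+ n / n`!%:R <= expR z + expR (- z).
Proof.
apply: (@le_trans _ _ (expR `|z|)).
  case: n => [|n]; first by rewrite expr0 fact0 divr1 -expR0 ler_expR.
  by apply: le_trans (expR_ge1Dxn n (normr_ge0 z)); rewrite lerDr.
have := expR_ge0 z; have := expR_ge0 (- z).
by case: (ger0P z); lra.
Qed.

Lemma L1_gauss_norm n : L1 gauss (fun z => `|z| ^+ n).
Proof.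
have [i1 _] := L1_gauss_exp 1; have [i2 _] := L1_gauss_exp (-1).
have i := L1Z (n`!%:R) (L1D i1 i2).
apply: (L1_le _ i); first exact: (measurable_funX n (@normr_measurable R setT)).
move=> z; rewrite ger0_norm ?exprn_ge0// mul1r mulN1r -ler_pdivrMl ?ltr0n ?fact_gt0//.
by rewrite mulrC exp_normD_ge.
Qed.

Lemma L1_gauss_id : L1 gauss (fun z => z).
Proof.
by apply: (L1_le _ (L1_gauss_norm 1)) => // z; rewrite expr1.
Qed.

Lemma L1_gauss_sqr : L1 gauss (fun z => z ^+ 2).
Proof.
apply: (L1_le _ (L1_gauss_norm 2)); first exact: measurable_funX.
by move=> z; rewrite normrX.
Qed.

(** Integrating [1 + tz <= e^(tz)] gives [t m <= e^(t^2/2) - 1] for every [t]; the right side is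
    quadratic in small [t], which forces [m = 0]. *)
Lemma mean_gauss_id : mean gauss (fun z => z) = 0.
Proof.
set m := mean _ _.
have key (t : R) : t * m <= expR (t ^+ 2 / 2) - 1.
  have [i e] := L1_gauss_exp t; rewrite -e -meanZ; last exact: L1_gauss_id.
  rewrite -(mean_cst gauss 1) -meanB//; last exact: L1_cst.
  apply: le_mean; [exact/L1Z/L1_gauss_id|by apply: L1B => //; exact: L1_cst|move=> z].
  by have := expR_ge1Dx (t * z); lra.
apply/eqP; apply: contraT => m0; have m2 : 0 < m ^+ 2 by rewrite exprn_even_gt0.
(* key fails at t = c m for c small *)
pose c := expR (- m ^+ 2 / 2); have c0 : 0 < c := expR_gt0 _.
have c1 : c <= 1 by rewrite -expR0 ler_expR; lra.
have cm : (c * m) ^+ 2 / 2 <= m ^+ 2 / 2.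
  by rewrite ler_pM2r// exprMn ler_piMl ?expr_le1// ltW.
have := key (c * m); set u := _ / 2 in cm *.
(* Since [u <= m^2/2], this yields [e^u - 1 <= u e^u <= c m^2/2], whereas [key] at [c m] says
   [c m^2 <= e^u - 1]. *)
have cE : c * expR u <= 1 by rewrite -ler_pdivlMl// mulr1 -expRN ler_expR mulNr opprK.
have uE : expR u * u = c * expR u * (c * m ^+ 2 / 2) by rewrite /u exprMn; ring.
have cm2 : 0 < c * m ^+ 2 / 2 by rewrite divr_gt0// mulr_gt0.
have := ler_wpM2r (ltW cm2) cE; rewrite -uE mul1r.
have := expR_ge1Dx (- u); have := expRxMexpNx_1 u; have := expR_gt0 u.
move: (expR u) (expR (- u)) => x y x0 xy uy xu; rewrite (_ : c * m * m = c * m ^+ 2); last by ring.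
have := ler_wpM2l (ltW x0) uy; rewrite xy mulrDr mulr1 mulrN; lra.
Qed.

(** If the variance vanished, Cauchy-Schwarz would give [E (Z e^Z) = 0], but [z e^z >= e^z - 1] and
    [E e^Z = e^(1/2) > 1]. Positivity permits the division by the variance in [clt_sd]. *)
Lemma mean_gauss_sqr_gt0 : 0 < mean gauss (fun z => z ^+ 2).
Proof.
rewrite lt_neqAle mean_ge0 ?andbT; last by move=> z; exact: sqr_ge0.
apply/negP => /eqP v0; have [i1 e1] := L1_gauss_exp 1; have [i2 e2] := L1_gauss_exp 2.
have iz : L2 gauss (fun z => z) by split=> //; exact: L1_gauss_sqr.
have iE : L2 gauss (fun z => expR (1 * z)).
  split; first by case/integrableP: i1 => /measurable_EFinP.
  by rewrite (_ : (fun z => _) = fun z => expR (2 * z))//; apply: funext => z; rewrite -expRM_natl mul1r.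
have := mean_mul_norm2 iz iE; rewrite {1}/norm2 -v0 sqrtr0 mul0r => h.
have : mean gauss (fun z => expR (1 * z) - 1) <= mean gauss (fun z => z * expR (1 * z)).
  apply: le_mean; [by apply: L1B => //; exact: L1_cst|exact: L2_mul|move=> z; rewrite mul1r].
  have := expR_ge1Dx (- z); have := expRxMexpNx_1 z; have := expR_gt0 z.
  by move: (expR z) (expR (- z)) => x y; nra.
rewrite meanB//; last exact: L1_cst.
rewrite e1 mean_cst; have := expR_ge1Dx (1 ^+ 2 / 2 : R); have := ler_norm (mean gauss (fun z => z * expR (1 * z))).
by rewrite expr1n; lra.
Qed.

End Gaussian.

(** * Test functions with second-order Taylor bounds, and their Gaussian averages *)

Section SmoothFunctions.
Variable R : realType.
Implicit Types (h : R -> R) (L : R).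

(** [h1] and [h2] stand for [h'] and [h''], encoded by Taylor inequalities: such inequalities pass
    through an average with the same [L], so Gaussian averaging involves no differentiation under
    the integral. *)
Record smooth L h h1 h2 : Prop := Smooth {
  smooth_bound0 : forall x, `|h x| <= L;
  smooth_bound1 : forall x, `|h1 x| <= L;
  smooth_bound2 : forall x, `|h2 x| <= L;
  smooth_lip0 : forall x t, `|h (x + t) - h x| <= L * `|t|;
  smooth_lip1 : forall x t, `|h1 (x + t) - h1 x| <= L * `|t|;
  smooth_lip2 : forall x t, `|h2 (x + t) - h2 x| <= L * `|t|;
  smooth_taylor1 : forall x t, `|h1 (x + t) - h1 x - h2 x * t| <= L * `|t| ^+ 2;
  smooth_taylor0 : forall x t,
    `|h (x + t) - h x - h1 x * t - h2 x * (t ^+ 2 / 2)| <= L * `|t| ^+ 3 }.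

Lemma lip_continuous L h : (forall x t, `|h (x + t) - h x| <= L * `|t|) -> continuous h.
Proof.
move=> hL x; have L0 : 0 <= L by have := hL 0 1; rewrite normr1 mulr1; exact: le_trans.
have L1 : 0 < L + 1 by lra.
apply/cvgrPdist_lt => e e0; have d0 : 0 < e / (L + 1) by rewrite divr_gt0.
apply: filterS (nbhsx_ballx x _ d0) => y; rewrite /ball/= distrC => h2.
rewrite distrC -[y](subrKC x); apply: le_lt_trans (hL _ _) _.
rewrite ltr_pdivlMr// in h2; have := normr_ge0 (y - x); nra.
Qed.

Lemma smooth_ge0 L h h1 h2 : smooth L h h1 h2 -> 0 <= L.
Proof. by move=> sh; exact: le_trans (smooth_bound0 sh 0). Qed.

Lemma smooth_L1 L h h1 h2 a x : smooth L h h1 h2 ->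
  [/\ L1 (gauss R) (fun z => h (x + a * z)), L1 (gauss R) (fun z => h1 (x + a * z)) &
      L1 (gauss R) (fun z => h2 (x + a * z))].
Proof.
move=> sh; split; apply: L1_bdd; apply: bdd_affine.
- exact: lip_continuous (smooth_lip0 sh).
- by exists L; exact: smooth_bound0 sh.
- exact: lip_continuous (smooth_lip1 sh).
- by exists L; exact: smooth_bound1 sh.
- exact: lip_continuous (smooth_lip2 sh).
- by exists L; exact: smooth_bound2 sh.
Qed.

Lemma smooth_gauss_avg L h h1 h2 a : smooth L h h1 h2 ->
  smooth L (gauss_avg a h) (gauss_avg a h1) (gauss_avg a h2).
Proof.
move=> sh.
have i0 x : L1 (gauss R) (fun z => h (x + a * z)) by case: (smooth_L1 a x sh).
have i1 x : L1 (gauss R) (fun z => h1 (x + a * z)) by case: (smooth_L1 a x sh).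
have i2 x : L1 (gauss R) (fun z => h2 (x + a * z)) by case: (smooth_L1 a x sh).
have sE (x t z : R) : x + t + a * z = x + a * z + t by rewrite addrAC.
split.
- by move=> x; apply: norm_mean_cst => // z; exact: smooth_bound0 sh _.
- by move=> x; apply: norm_mean_cst => // z; exact: smooth_bound1 sh _.
- by move=> x; apply: norm_mean_cst => // z; exact: smooth_bound2 sh _.
- move=> x t; rewrite /gauss_avg -meanB//; apply: norm_mean_cst; first exact: L1B.
  by move=> z; rewrite sE; exact: smooth_lip0 sh _ _.
- move=> x t; rewrite /gauss_avg -meanB//; apply: norm_mean_cst; first exact: L1B.
  by move=> z; rewrite sE; exact: smooth_lip1 sh _ _.
- move=> x t; rewrite /gauss_avg -meanB//; apply: norm_mean_cst; first exact: L1B.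
  by move=> z; rewrite sE; exact: smooth_lip2 sh _ _.
- move=> x t; rewrite [_ * t]mulrC /gauss_avg -meanZ// -meanB// -meanB; [|exact: L1B|exact: L1Z].
  apply: norm_mean_cst; first by apply: L1B; [exact: L1B|exact: L1Z].
  by move=> z; rewrite sE [t * _]mulrC; exact: smooth_taylor1 sh _ _.
- move=> x t; rewrite [_ * t]mulrC [_ * (_ / _)]mulrC /gauss_avg -!meanZ// -meanB//.
  have j1 : L1 (gauss R) (fun z => h (x + t + a * z) - h (x + a * z)) by exact: L1B.
  have j2 : L1 (gauss R) (fun z => t * h1 (x + a * z)) by exact: L1Z.
  have j3 : L1 (gauss R) (fun z => t ^+ 2 / 2 * h2 (x + a * z)) by exact: L1Z.
  rewrite -meanB// -meanB//; last exact: L1B.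
  apply: norm_mean_cst; first by apply: L1B => //; exact: L1B.
  move=> z; rewrite sE [t * _]mulrC [_ / _ * _]mulrC; exact: smooth_taylor0 sh _ _.
Qed.

Definition gauss_var : R := mean (gauss R) (fun z => z ^+ 2).
Definition gauss_abs1 : R := mean (gauss R) (fun z => `|z|).
Definition gauss_abs3 : R := mean (gauss R) (fun z => `|z| ^+ 3).

(** One time step of the heat flow; the linear Taylor term disappears because the Gaussian is
    centred. *)
Lemma gauss_avg_taylor L h h1 h2 a x : smooth L h h1 h2 -> 0 <= a ->
  `|gauss_avg a h x - h x - h2 x * (a ^+ 2 * gauss_var / 2)| <= L * (a ^+ 3 * gauss_abs3).
Proof.
move=> sh a0; have [i0 _ _] := smooth_L1 a x sh.
have iz := L1_gauss_id R; have iz2 := L1_gauss_sqr R.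
have j1 : L1 (gauss R) (fun z => h1 x * a * z) by exact: L1Z.
have j2 : L1 (gauss R) (fun z => h2 x * (a ^+ 2 / 2) * z ^+ 2) by exact: L1Z.
have j0 : L1 (gauss R) (fun z => h (x + a * z) - h x) by apply: L1B => //; exact: L1_cst.
rewrite (_ : _ - _ - _ = mean (gauss R) (fun z => h (x + a * z) - h x -
    h1 x * a * z - h2 x * (a ^+ 2 / 2) * z ^+ 2)); last first.
  rewrite meanB//; last exact: L1B.
  rewrite meanB// meanB//; last exact: L1_cst.
  rewrite mean_cst !meanZ// mean_gauss_id mulr0 subr0 /gauss_avg /gauss_var; congr (_ - _); ring.
rewrite [leRHS]mulrA /gauss_abs3 -meanZ; last exact: L1_gauss_norm.
apply: norm_mean_le; [by apply: L1B => //; exact: L1B|exact/L1Z/L1_gauss_norm|move=> z].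
have := smooth_taylor0 sh x (a * z); rewrite normrM (ger0_norm a0) !exprMn mulrA.
by congr (`|_| <= _); ring.
Qed.

Lemma gauss_avg_lip L h h1 h2 a b x : smooth L h h1 h2 ->
  `|gauss_avg a h x - gauss_avg b h x| <= L * (`|a - b| * gauss_abs1).
Proof.
move=> sh; have [i0 _ _] := smooth_L1 a x sh; have [j0 _ _] := smooth_L1 b x sh.
have iN : L1 (gauss R) (fun z => `|z|) by apply: L1_norm; exact: L1_gauss_id.
rewrite /gauss_avg -meanB// [leRHS]mulrA /gauss_abs1 -meanZ//.
apply: norm_mean_le; [exact: L1B|exact: L1Z|move=> z].
have := smooth_lip0 sh (x + b * z) ((a - b) * z); rewrite normrM mulrA.
by congr (`|h _ - _| <= _); ring.
Qed.

Lemma gauss_abs1_ge0 : 0 <= gauss_abs1. Proof. by apply: mean_ge0. Qed.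
Lemma gauss_abs3_ge0 : 0 <= gauss_abs3. Proof. by apply: mean_ge0 => z; exact: exprn_ge0. Qed.

End SmoothFunctions.

(** * Smooth functions built from cubic splines *)

Section Staircases.
Variable R : realType.
Implicit Types (h : R -> R) (L : R).

Definition is_smooth h := exists L h1 h2, smooth L h h1 h2.

(** The missing Lipschitz bounds come from the Taylor bounds when [|t| <= 1], where at most three
    terms of size [L |t|] appear, and from the sup bounds when [|t| > 1]. *)
Lemma is_smooth_intro L h h1 h2 :
  (forall x, `|h x| <= L) -> (forall x, `|h1 x| <= L) -> (forall x, `|h2 x| <= L) ->
  (forall x t, `|h2 (x + t) - h2 x| <= L * `|t|) ->
  (forall x t, `|h1 (x + t) - h1 x - h2 x * t| <= L * `|t| ^+ 2) ->
  (forall x t, `|h (x + t) - h x - h1 x * t - h2 x * (t ^+ 2 / 2)| <= L * `|t| ^+ 3) ->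
  is_smooth h.
Proof.
move=> b0 b1 b2 l2 t1 t0; have L0 : 0 <= L by exact: le_trans (b0 0).
exists (3 * L), h1, h2; have LL : L <= 3 * L by lra.
have l1 x t : `|h1 (x + t) - h1 x| <= 3 * L * `|t|.
  have [t_1|/ltW t_1] := leP `|t| 1.
    have := t1 x t; have a : `|h2 x * t| <= L * `|t| by rewrite normrM ler_wpM2r.
    have b : `|t| ^+ 2 <= `|t| by rewrite expr2 ler_piMl.
    have c := ler_wpM2l L0 b => d; have e := mulr_ge0 L0 (normr_ge0 t).
    rewrite -(subrK (h2 x * t) (h1 (x + t) - h1 x)); apply: le_trans (ler_normD _ _) _; lra.
  have c := ler_wpM2l L0 t_1; have := le_trans (ler_normB _ _) (lerD (b1 (x + t)) (b1 x)); lra.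
have l0 x t : `|h (x + t) - h x| <= 3 * L * `|t|.
  have [t_1|/ltW t_1] := leP `|t| 1.
    have := t0 x t; have a : `|h1 x * t| <= L * `|t| by rewrite normrM ler_wpM2r.
    have b : `|t| ^+ 2 <= `|t| by rewrite expr2 ler_piMl.
    have b3 : `|t| ^+ 3 <= `|t|.
      by apply: le_trans b; rewrite exprS ler_piMl// exprn_ge0.
    have a2 : `|h2 x * (t ^+ 2 / 2)| <= L * `|t|.
      rewrite normrM ler_pM// normrM normrX (@ger0_norm _ 2^-1)//.
      by have := normr_ge0 t; lra.
    have c := ler_wpM2l L0 b3 => d; have e := mulr_ge0 L0 (normr_ge0 t).
    rewrite (_ : h (x + t) - h x = h (x + t) - h x - h1 x * t - h2 x * (t ^+ 2 / 2) +
      h1 x * t + h2 x * (t ^+ 2 / 2)); last by ring.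
    apply: le_trans (ler_normD _ _) _; apply: le_trans (lerD (ler_normD _ _) (lexx _)) _; lra.
  have c := ler_wpM2l L0 t_1; have := le_trans (ler_normB _ _) (lerD (b0 (x + t)) (b0 x)); lra.
split=> //.
- by move=> x; exact: le_trans (b0 x) LL.
- by move=> x; exact: le_trans (b1 x) LL.
- by move=> x; exact: le_trans (b2 x) LL.
- by move=> x t; apply: le_trans (l2 x t) _; rewrite ler_wpM2r.
- by move=> x t; apply: le_trans (t1 x t) _; rewrite ler_wpM2r// exprn_ge0.
- by move=> x t; apply: le_trans (t0 x t) _; rewrite ler_wpM2r// exprn_ge0.
Qed.

Lemma is_smooth_cst (c : R) : is_smooth (fun=> c).
Proof.
apply: (@is_smooth_intro `|c| _ (fun=> 0) (fun=> 0)) => // x; rewrite ?normr0//.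
- by move=> t; rewrite subrr normr0 mulr_ge0.
- by move=> t; rewrite mul0r !subrr normr0 mulr_ge0// exprn_ge0.
- by move=> t; rewrite !mul0r !subrr normr0 mulr_ge0// exprn_ge0.
Qed.

Lemma is_smoothD h g : is_smooth h -> is_smooth g -> is_smooth (fun x => h x + g x).
Proof.
move=> [L [h1 [h2 sh]]] [M [g1 [g2 sg]]].
apply: (@is_smooth_intro (L + M) _ (fun x => h1 x + g1 x) (fun x => h2 x + g2 x)).
- by move=> x; apply: le_trans (ler_normD _ _) (lerD (smooth_bound0 sh _) (smooth_bound0 sg _)).
- by move=> x; apply: le_trans (ler_normD _ _) (lerD (smooth_bound1 sh _) (smooth_bound1 sg _)).
- by move=> x; apply: le_trans (ler_normD _ _) (lerD (smooth_bound2 sh _) (smooth_bound2 sg _)).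
- move=> x t; rewrite [leRHS]mulrDl.
  apply: le_trans (lerD (smooth_lip2 sh x t) (smooth_lip2 sg x t)).
  by apply: le_trans (ler_normD _ _); rewrite le_eqVlt; apply/orP; left; apply/eqP; congr `|_|; ring.
- move=> x t; rewrite [leRHS]mulrDl.
  apply: le_trans (lerD (smooth_taylor1 sh x t) (smooth_taylor1 sg x t)).
  by apply: le_trans (ler_normD _ _); rewrite le_eqVlt; apply/orP; left; apply/eqP; congr `|_|; ring.
- move=> x t; rewrite [leRHS]mulrDl.
  apply: le_trans (lerD (smooth_taylor0 sh x t) (smooth_taylor0 sg x t)).
  by apply: le_trans (ler_normD _ _); rewrite le_eqVlt; apply/orP; left; apply/eqP; congr `|_|; ring.
Qed.

Lemma is_smooth_affine h (a c d : R) : is_smooth h -> is_smooth (fun x => a * h (c * x + d)).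
Proof.
move=> [L [h1 [h2 sh]]]; have L0 := smooth_ge0 sh.
have k0 : 0 <= `|c| by []. have a0 : 0 <= `|a| by [].
have k1 : `|c| ^+ 1 <= (1 + `|c|) ^+ 3.
  by apply: (@le_trans _ _ ((1 + `|c|) ^+ 1)); [rewrite !expr1; lra|rewrite ler_weXn2l//; lra].
have k2 : `|c| ^+ 2 <= (1 + `|c|) ^+ 3.
  apply: (@le_trans _ _ ((1 + `|c|) ^+ 2)); last by rewrite ler_weXn2l//; lra.
  by rewrite lerXn2r ?nnegrE//; lra.
have k3 : `|c| ^+ 3 <= (1 + `|c|) ^+ 3 by rewrite lerXn2r ?nnegrE//; lra.
have kk : 1 <= (1 + `|c|) ^+ 3 by rewrite exprn_ege1//; lra.
(* [(1 + |c|)^3] dominates [1], [|c|], [|c|^2] and [|c|^3], the powers of [c] produced by the chain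
   rule. *)
pose K := `|a| * ((1 + `|c|) ^+ 3 * L).
have aL (y z : R) : 0 <= z -> z <= (1 + `|c|) ^+ 3 -> `|y| <= L -> `|a| * (z * `|y|) <= K.
  by move=> z0 zk yL; rewrite ler_wpM2l// ler_pM.
have aL' (z u : R) : 0 <= u -> z <= (1 + `|c|) ^+ 3 -> `|a| * (L * (z * u)) <= K * u.
  move=> u0 zk; rewrite /K -mulrA ler_wpM2l// mulrA ler_wpM2r// mulrC ler_wpM2r//.
have cxt (x t : R) : c * (x + t) + d = c * x + d + c * t by ring.
apply: (@is_smooth_intro K _ (fun x => a * (c * h1 (c * x + d))) (fun x => a * (c ^+ 2 * h2 (c * x + d)))).
- move=> x; rewrite normrM -[`|h _|]mul1r; apply: aL => //; exact: smooth_bound0 sh _.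
- move=> x; rewrite !normrM; apply: aL => //; exact: smooth_bound1 sh _.
- move=> x; rewrite 2!normrM normrX; apply: aL => //.
  exact: smooth_bound2 sh _.
- move=> x t; rewrite cxt -mulrBr -mulrBr 2!normrM normrX.
  apply: le_trans (aL' _ _ (normr_ge0 t) k3).
  rewrite ler_wpM2l//; apply: le_trans (ler_wpM2l _ (smooth_lip2 sh _ _)) _; first exact: exprn_ge0.
  by rewrite normrM le_eqVlt; apply/orP; left; apply/eqP; ring.
- move=> x t; rewrite cxt.
  have t1 := smooth_taylor1 sh (c * x + d) (c * t).
  rewrite (_ : _ - _ - _ = a * (c * (h1 (c * x + d + c * t) - h1 (c * x + d) - h2 (c * x + d) * (c * t)))); last by ring.
  rewrite !normrM; apply: le_trans (aL' _ _ (exprn_ge0 2 (normr_ge0 t)) k3).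
  rewrite ler_wpM2l//; apply: le_trans (ler_wpM2l k0 t1) _.
  by rewrite normrM le_eqVlt; apply/orP; left; apply/eqP; ring.
- move=> x t; rewrite cxt.
  have t0 := smooth_taylor0 sh (c * x + d) (c * t).
  rewrite (_ : _ - _ - _ - _ = a * (h (c * x + d + c * t) - h (c * x + d) - h1 (c * x + d) * (c * t) -
    h2 (c * x + d) * ((c * t) ^+ 2 / 2))); last by ring.
  rewrite !normrM; apply: le_trans (aL' _ _ (exprn_ge0 3 (normr_ge0 t)) k3).
  rewrite ler_wpM2l//; apply: le_trans t0 _.
  by rewrite normrM le_eqVlt; apply/orP; left; apply/eqP; ring.
Qed.

Let pos (x : R) : R := Num.max 0 x.

Lemma posP x : (0 <= x /\ pos x = x) \/ (x <= 0 /\ pos x = 0).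
Proof.
rewrite /pos; have [x0|/ltW x0] := leP 0 x; [left|right]; split=> //.
Qed.

(* The integral of the quadratic B-spline with knots 0, 1, 2, 3. *)
Definition spline_step (x : R) : R :=
  (pos x ^+ 3 - 3 * pos (x - 1) ^+ 3 + 3 * pos (x - 2) ^+ 3 - pos (x - 3) ^+ 3) / 6.

Lemma spline_step0 x : x <= 0 -> spline_step x = 0.
Proof.
move=> x0; have p0 (y : R) : y <= 0 -> pos y = 0 by case: (posP y) => -[? ->]; lra.
by rewrite /spline_step !p0 ?expr0n/= ?mulr0; lra.
Qed.

Lemma spline_step1 x : 3 <= x -> spline_step x = 1.
Proof.
move=> x0; have p0 (y : R) : 0 <= y -> pos y = y by case: (posP y) => -[? ->]; lra.
by rewrite /spline_step !p0; [field|lra..].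
Qed.

Lemma spline_step_itv x : 0 <= spline_step x <= 1.
Proof.
have [x0|/ltW x0] := leP x 0; first by rewrite spline_step0// lexx ler01.
have [x3|/ltW x3] := leP 3 x; first by rewrite spline_step1// lexx ler01.
rewrite /spline_step.
have -> : pos (x - 3) = 0 by case: (posP (x - 3)) => -[? ->]; lra.
have -> : pos x = x by case: (posP x) => -[? ->]; lra.
case: (posP (x - 1)) => -[x1 ->]; case: (posP (x - 2)) => -[x2 ->]; apply/andP.
- have e : (x ^+ 3 - 3 * (x - 1) ^+ 3 + 3 * (x - 2) ^+ 3 - 0 ^+ 3) / 6 = 1 - (3 - x) ^+ 3 / 6 by field.
  have y0 : 0 <= 3 - x by lra.
  have y1 : (3 - x) ^+ 3 <= 1 by rewrite expr_le1//; lra.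
  by have := exprn_ge0 3 y0; rewrite e; split; lra.
- have y0 : 0 <= x - 1 by []. have y1 : x - 1 <= 1 by lra.
  move: (x - 1) y0 y1 (subrK 1 x) => y y0 y1 <-; split; nra.
- by exfalso; lra.
- have x11 : x ^+ 3 <= 1 by rewrite expr_le1//; lra.
  have := exprn_ge0 3 x0; split; lra.
Qed.

Lemma is_smooth_spline_step : is_smooth spline_step.
Proof.
have T0 x t : `|pos (x + t) ^+ 3 - pos x ^+ 3 - 3 * pos x ^+ 2 * t - 6 * pos x * (t ^+ 2 / 2)| <= `|t| ^+ 3.
  rewrite -normrX.
  case: (posP x) => -[x0 ->]; case: (posP (x + t)) => -[xt0 ->].
  - by rewrite le_eqVlt; apply/orP; left; apply/eqP; congr `|_|; field.
  - have t0 : t <= 0 by lra.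
    have t3 : t ^+ 3 <= 0 by rewrite exprn_odd_le0.
    have a : 0 <= - (x + t) ^+ 3 <= - t ^+ 3.
      rewrite (_ : - (x + t) ^+ 3 = (- (x + t)) ^+ 3); last by ring.
      rewrite (_ : - t ^+ 3 = (- t) ^+ 3); last by ring.
      by rewrite exprn_ge0 ?lerXn2r ?nnegrE//=; lra.
    by rewrite (ler0_norm t3) ler_norml; apply/andP; split; lra.
  - have a : 0 <= (x + t) ^+ 3 <= t ^+ 3 by rewrite exprn_ge0 ?lerXn2r ?nnegrE//=; lra.
    rewrite ger0_norm; last lra.
    by rewrite ger0_norm; lra.
  - by rewrite !expr0n/= !mulr0 !mul0r !subrr normr0.
have T1 x t : `|3 * pos (x + t) ^+ 2 - 3 * pos x ^+ 2 - 6 * pos x * t| <= 3 * `|t| ^+ 2.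
  rewrite real_normK ?num_real// ler_norml.
  case: (posP x) => -[x0 ->]; case: (posP (x + t)) => -[xt0 ->]; apply/andP; split; nra.
have T2 x t : `|6 * pos (x + t) - 6 * pos x| <= 6 * `|t|.
  rewrite -mulrBr normrM ger0_norm// ler_wpM2l//.
  case: (posP x) => -[x0 ->]; case: (posP (x + t)) => -[xt0 ->]; case: (ger0P t) => t0;
    rewrite ler_norml; apply/andP; split; lra.
pose q1 x := 3 * pos x ^+ 2; pose q2 x := 6 * pos x.
(* The third difference defining [spline_step]. Its coefficients have absolute sum [8/6 <= 2], so
   each bound for truncated powers carries over up to a factor 2. *)
pose comb (q : R -> R) x := (q x - 3 * q (x - 1) + 3 * q (x - 2) - q (x - 3)) / 6.
have combn (u1 u2 u3 u4 b : R) : `|u1| <= b -> `|u2| <= b -> `|u3| <= b -> `|u4| <= b ->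
    `|(u1 - 3 * u2 + 3 * u3 - u4) / 6| <= 2 * b.
  rewrite !ler_norml => /andP[? ?] /andP[? ?] /andP[? ?] /andP[? ?].
  by apply/andP; split; lra.
have pb x y : 0 <= x -> x <= 3 -> y <= x -> 0 <= pos y <= 3.
  by move=> x0 x3 yx; case: (posP y) => -[y0 ->]; apply/andP; split; lra.
have bound (q : R -> R) (b : R) : (forall x, 0 <= pos x <= 3 -> `|q x| <= b) -> (forall x, x <= 0 -> q x = 0) ->
    forall x, x <= 3 -> `|comb q x| <= 2 * b.
  move=> qb q0 x x3; have [x0|/ltW x0] := leP x 0.
    rewrite /comb !q0; [|lra..]; rewrite (_ : (_ - _) / 6 = 0) ?normr0; last by ring.
    have : 0 <= b by apply: le_trans (qb 0 _) => //; rewrite /pos maxxx lexx; lra.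
    by lra.
  by apply: combn; apply: qb; apply: (pb x) => //; lra.
(* Beyond 3 nothing is truncated, and a third difference kills the quadratic [q1] and the linear
   [q2]; their growth at infinity is harmless. *)
have big x : 3 <= x -> [/\ pos x = x, pos (x - 1) = x - 1, pos (x - 2) = x - 2 & pos (x - 3) = x - 3].
  by move=> x3; split; rewrite /pos max_r//; lra.
(* 54 is twice 27, the maximum of [q1] on [[0, 3]]; all other bounds are smaller. *)
apply: (@is_smooth_intro 54 _ (comb q1) (comb q2)).
- by move=> x; have /andP[a b] := spline_step_itv x; rewrite ger0_norm//; lra.
- move=> x; have [x3|/ltW x3] := leP x 3.
    have b1 y : 0 <= pos y <= 3 -> `|q1 y| <= 27.
      by move=> /andP[y0 y3]; rewrite /q1 ger0_norm; nra.
    have b2 y : y <= 0 -> q1 y = 0.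
      by move=> y0; rewrite /q1; case: (posP y) => -[? ->]; nra.
    have b3 := bound q1 27 b1 b2 x x3; apply: le_trans b3 _; lra.
  have [e1 e2 e3 e4] := big x x3.
  by rewrite /comb /q1 e1 e2 e3 e4 (_ : _ / 6 = 0) ?normr0//; ring.
- move=> x; have [x3|/ltW x3] := leP x 3.
    have b1 y : 0 <= pos y <= 3 -> `|q2 y| <= 27.
      by move=> /andP[y0 y3]; rewrite /q2 ger0_norm; nra.
    have b2 y : y <= 0 -> q2 y = 0.
      by move=> y0; rewrite /q2; case: (posP y) => -[? ->]; nra.
    have b3 := bound q2 27 b1 b2 x x3; apply: le_trans b3 _; lra.
  have [e1 e2 e3 e4] := big x x3.
  by rewrite /comb /q2 e1 e2 e3 e4 (_ : _ / 6 = 0) ?normr0//; ring.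
- move=> x t; have tt := normr_ge0 t.
  have c (y : R) : `|q2 (x + t - y) - q2 (x - y)| <= 6 * `|t| by rewrite (addrAC x t); exact: T2.
  have c0 := T2 x t.
  have := combn _ _ _ _ _ c0 (c 1) (c 2) (c 3).
  rewrite (_ : (_ - _) / 6 = comb q2 (x + t) - comb q2 x); last by rewrite /comb /q2; field.
  by move=> h; apply: le_trans h _; lra.
- move=> x t; have tt := exprn_ge0 2 (normr_ge0 t).
  have c (y : R) : `|q1 (x + t - y) - q1 (x - y) - q2 (x - y) * t| <= 3 * `|t| ^+ 2 by rewrite (addrAC x t); exact: T1.
  have c0 := T1 x t.
  have := combn _ _ _ _ _ c0 (c 1) (c 2) (c 3).
  rewrite (_ : (_ - _) / 6 = comb q1 (x + t) - comb q1 x - comb q2 x * t); last by rewrite /comb /q1 /q2; field.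
  by move=> h; apply: le_trans h _; lra.
- move=> x t; have tt := exprn_ge0 3 (normr_ge0 t).
  have c (y : R) : `|pos (x + t - y) ^+ 3 - pos (x - y) ^+ 3 - q1 (x - y) * t - q2 (x - y) * (t ^+ 2 / 2)| <= `|t| ^+ 3.
    by rewrite (addrAC x t); exact: T0.
  have c0 := T0 x t.
  have := combn _ _ _ _ _ c0 (c 1) (c 2) (c 3).
  rewrite (_ : (_ - _) / 6 = spline_step (x + t) - spline_step x - comb q1 x * t - comb q2 x * (t ^+ 2 / 2)); last first.
    by rewrite /spline_step /comb /q1 /q2; field.
  by move=> h; apply: le_trans h _; lra.
Qed.

End Staircases.

(** * Approximation of continuous functions on segments *)

Section Approximation.
Variable R : realType.
Implicit Types (h : R -> R).

Lemma cluster_in_segment (a b : R) (u : nat -> R) : (forall n, a <= u n <= b) ->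
  exists p, a <= p <= b /\ forall (e : R) N, 0 < e -> exists n, (N <= n)%N /\ `|u n - p| < e.
Proof.
move=> uab.
have [|p [pab cp]] := @segment_compact R a b (u @ \oo) _.
  by exists 0%N => // n _; rewrite /= in_itv/=.
exists p; split; first by move: pab; rewrite /= in_itv.
move=> e N e0.
have [] := cp [set x | exists n, (N <= n)%N /\ x = u n] (ball p e).
- by exists N => // n /= Nn; exists n.
- exact: nbhsx_ballx.
- by move=> _ [[n [Nn ->]]]; rewrite /ball/= distrC => h; exists n.
Qed.

(** The modulus is sought of the form [c / (N+1)] so that it can serve directly as the mesh of a
    subdivision into [N+1] cells. *)
Lemma uniform_continuity_segment (K e c : R) h : continuous h -> 0 < e -> 0 <= c ->
  exists N : nat, forall x y, - K <= x <= K -> - K <= y <= K ->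
    `|x - y| <= c / N.+1%:R -> `|h x - h y| <= e.
Proof.
move=> ch e0 c0; apply: contrapT => nN.
have {}nN (N : nat) : exists xy : R * R, [/\ - K <= xy.1 <= K, `|xy.1 - xy.2| <= c / N.+1%:R &
    e < `|h xy.1 - h xy.2|].
  apply: contrapT => nxy; apply: nN; exists N => x y xK yK xy.
  by rewrite leNgt; apply/negP => exy; apply: nxy; exists (x, y).
have [u uP] := choice nN.
have [p [pK cp]] := @cluster_in_segment (- K) K (fun n => (u n).1) (fun n => let: And3 a _ _ := uP n in a).
have e2 : 0 < e / 2 by lra.
have /cvgrPdist_lt/(_ _ e2)/nbhs_ballP[d /= d0 hd] := ch p.
have d2 : 0 < d / 2 by lra.
pose N := Num.truncn (c / (d / 2)).
have [n [Nn un']] := cp (d / 2) N d2.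
have un : `|(u n).1 - p| < d / 2 := un'.
have [_ xy exy] := uP n.
have cn : c / n.+1%:R < d / 2.
  rewrite ltr_pdivrMr ?ltr0n// mulrC -ltr_pdivrMr//.
  apply: lt_le_trans (truncnS_gt _) _; rewrite ler_nat; exact: Nn.
have u1 : `|(u n).1 - p| < d by lra.
have u2 : `|(u n).2 - p| < d.
  have xy' := le_lt_trans xy cn.
  by have := ler_distD (u n).1 (u n).2 p; rewrite [`|(u n).2 - (u n).1|]distrC => h3; lra.
have h1 : `|h p - h (u n).1| < e / 2 by apply: hd; rewrite /ball/= distrC; exact: u1.
have h2 : `|h p - h (u n).2| < e / 2 by apply: hd; rewrite /ball/= distrC; exact: u2.
have := ler_distD (h p) (h (u n).1) (h (u n).2); rewrite [`|h (u n).1 - h p|]distrC.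
lra.
Qed.

Section Stair.
Variables (h : R -> R) (x0 d : R).
Hypothesis d0 : 0 < d.

Definition node (i : nat) : R := x0 + i%:R * d.

(** Smooth interpolation of [h] at the nodes: the factor 3 makes [spline_step], which rises over
    [[0, 3]], climb exactly within the cell [[node i, node i.+1]]. *)
Definition stair (N : nat) (x : R) : R :=
  h x0 + \sum_(0 <= i < N) (h (node i.+1) - h (node i)) * spline_step (3 * ((x - node i) / d)).

Lemma is_smooth_stair N : is_smooth (stair N).
Proof.
elim: N => [|N ih].
  rewrite (_ : stair 0 = fun=> h x0); first exact: is_smooth_cst.
  by apply: funext => x; rewrite /stair big_geq// addr0.
rewrite (_ : stair N.+1 = fun x => stair N x + (h (node N.+1) - h (node N)) *
    spline_step (3 / d * x + (- (3 / d * node N)))).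
  by apply: is_smoothD => //; apply: is_smooth_affine; exact: is_smooth_spline_step.
apply: funext => x; rewrite /stair big_nat_recr//= addrA; congr (_ + _ * spline_step _).
by ring.
Qed.

(** Being a convex combination of two nodal values gives the sup bound everywhere, and the proximity
    of the two nodes gives the approximation in range. The first conjunct is what the induction
    feeds on. *)
Lemma stair_val N x : (node N <= x -> stair N x = h (node N)) /\
  exists (p : R) (i j : nat), [/\ 0 <= p <= 1, stair N x = (1 - p) * h (node i) + p * h (node j), (i <= N)%N, (j <= N)%N &
    x0 <= x <= node N -> `|x - node i| <= d /\ `|x - node j| <= d].
Proof.
have nodeS i : node i.+1 = node i + d by rewrite /node -natr1; ring.
have n0 : node 0 = x0 by rewrite /node mul0r addr0.
elim: N => [|N [ih1 [p [i [j [p01 e iN jN near]]]]]].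
  have s0 : stair 0 x = h (node 0) by rewrite /stair big_geq// addr0 n0.
  split=> //; exists 0, 0%N, 0%N; split=> //; first by rewrite lexx ler01.
    by rewrite s0; ring.
  rewrite n0 => /andP[xx1 xx2]; have xx : x - x0 = 0 by clear -xx1 xx2; lra.
  by rewrite xx normr0; split; exact: ltW.
have sS : stair N.+1 x = stair N x + (h (node N.+1) - h (node N)) * spline_step (3 * ((x - node N) / d)).
  by rewrite /stair big_nat_recr//= addrA.
have [xN|/ltW Nx] := leP x (node N).
  rewrite spline_step0 ?mulr0 ?addr0 in sS; last first.
    by rewrite pmulr_rle0// pmulr_lle0 ?invr_gt0// subr_le0.
  split.
    by move=> Nx; have := le_trans Nx xN; rewrite nodeS gerDl leNgt d0.
  exists p, i, j; split=> //; [by rewrite sS|exact: leqW|exact: leqW|].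
  by move=> /andP[x0x _]; apply: near; rewrite x0x.
rewrite ih1// in sS; split.
  rewrite nodeS => Nx1; rewrite sS spline_step1 ?mulr1.
    by rewrite nodeS; ring.
  by rewrite -[leLHS]mulr1 ler_wpM2l// ler_pdivlMr// mul1r; lra.
exists (spline_step (3 * ((x - node N) / d))), N, N.+1; split=> //.
- exact: spline_step_itv.
- by rewrite sS; ring.
- by rewrite nodeS => /andP[_ xN1]; rewrite !ler_norml; split; apply/andP; split; lra.
Qed.

End Stair.

Lemma smooth_approx (M K e : R) h : continuous h -> (forall x, `|h x| <= M) -> 0 < K -> 0 < e ->
  exists g, [/\ is_smooth g, forall x, `|g x| <= M & forall x, `|x| <= K -> `|h x - g x| <= e].
Proof.
move=> ch hM K0 e0.
have [N uc] := uniform_continuity_segment K ch e0 (ltW (mulr_gt0 (ltr0n R 2) K0)).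
pose d := 2 * K / N.+1%:R; have d0 : 0 < d by rewrite divr_gt0// mulr_gt0.
exists (stair h (- K) d N.+1); split; first exact: is_smooth_stair.
  move=> x; have [_ [p [i [j [/andP[p0 p1] -> _ _ _]]]]] := stair_val h (- K) d0 N.+1 x.
  apply: le_trans (ler_normD _ _) _; rewrite !normrM (ger0_norm p0) ger0_norm; last lra.
  have := hM (- K + i%:R * d); have := hM (- K + j%:R * d); nra.
move=> x; rewrite ler_norml => xK.
have [_ [p [i [j [/andP[p0 p1] -> iN jN]]]]] := stair_val h (- K) d0 N.+1 x.
have Nd : N.+1%:R * d = 2 * K by rewrite /d mulrC divfK// pnatr_eq0.
have nK k : (k <= N.+1)%N -> - K <= - K + k%:R * d <= K.
  move=> kN; have k0 : 0 <= k%:R :> R by []. have kN' : k%:R <= N.+1%:R :> R by rewrite ler_nat.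
  by apply/andP; split; nra.
rewrite /node Nd => /(_ _)[|n1 n2]; first by rewrite (_ : - K + 2 * K = K)//; ring.
have h1 := uc _ _ xK (nK i iN) n1; have h2 := uc _ _ xK (nK j jN) n2.
rewrite (_ : h x - _ = (1 - p) * (h x - h (- K + i%:R * d)) + p * (h x - h (- K + j%:R * d))); last by ring.
apply: le_trans (ler_normD _ _) _; rewrite !normrM (ger0_norm p0) (@ger0_norm _ (1 - p)); last lra.
nra.
Qed.

End Approximation.

(** * Bounded multilinear forms *)

Section Multilinear.
Variables (R : realType) (X : normedModType R).

Lemma upd_id k (v : 'I_k -> X) i : upd v i (v i) = v.
Proof. by apply: funext => j; rewrite /upd; case: eqP => [->|]. Qed.

Lemma multilinear_upd0 k (A : ('I_k -> X) -> R) v i : multilinear A -> A (upd v i 0) = 0.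
Proof.
move=> mA; have := mA i v 1 0 0; rewrite scaler0 addr0 mul1r => h; lra.
Qed.

Lemma multilinear_updZ k (A : ('I_k -> X) -> R) v i (a : R) x : multilinear A ->
  A (upd v i (a *: x)) = a * A (upd v i x).
Proof. by move=> mA; rewrite -[a *: x]addr0 mA multilinear_upd0// addr0. Qed.

Lemma multilinear_updB k (A : ('I_k -> X) -> R) v i x y : multilinear A ->
  A (upd v i (x - y)) = A (upd v i x) - A (upd v i y).
Proof. by move=> mA; rewrite addrC -scaleN1r mA mulN1r addrC. Qed.

Lemma multilinear_scale k (A : ('I_k -> X) -> R) (c : 'I_k -> R) (u : 'I_k -> X) :
  multilinear A -> A (fun i => c i *: u i) = (\prod_i c i) * A u.
Proof.
move=> mA; rewrite -big_enum.
suff h (s : seq 'I_k) : uniq s ->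
    A (fun i => if i \in s then c i *: u i else u i) = (\prod_(i <- s) c i) * A u.
  by rewrite -h ?enum_uniq//; congr A; apply: funext => i; rewrite mem_enum.
elim: s => [_|i s ih /= /andP[si us]]; first by rewrite big_nil mul1r.
rewrite big_cons -mulrA -ih//; set v := fun j => if j \in s then _ else _.
rewrite (_ : (fun j => _) = upd v i (c i *: u i)); last first.
  by apply: funext => j; rewrite /upd inE; case: eqP => [->|].
rewrite multilinear_updZ//; congr (_ * A _).
have -> : u i = v i by rewrite /v (negbTE si).
exact: upd_id.
Qed.

(** Homogeneity, after normalising each argument. For a zero argument the inverse norm is 0 and the
    normalised vector is 0, so no case is lost. *)
Lemma multilinear_le k (A : ('I_k -> X) -> R) (M : R) (v : 'I_k -> X) : multilinear A ->
  (forall u, (forall i, `|u i| <= 1) -> `|A u| <= M) -> `|A v| <= M * \prod_i `|v i|.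
Proof.
move=> mA AM; pose u i := `|v i|^-1 *: v i.
have vE : v = (fun i => `|v i| *: u i).
  apply: funext => i; rewrite /u scalerA; have [->|v0] := eqVneq (v i) 0; first by rewrite scaler0.
  by rewrite divff ?scale1r// normr_eq0.
have p0 : 0 <= \prod_i `|v i| by apply: prodr_ge0.
rewrite {1}vE multilinear_scale// normrM (ger0_norm p0) mulrC ler_wpM2r//.
apply: AM => i; rewrite normrZ normfV normr_id.
have [->|v0] := eqVneq (v i) 0; first by rewrite normr0 mulr0.
by rewrite mulVf// normr_eq0.
Qed.

(** Replace [y] by [x] one slot at a time: each of the [k] increments has one argument [x - y] and
    [k-1] arguments of norm at most [r]. *)
Lemma multilinear_diag_lip k (A : ('I_k -> X) -> R) (M r : R) (x y : X) : multilinear A ->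
  (forall u, (forall i, `|u i| <= 1) -> `|A u| <= M) -> `|x| <= r -> `|y| <= r ->
  `|A (fun=> x) - A (fun=> y)| <= k%:R * (M * (`|x - y| * r ^+ k.-1)).
Proof.
move=> mA AM xr yr; have r0 : 0 <= r by exact: le_trans xr.
have M0 : 0 <= M by apply: le_trans (AM (fun=> 0) _) => // i; rewrite normr0.
pose hyb j := fun i : 'I_k => if (i < j)%N then x else y.
have st j : (j < k)%N -> `|A (hyb j.+1) - A (hyb j)| <= M * (`|x - y| * r ^+ k.-1).
  move=> jk; pose j' := Ordinal jk.
  have -> : hyb j.+1 = upd (hyb j) j' x.
    apply: funext => i; rewrite /upd /hyb ltnS leq_eqVlt.
    by rewrite -[i == j']/(val i == j); case: eqP.
  have e : hyb j = upd (hyb j) j' y.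
    apply: funext => i; rewrite /upd /hyb -[i == j']/(val i == j).
    by case: eqP => // ->; rewrite ltnn.
  rewrite {2}e -multilinear_updB//; apply: le_trans (multilinear_le _ mA AM) _.
  rewrite ler_wpM2l// (bigD1 j')//= /upd eqxx ler_wpM2l//.
  have -> : r ^+ k.-1 = \prod_(i < k | i != j') r.
    have -> : k.-1 = #|predC1 j'| by rewrite cardC1 card_ord.
    by rewrite -prodr_const; apply: eq_bigl.
  apply: ler_prod => i ij; rewrite normr_ge0/= ifN//.
  by rewrite /hyb; case: ifP.
have -> : A (fun=> x) - A (fun=> y) = \sum_(0 <= j < k) (A (hyb j.+1) - A (hyb j)).
  rewrite telescope_sumr//; congr (A _ - A _); apply: funext => i; rewrite /hyb//.
  by rewrite ltn_ord.
apply: le_trans (ler_norm_sum _ _ _) _.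
rewrite [leRHS](_ : _ = \sum_(0 <= j < k) M * (`|x - y| * r ^+ k.-1)); last first.
  by rewrite sumr_const_nat subn0 mulr_natl.
by apply: ler_sum_nat => j /andP[_]; exact: st.
Qed.

End Multilinear.

(** * Exponential growth of the functions of [E_omega] *)

Section EOmega.
Variables (R : realType) (X : normedModType R) (omega : nat -> R).
Hypothesis omega1 : forall k, 1 < omega k.

Lemma expR_partial_le (r : R) n : 0 <= r -> \sum_(0 <= k < n) r ^+ k / k`!%:R <= expR r.
Proof.
move=> r0; have nd : nondecreasing_seq (series (exp_coeff r)).
  apply/nondecreasing_seqP => m; rewrite /series /= big_nat_recr//= lerDl.
  by rewrite exp_coeff_ge0.
have := nondecreasing_cvgn_le nd (is_cvg_series_exp_coeff r) n.
by apply: le_trans; rewrite /series /= le_eqVlt; apply/orP; left; apply/eqP.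
Qed.

Lemma norm_cvg_le (u : nat -> R) (l B : R) : u @ \oo --> l ->
  (forall n, `|u n| <= B) -> `|l| <= B.
Proof.
move=> ul uB; have c : (fun n => `|u n|) @ \oo --> `|l| by exact: cvg_norm.
rewrite -(cvg_lim _ c)//; apply: limr_le; first by apply/cvg_ex; eexists; exact: c.
exact: nearW.
Qed.

(** As [omega k > 1], one [M] bounds all derivatives at 0, and the Taylor series is dominated by the
    exponential; for differences [k r^(k-1) / k! = r^(k-1) / (k-1)!] restores the same series. *)
Lemma E_omega_growth (f : X -> R) : E_omega omega f -> exists M : R, [/\ 0 <= M,
  forall x, `|f x| <= M * expR `|x| &
  forall r x y, `|x| <= r -> `|y| <= r -> `|f x - f y| <= M * expR r * `|x - y|].
Proof.
move=> [Df [[Df0 DfS] [fE [M hM]]]].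
(* Multilinearity comes with being a derivative, hence starts at order 1; order 0 is a form without
   arguments and is treated apart below. *)
have ml k : multilinear (Df k.+1 0) by have [] := nbhs_singleton (DfS k).
have AM k u : (forall i, `|u i| <= 1) -> `|Df k 0 u| <= M.
  move=> u1; have w1 : 1 <= omega k ^+ k by rewrite exprn_ege1// ltW.
  have h : ((`|Df k 0 u|)%:E <= mlnorm (Df k 0%R))%E.
    by apply: ereal_sup_ubound; exists u.
  rewrite -lee_fin; apply: le_trans (hM k); apply: (le_trans h).
  rewrite -[leLHS]mule1 lee_wpmul2l ?lee_fin//.
  by apply: (le_trans _ h); rewrite lee_fin.
have M0 : 0 <= M by apply: le_trans (AM 0%N (fun=> 0) _) => // i; rewrite normr0.
exists M; split=> //.
  move=> x; apply: (norm_cvg_le (fE x)) => n; apply: le_trans (ler_norm_sum _ _ _) _.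
  apply: le_trans (ler_wpM2l M0 (expR_partial_le n (normr_ge0 x))).
  rewrite mulr_sumr; apply: ler_sum => k _; rewrite normrM (@ger0_norm _ (_^-1)) ?invr_ge0//.
  rewrite mulrA ler_wpM2r ?invr_ge0//; case: k => [|k].
    by rewrite expr0 mulr1; apply: AM => -[].
  have := multilinear_le (fun=> x) (ml k) (AM k.+1).
  by rewrite prodr_const card_ord.
move=> r x y xr yr; have r0 : 0 <= r by exact: le_trans xr.
apply: (norm_cvg_le (cvgB (fE x) (fE y))) => n; rewrite /= !fctE -sumrB.
apply: le_trans (ler_norm_sum _ _ _) _.
rewrite mulrAC; apply: (@le_trans _ _ (M * `|x - y| * \sum_(0 <= k < n) r ^+ k / k`!%:R)); last first.
  by rewrite ler_wpM2l ?mulr_ge0//; exact: expR_partial_le.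
case: n => [|n]; first by rewrite !big_geq// mulr0.
rewrite big_nat_recl//= (_ : (fun=> x) = (fun=> y) :> ('I_0 -> X)); last by apply: funext => -[].
rewrite subrr normr0 add0r mulr_sumr.
apply: (@le_trans _ _ (\sum_(0 <= k < n) M * `|x - y| * (r ^+ k / k`!%:R))); last first.
  rewrite big_nat_recr//= lerDl !mulr_ge0// ?invr_ge0// exprn_ge0//.
apply: ler_sum => k _; rewrite -mulrBl normrM (@ger0_norm _ (_^-1)) ?invr_ge0//.
rewrite ler_pdivrMr ?ltr0n ?fact_gt0//.
apply: le_trans (multilinear_diag_lip (ml k) (AM k.+1) xr yr) _.
rewrite factS natrM /= le_eqVlt; apply/orP; left; apply/eqP.
by field; rewrite pnatr_eq0 -lt0n fact_gt0.
Qed.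

End EOmega.

(** * Sets of full measure and dominated convergence *)

Section FullMeasure.
Context d (T : measurableType d) (R : realType) (P : probability T R).

Definition full (G : set T) := measurable G /\ P (~` G) = 0%E.

Lemma bdd_indic (A : set T) : measurable A -> bdd (\1_A : T -> R).
Proof.
move=> mA; split; first exact: measurable_indic.
by exists 1 => w; rewrite indicE; case: (_ \in _); rewrite ?normr1 ?normr0.
Qed.

Lemma prob_mean (A : set T) : measurable A -> P A = (mean P (\1_A : T -> R))%:E.
Proof. by move=> mA; rewrite -mean_EFin ?integral_indic ?setIT//; exact/L1_bdd/bdd_indic. Qed.

Lemma full_ae G : full G -> {ae P, forall x, G x}.
Proof.
move=> [mG G0]; exists (~` G); split; [exact: measurableC|exact: G0|].
by move=> x /=.
Qed.

Lemma full_mean_eq G (F F' : T -> R) : full G -> measurable_fun setT F -> measurable_fun setT F' ->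
  (forall w, G w -> F w = F' w) -> mean P F = mean P F'.
Proof.
move=> fG mF mF' FF'; congr fine; apply: ae_eq_integral => //; [exact/measurable_EFinP..|].
have := full_ae fG; apply: filterS => x Gx _ /=.
by rewrite FF'.
Qed.

Lemma full_measure_eq G A B : full G -> measurable A -> measurable B ->
  (forall w, G w -> A w <-> B w) -> P A = P B.
Proof.
move=> fG mA mB AB; rewrite !prob_mean//; congr EFin.
apply: (full_mean_eq fG) => [||w /AB ABw]; try exact: measurable_indic.
by rewrite !indicE; congr (_%:R); congr nat_of_bool; apply/idP/idP => /set_mem/ABw/mem_set.
Qed.

Lemma full_cvg_mean G (H : nat -> T -> R) (F g : T -> R) : full G ->
  (forall n, measurable_fun setT (H n)) -> measurable_fun setT F -> L1 P g ->
  (forall w, G w -> (fun n => H n w) @ \oo --> F w) ->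
  (forall n w, G w -> `|H n w| <= g w) ->
  L1 P F /\ (fun n => mean P (H n)) @ \oo --> mean P F.
Proof.
move=> fG mH mF ig HF Hg.
have [||||iF _ c] := @dominated_convergence _ _ _ P setT measurableT
    (fun n => EFin \o H n) (EFin \o F) (EFin \o g) _ _ _ ig _.
- by move=> n; exact/measurable_EFinP.
- exact/measurable_EFinP.
- have := full_ae fG; apply: filterS => x Gx _ /=.
  by apply: cvg_EFin; [exact: nearW|exact: HF].
- have := full_ae fG; apply: filterS => x Gx n _ /=.
  by rewrite lee_fin; exact: Hg.
split=> //.
have ce : (\int[P]_x (EFin \o F) x)%E = (mean P F)%:E by exact: mean_EFin.
by rewrite ce in c; exact: (fine_cvg c).
Qed.

End FullMeasure.

(** * Truncation of real functions *)

Section Clamp.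
Variable R : realType.
Implicit Types c x y : R.

Definition clamp c y := Num.max (- c) (Num.min c y).

Lemma clampP c y : 0 <= c -> [\/ clamp c y = y /\ - c <= y <= c, clamp c y = c /\ c <= y | clamp c y = - c /\ y <= - c].
Proof.
move=> c0; rewrite /clamp; have [cy|yc] := leP c y.
  by rewrite max_r; [constructor 2|lra].
have [cy|ycc] := leP (- c) y; first by constructor 1; rewrite ltW.
by constructor 3; rewrite ltW.
Qed.

Lemma norm_clamp_le c y : 0 <= c -> `|clamp c y| <= c.
Proof.
move=> c0; case: (clampP y c0) => -[-> h]; first by rewrite ler_norml.
  by rewrite ger0_norm.
by rewrite normrN ger0_norm.
Qed.

Lemma clamp_id c y : `|y| <= c -> clamp c y = y.
Proof.
move=> yc; have c0 : 0 <= c by exact: le_trans yc.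
move: yc; rewrite ler_norml => /andP[h1 h2].
by case: (clampP y c0) => -[-> h] //; lra.
Qed.

Lemma norm_clamp_le_norm c y : 0 <= c -> `|clamp c y| <= `|y|.
Proof.
move=> c0; case: (clampP y c0) => -[-> h]//.
  by rewrite ger0_norm// ger0_norm//; lra.
by rewrite normrN ger0_norm// ler0_norm; lra.
Qed.

Lemma clamp_lip c x y : 0 <= c -> `|clamp c x - clamp c y| <= `|x - y|.
Proof.
move=> c0.
wlog xy : x y / x <= y => [H|].
  by have [/H//|/ltW/H] := leP x y; rewrite distrC [`|y - x|]distrC.
rewrite [leRHS]distrC [leLHS]distrC (@ger0_norm _ (y - x)) ?subr_ge0// ler_norml.
by case: (clampP x c0) => -[-> hx]; case: (clampP y c0) => -[-> hy]; try (case/andP: hx => hx1 hx2); try (case/andP: hy => hy1 hy2); apply/andP; split; lra.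
Qed.

Lemma pow4_add_le x y : (x + y) ^+ 2 ^+ 2 <= 8 * (x ^+ 4 + y ^+ 4).
Proof.
have s1 : (x + y) ^+ 2 <= 2 * (x ^+ 2 + y ^+ 2) by have := sqr_ge0 (x - y); nra.
have s2 : (x + y) ^+ 2 ^+ 2 <= (2 * (x ^+ 2 + y ^+ 2)) ^+ 2.
  by rewrite lerXn2r ?nnegrE ?sqr_ge0// mulr_ge0 ?addr_ge0 ?sqr_ge0.
have := sqr_ge0 (x ^+ 2 - y ^+ 2); move: s2; rewrite -[4%N]/(2 * 2)%N !exprM.
by move: (x ^+ 2) (y ^+ 2) ((x + y) ^+ 2 ^+ 2) => a b c; rewrite !expr2; lra.
Qed.

End Clamp.

(** * Borel measurability on a normed space *)

Section BorelNormed.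
Variables (R : realType) (X : normedModType R).

Lemma measurable_open (U : set X) : open U -> measurable (U : set (borelX X)).
Proof. by move=> oU; exact: sub_sigma_algebra. Qed.

Lemma continuous_measurable_borel (f : X -> R) : continuous f ->
  measurable_fun setT (f : borelX X -> R).
Proof.
move=> cf; apply: (@measurability _ _ (borelX X) _ setT f (@RGenOpens.G R) (RGenOpens.measurableE R)) => _ [_ [a [b ->]] <-].
by rewrite setTI; apply: measurable_open; apply: open_comp => // x _; exact: cf.
Qed.

Lemma continuous_measurable_borelX (T : X -> X) : continuous T ->
  measurable_fun setT (T : borelX X -> borelX X).
Proof.
move=> cT; apply: (@measurability _ _ (borelX X) (borelX X) setT T (@open X)) => // _ [U oU <-].
by rewrite setTI; apply: measurable_open; apply: open_comp => // x _; exact: cT.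
Qed.

Variables (f : X -> R) (M : R).
Hypothesis f_lip : forall r x y, `|x| <= r -> `|y| <= r -> `|f x - f y| <= M * expR r * `|x - y|.
Hypothesis M0 : 0 <= M.

Lemma growth_continuous : continuous f.
Proof.
move=> x; pose C := M * expR (`|x| + 1) + 1.
have C0 : 0 < C by rewrite ltr_wpDl// mulr_ge0// expR_ge0.
apply/cvgrPdist_lt => d d0.
have d1 : 0 < Num.min 1 (d / C) by rewrite lt_min ltr01 divr_gt0.
apply: filterS (nbhsx_ballx x _ d1) => y; rewrite -ball_normE /ball_/= lt_min => /andP[y1 yd].
have yr : `|y| <= `|x| + 1.
  by rewrite -[y](subrKC x); apply: le_trans (ler_normD _ _) _; rewrite lerD2l distrC ltW.
have xr : `|x| <= `|x| + 1 by rewrite lerDl.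
apply: le_lt_trans (f_lip xr yr) _.
rewrite ltr_pdivlMr// in yd; have := normr_ge0 (x - y).
by move: yd; rewrite /C; lra.
Qed.

End BorelNormed.

(** * The two-sided shift: resampling, influences and covariances *)

Section BernoulliShift.
Variable R : realType.
Implicit Types H : letters int -> R.

Definition shift (n : nat) (w : letters int) : letters int := w \o (fun i => i + n%:Z).

(* A sequence indexed by bool * int is a pair of independent sequences. *)
Definition mix (A : pred int) (w : letters (bool * int)%type) : letters int :=
  w \o (fun i => (~~ A i, i)).

(** Exchanges the two copies on the rows of [B]. The law is preserved, and [mix A] becomes [mix] of
    the symmetric difference of [A] and [B] ([mix_swap]). *)
Definition swap (B : pred int) (w : letters (bool * int)%type) : letters (bool * int)%type :=
  w \o (fun bi => (bi.1 (+) B bi.2, bi.2)).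

(** Only row [i] is read from the second copy in the subtracted term. *)
Definition resample (i : int) H (w : letters (bool * int)%type) : R :=
  H (mix predT w) - H (mix (predC1 i) w).

Lemma eq_mix (A B : pred int) w : A =1 B -> mix A w = mix B w.
Proof. by move=> AB; apply: funext => i; rewrite /mix /= AB. Qed.

Lemma mix_swap A B w : mix A (swap B w) = mix (fun i => A i (+) B i) w.
Proof. by apply: funext => i; rewrite /mix /swap /= -addNb. Qed.

Lemma shiftD m n w : shift m (shift n w) = shift (m + n) w.
Proof. by apply: funext => i; rewrite /shift /= -addrA PoszD. Qed.

Variables (P : probability (letters int) R) (P2 : probability (letters (bool * int)%type) R).
Hypotheses (iP : iid P) (iP2 : iid P2).

Lemma mpres_shift n : mpres P P (shift n).
Proof. by apply: iid_reindex => // i j /addIr. Qed.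

Lemma mpres_mix A : mpres P2 P (mix A).
Proof. by apply: iid_reindex => // i j []. Qed.

Lemma mpres_swap B : mpres P2 P2 (swap B).
Proof.
apply: iid_reindex => // -[b i] [b' i'] /= [e ii]; rewrite -ii in e.
by rewrite -ii; congr pair; exact: addIb e.
Qed.

Lemma bdd_comp d1 d2 (T1 : measurableType d1) (T2 : measurableType d2) (phi : T1 -> T2) (F : T2 -> R) :
  measurable_fun setT phi -> bdd F -> bdd (fun w => F (phi w)).
Proof. by move=> mphi [mF [M FM]]; split; [exact: measurableT_comp|exists M]. Qed.

Lemma bdd_mix A H : bdd H -> bdd (fun w => H (mix A w)).
Proof. exact: bdd_comp (mpres_mix A).1. Qed.

Lemma bdd_shift n H : bdd H -> bdd (fun w => H (shift n w)).
Proof. exact: bdd_comp (mpres_shift n).1. Qed.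

Lemma bdd_resample i H : bdd H -> bdd (resample i H).
Proof. by move=> bH; apply: bddB; exact: bdd_mix. Qed.

Lemma mean_mix A H : measurable_fun setT H -> mean P2 (fun w => H (mix A w)) = mean P H.
Proof. by move=> mH; rewrite (mpres_mean (mpres_mix A)). Qed.

Lemma mean_shift n H : measurable_fun setT H -> mean P (fun w => H (shift n w)) = mean P H.
Proof. by move=> mH; rewrite [RHS](mpres_mean (mpres_shift n)). Qed.

Lemma mean_swap B (F : letters (bool * int)%type -> R) : measurable_fun setT F ->
  mean P2 (fun w => F (swap B w)) = mean P2 F.
Proof. by move=> mF; rewrite [RHS](mpres_mean (mpres_swap B)). Qed.

Definition influence H (a : int -> R) :=
  forall i, mean P2 (fun w => resample i H w ^+ 2) <= a i ^+ 2.

Lemma influence_shift n H a : bdd H -> influence H a ->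
  influence (fun w => H (shift n w)) (fun i => a (i - n%:Z)).
Proof.
move=> bH Ha i; apply: le_trans (Ha (i - n%:Z)).
pose th (bi : bool * int) := (bi.1, bi.2 + n%:Z).
have thI : injective th by move=> [b j] [b' j'] [-> /addIr ->].
have [mR _] := bddX 2 (bdd_resample (i - n%:Z) bH).
rewrite [leRHS](mpres_mean (iid_reindex thI iP2 iP2)) //.
rewrite le_eqVlt; apply/orP; left; apply/eqP; congr mean; apply: funext => w /=.
have sE A : shift n (mix A w) = mix (fun j => A (j + n%:Z)) (w \o th) by [].
rewrite /resample !sE; congr ((_ - H _) ^+ 2); apply: funext => j.
by rewrite /mix /= eq_sym -subr_eq eq_sym.
Qed.

Lemma influenceB H1 H2 (a1 a2 : int -> R) : bdd H1 -> bdd H2 ->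
  (forall i, 0 <= a1 i) -> (forall i, 0 <= a2 i) ->
  influence H1 a1 -> influence H2 a2 ->
  influence (fun w => H1 w - H2 w) (fun i => a1 i + a2 i).
Proof.
move=> b1 b2 p1 p2 h1 h2 i.
have bR H : bdd H -> L2 P2 (resample i H) by move=> /(bdd_resample i)/L2_bdd.
rewrite (_ : (fun w => _) = fun w => (resample i H1 w + (-1) * resample i H2 w) ^+ 2); last first.
  by apply: funext => w; rewrite /resample; ring.
rewrite -norm2_le ?addr_ge0//.
apply: le_trans (norm2_triangle (bR _ b1) (L2Z (-1) (bR _ b2))) _.
apply: lerD; rewrite norm2_le//.
rewrite (_ : (fun w => (-1 * _) ^+ 2) = fun w => resample i H2 w ^+ 2)//.
by apply: funext => w; rewrite mulN1r sqrrN.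
Qed.

(* Swapping the i-th row exchanges H1 with its resampled version and changes the
   sign of the increment of H2, which produces the factor 1/2. *)
Lemma mean_mix_increment i (A : pred int) H1 H2 (a1 a2 : R) : ~~ A i ->
  bdd H1 -> bdd H2 -> 0 < a1 -> 0 < a2 ->
  mean P2 (fun w => resample i H1 w ^+ 2) <= a1 ^+ 2 ->
  mean P2 (fun w => resample i H2 w ^+ 2) <= a2 ^+ 2 ->
  `|mean P2 (fun w => H1 (mix predT w) * H2 (mix (predU1 i A) w)) -
    mean P2 (fun w => H1 (mix predT w) * H2 (mix A w))| <= a1 * a2.
Proof.
move=> nAi b1 b2 p1 p2 h1 h2.
pose inc w := H2 (mix (predU1 i A) w) - H2 (mix A w).
have binc : bdd inc by apply: bddB; exact: bdd_mix.
have incsw w : inc (swap (pred1 i) w) = - inc w.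
  rewrite /inc !mix_swap opprB; congr (H2 _ - H2 _); apply: eq_mix => j /=;
  by have [->|_] := eqVneq j i; rewrite ?addbF// ?(negbTE nAi).
have bH A' H : bdd H -> bdd (fun w => H (mix A' w)) by exact: bdd_mix.
pose f w := H1 (mix predT w) * inc w.
have bf : bdd f by apply: bddM => //; exact: bH.
rewrite -meanB; [|by apply: L1_bdd; apply: bddM; exact: bH..].
rewrite (_ : (fun w => _) = f); last by apply: funext => w; rewrite /f /inc; ring.
have e : mean P2 f = 2^-1 * mean P2 (fun w => resample i H1 w * inc w).
  have e1 : mean P2 f = mean P2 (fun w => (-1) * (H1 (mix (predC1 i) w) * inc w)).
    rewrite -(mean_swap (pred1 i) bf.1); congr mean; apply: funext => w.
    rewrite /f incsw mix_swap mulrN mulN1r; congr (- (H1 _ * _)).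
  have bg : bdd (fun w => H1 (mix (predC1 i) w) * inc w) by apply: bddM => //; exact: bH.
  have -> : mean P2 (fun w => resample i H1 w * inc w) = mean P2 f + mean P2 f.
    rewrite {2}e1 -meanD; [|exact: L1_bdd|by apply: L1_bdd; exact: bddZ].
    by congr mean; apply: funext => w; rewrite /resample /f; ring.
  by field.
have := @mean_mul_le _ _ _ P2 (resample i H1) inc a1 a2
  (L2_bdd P2 (bdd_resample i b1)) (L2_bdd P2 binc) p1 p2 h1.
(* Swapping the copies on all rows outside [A] and different from [i] turns [inc] into
   [resample i H2], so both have the same second moment. *)
have <- : mean P2 (fun w => resample i H2 w ^+ 2) = mean P2 (fun w => inc w ^+ 2).
  have [mi _] := bddX 2 binc.
  rewrite -(mean_swap (predC (predU1 i A)) mi); congr mean; apply: funext => w.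
  rewrite /inc /resample !mix_swap; congr ((H2 _ - H2 _) ^+ 2); apply: eq_mix => j /=.
    by case: (_ || _).
  by have [->|_] := eqVneq j i; [rewrite (negbTE nAi)|case: (A j)].
move=> /(_ h2) le12; rewrite e normrM ger0_norm ?invr_ge0//.
(* The gained factor 1/2 is given up here, which keeps the constants simple. *)
apply: le_trans (le12); rewrite ler_piMl// invf_le1//; lra.
Qed.

(** [H2] read through [mix] of the rows in [s] interpolates between [H2] itself, when [s] contains
    all its letters, and an independent copy of it, when [s] is empty. Each row removed costs one
    increment. *)
Lemma cov_resample (s : seq int) H1 H2 (a1 a2 : int -> R) : uniq s ->
  bdd H1 -> bdd H2 -> depends (fun i => i \in s) H2 ->
  (forall i, 0 < a1 i) -> (forall i, 0 < a2 i) ->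
  influence H1 a1 -> influence H2 a2 ->
  `|mean P (fun w => H1 w * H2 w) - mean P H1 * mean P H2| <= \sum_(i <- s) a1 i * a2 i.
Proof.
move=> us b1 b2 d2 p1 p2 h1 h2.
have [m1 _] := b1; have [m2 _] := b2.
have -> : mean P (fun w => H1 w * H2 w) =
    mean P2 (fun w => H1 (mix predT w) * H2 (mix (fun i => i \in s) w)).
  rewrite -(mean_mix predT (measurable_funM m1 m2)); congr mean; apply: funext => w.
  by congr (_ * _); apply: d2 => i si; rewrite /mix /= si.
elim: s us {d2} => [_|i s ih /= /andP[si us]].
  rewrite big_nil.
  (* [mix predT] reads the copy tagged [false] and [mix] of the empty set the copy tagged [true]. *)
  have dep (b : bool) H : depends (fun bi => if b then ~~ bi.1 else bi.1) (fun w => H (mix (fun=> b) w)).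
    by move=> w w' ww'; congr H; apply: funext => j; rewrite /mix /= ww'//=; case: b {ww'}.
  rewrite (_ : (fun i => _) = fun=> false); last by apply: funext => i; rewrite in_nil.
  rewrite (mean_indep iP2 (bdd_mix _ b1) (bdd_mix _ b2) (dep true H1) _); last first.
    by move=> w w' ww'; apply: (dep false) => bi bi1; apply: ww'; rewrite /= negbK.
  by rewrite !mean_mix// subrr normr0.
rewrite big_cons.
have := @mean_mix_increment i (fun i => i \in s) H1 H2 (a1 i) (a2 i) si b1 b2 (p1 i) (p2 i) (h1 i) (h2 i).
rewrite (_ : (fun j => j \in i :: s) = predU1 i (fun j => j \in s)); last first.
  by apply: funext => j; rewrite inE.
move=> h; apply: le_trans (lerD h (ih us)); apply: le_trans (ler_normD _ _).
by rewrite addrA subrK.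
Qed.

Variable alpha : R.
Hypothesis alpha1 : 1 < alpha.

(** Influences are bounded on bounded functions of finitely many letters, uniformly along the
    sequence: [cov_resample] applies to these, and the covariance bound survives the L^2 limit. *)
Definition regular (K : R) (F : letters int -> R) := [/\ 0 < K, L2 P F &
  exists Fm : nat -> letters int -> R,
    [/\ forall m, bdd (Fm m), forall m, exists k, depends (window k) (Fm m),
        forall m, influence (Fm m) (fun i => K * zweight alpha i) &
        (fun m => norm2 P (fun w => Fm m w - F w)) @ \oo --> (0 : R)]].

Lemma depends_rows m H : depends (window m) H <-> depends (fun i => i \in rows m) H.
Proof. by split=> d w w' ww'; apply: d => i hi; apply: ww'; rewrite ?mem_rows// -mem_rows. Qed.

Lemma norm2_shift n H : measurable_fun setT H -> norm2 P (fun w => H (shift n w)) = norm2 P H.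
Proof.
move=> mH; rewrite /norm2; congr Num.sqrt.
by apply: (mean_shift n (H := fun w => H w ^+ 2)); exact: measurable_funX.
Qed.

Lemma L2_shift n H : L2 P H -> L2 P (fun w => H (shift n w)).
Proof. exact: (mpres_L2 (mpres_shift n)). Qed.

Lemma cov_regular K1 K2 F G n : regular K1 F -> regular K2 G -> (0 < n)%N ->
  `|mean P (fun w => F (shift n w) * G w) - mean P F * mean P G| <=
  K1 * K2 * (conv_const alpha * n%:R `^ (- alpha)).
Proof.
move=> [K10 iF [Fm [bF dF hF cF]]] [K20 iG [Gm [bG dG hG cG]]] n0.
have lF m := L2_bdd P (bF m); have lG m := L2_bdd P (bG m).
have [mF _] := iF.
set u := fun m => `|mean P (fun w => Fm m (shift n w) * Gm m w) - mean P (Fm m) * mean P (Gm m)|.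
have cu : u @ \oo --> `|mean P (fun w => F (shift n w) * G w) - mean P F * mean P G|.
  apply: cvg_norm; apply: cvgB; last first.
    by apply: cvgM; exact: cvg_mean_norm2.
  apply: (@cvg_mean_mul _ _ _ P (fun m w => Fm m (shift n w)) Gm (fun w => F (shift n w))) => //.
  - exact: L2_shift.
  - by move=> m; exact: L2_shift.
  - rewrite [X in X @ _](_ : _ = (fun m => norm2 P (fun w => Fm m w - F w)))//.
    apply: funext => m; apply: (norm2_shift n (H := fun w => Fm m w - F w)).
    by apply: measurable_funB => //; case: (bF m).
rewrite -(cvg_lim _ cu)//; apply: limr_le; first by apply/cvg_ex; eexists; exact: cu.
apply: nearW => m; rewrite /u; have [k dGk] := dG m.
have := @cov_resample (rows k) (fun w => Fm m (shift n w)) (Gm m)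
  (fun i => K1 * zweight alpha (i - n%:Z)) (fun i => K2 * zweight alpha i)
  (uniq_rows k) (bdd_shift n (bF m)) (bG m) ((depends_rows _ _).1 dGk).
rewrite mean_shift; last by case: (bF m).
move=> h; apply: le_trans (h _ _ _ _) _ => //.
- by move=> i; rewrite mulr_gt0 ?zweight_gt0.
- by move=> i; rewrite mulr_gt0 ?zweight_gt0.
- exact: (influence_shift n (bF m) (hF m)).
rewrite (eq_bigr (fun i => K1 * K2 * (zweight alpha i * zweight alpha (i - n%:Z)))); last first.
  by move=> i _; ring.
rewrite -mulr_sumr; apply: ler_wpM2l; first by rewrite mulr_ge0// ltW.
by apply: sum_zweight_conv => //; exact: uniq_rows.
Qed.

Lemma windowS m n i : (m <= n)%N -> window m i -> window n i.
Proof. by rewrite /window; lia. Qed.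

Lemma depends_windowS m n H : (m <= n)%N -> depends (window m) H -> depends (window n) H.
Proof. by move=> mn d w w' ww'; apply: d => i /(windowS mn); exact: ww'. Qed.

(* The constant 2 K does not depend on the approximant H, which makes the variance
   bounds for F - H uniform. *)
Lemma regularB_approx K F H m : regular K F -> bdd H -> depends (window m) H ->
  influence H (fun i => K * zweight alpha i) -> regular (2 * K) (fun w => F w - H w).
Proof.
move=> [K0 iF [Fm [bF dF hF cF]]] bH dH hH; split.
- by rewrite mulr_gt0.
- by apply: L2B => //; exact: L2_bdd.
exists (fun p w => Fm p w - H w); split.
- by move=> p; exact: bddB.
- move=> p; have [k dk] := dF p; exists (k + m)%N => w w' ww'; congr (_ - _).
    exact: (depends_windowS (leq_addr m k) dk).
  exact: (depends_windowS (leq_addl k m) dH).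
- move=> p; rewrite (_ : (fun i => _) = fun i => K * zweight alpha i + K * zweight alpha i).
    by apply: influenceB => // i; rewrite mulr_ge0 ?ltW ?zweight_gt0.
  by apply: funext => i; ring.
- apply: cvg_trans cF; apply: near_eq_cvg; apply: nearW => p; congr norm2.
  by apply: funext => w; ring.
Qed.

Definition psum n F (w : letters int) : R := \sum_(0 <= k < n) F (shift k w).

Lemma psumS n F w : psum n.+1 F w = psum n F w + F (shift n w).
Proof. by rewrite /psum big_nat_recr. Qed.

Lemma psumD n k F w : psum (n + k) F w = psum n F w + psum k F (shift n w).
Proof.
elim: k => [|k ih]; first by rewrite addn0 /psum (big_geq (leqnn 0)) addr0.
by rewrite addnS !psumS ih addrA shiftD addnC.
Qed.

Lemma psumB n F G w : psum n (fun w => F w - G w) w = psum n F w - psum n G w.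
Proof. by rewrite /psum sumrB. Qed.

Lemma bdd_psum n F : bdd F -> bdd (psum n F).
Proof. by move=> bF; apply: bdd_sum => k; exact: bdd_shift. Qed.

Lemma L2_psum n F : L2 P F -> L2 P (psum n F).
Proof. by move=> iF; apply: L2_sum => k; exact: L2_shift. Qed.

Lemma psum_le n F (B : R) w : (forall w, `|F w| <= B) -> `|psum n F w| <= n%:R * B.
Proof.
move=> FB; elim: n => [|n ih]; first by rewrite /psum big_geq// normr0 mul0r.
rewrite psumS -natr1 mulrDl mul1r; apply: le_trans (ler_normD _ _) _.
exact: lerD.
Qed.

Lemma mean_shift_mul j k F G : L2 P F -> L2 P G ->
  mean P (fun w => F (shift j w) * G (shift (j + k)%N w)) =
  mean P (fun w => F w * G (shift k w)).
Proof.
move=> [mF _] [mG _].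
have mm : measurable_fun setT (fun w => F w * G (shift k w)).
  by apply: measurable_funM => //; apply: measurableT_comp => //; case: (mpres_shift k).
rewrite -(mean_shift j mm); congr mean; apply: funext => w.
by rewrite shiftD addnC.
Qed.

Lemma mean_psum_sqrS n F : L2 P F ->
  mean P (fun w => psum n.+1 F w ^+ 2) =
  mean P (fun w => psum n F w ^+ 2) + mean P (fun w => F w ^+ 2) +
  2 * mean P (fun w => psum n F w * F (shift n w)).
Proof.
move=> iF; have iFn := L2_shift n iF; have iS := L2_psum n iF.
have [mF _] := iF; have iFS := L2_mul iS iFn; have iFZ := L1Z 2 iFS.
have [_ iS2] := iS; have [_ iF2] := iFn.
rewrite -(mean_shift n (H := fun w => F w ^+ 2)); last exact: measurable_funX.
rewrite -meanZ// -meanD// -meanD//; last exact: L1D.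
by congr mean; apply: funext => w; rewrite psumS; ring.
Qed.

Lemma mean_psum_cross n F : L2 P F ->
  mean P (fun w => psum n F w * F (shift n w)) =
  \sum_(0 <= i < n) mean P (fun w => F (shift i.+1 w) * F w).
Proof.
move=> iF.
rewrite (_ : (fun w => _) = fun w => \sum_(0 <= k < n) F (shift k w) * F (shift n w)); last first.
  by apply: funext => w; rewrite /psum mulr_suml.
rewrite mean_sum; last by move=> k; apply: L2_mul; exact: L2_shift.
rewrite big_nat_rev add0n; apply: eq_big_nat => k /andP[_ kn].
rewrite (_ : (fun w => F (shift k.+1 w) * F w) = fun w => F w * F (shift k.+1 w)); last first.
  by apply: funext => w; rewrite mulrC.
rewrite -(mean_shift_mul (n - k.+1) k.+1 iF iF).
by rewrite subnK.
Qed.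

Lemma weight_tail (e : R) : 0 < e ->
  exists N, forall n, \sum_(N <= i < n) weight alpha i <= e.
Proof.
move=> e0; pose u n := \sum_(0 <= i < n) weight alpha i.
have w0 k : 0 <= weight alpha k by exact/ltW/weight_gt0.
have nu : nondecreasing_seq u.
  apply/nondecreasing_seqP => n; rewrite /u big_nat_recr//= lerDl//.
have cu : cvgn u.
  apply: nondecreasing_is_cvgn => //; exists (zeta_bound alpha) => _ [n _ <-].
  exact: sum_weight_le.
have := nondecreasing_cvgn_le nu cu => ule.
move/cvgrPdist_lt: (cu) => /(_ e e0)[N _ /(_ N (leqnn N))] uN.
exists N => n; have [nN|/ltnW Nn] := leqP n N; first by rewrite big_geq ?ltW.
have : u n = u N + \sum_(N <= i < n) weight alpha i by rewrite /u -big_cat_nat.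
have := ule n; move: uN; rewrite ger0_norm ?subr_ge0//.
by move: (limn u) (u n) (u N) (\sum_(_ <= _ < _) _) => a b c d; lra.
Qed.

(* |E F(shift i) F| is at most E F^2 and at most C i^-alpha; the former is used for
   i <= N and the latter for i > N. *)
Lemma mean_psum_sqr_le K F N (d t : R) : regular K F -> mean P F = 0 ->
  mean P (fun w => F w ^+ 2) <= d ->
  (forall n, \sum_(N <= i < n) weight alpha i <= t) ->
  forall n, mean P (fun w => psum n F w ^+ 2) <=
    n%:R * (d + 2 * (N%:R * d + K ^+ 2 * conv_const alpha * t)).
Proof.
move=> rF EF0 Fd tail n; have [K0 iF _] := rF.
have d0 : 0 <= d by apply: le_trans Fd; apply: mean_ge0 => w; exact: sqr_ge0.
have K20 : 0 <= K ^+ 2 * conv_const alpha by rewrite mulr_ge0 ?sqr_ge0 ?conv_const_ge0.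
have c1 i : `|mean P (fun w => F (shift i w) * F w)| <= d.
  apply: le_trans (mean_mul_norm2 (L2_shift i iF) iF) _.
  by rewrite norm2_shift; [rewrite -expr2 sqr_norm2|case: iF].
have c2 i : `|mean P (fun w => F (shift i.+1 w) * F w)| <= K ^+ 2 * conv_const alpha * weight alpha i.
  have := cov_regular rF rF (ltn0Sn i).
  by rewrite EF0 mul0r subr0 -expr2 mulrA.
have sumc k : `|\sum_(0 <= i < k) mean P (fun w => F (shift i.+1 w) * F w)| <=
    N%:R * d + K ^+ 2 * conv_const alpha * t.
  apply: le_trans (ler_norm_sum _ _ _) _.
  have [kN|/ltnW Nk] := leqP k N.
    apply: (@le_trans _ _ (k%:R * d)).
      by rewrite mulr_natl -{2}[k]subn0 -sumr_const_nat; apply: ler_sum => i _; exact: c1.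
    have t0 : 0 <= t by have := tail N; rewrite big_geq.
    have kN' : k%:R <= N%:R :> R by rewrite ler_nat.
    by have := mulr_ge0 K20 t0; have := ler_wpM2r d0 kN'; lra.
  rewrite (@big_cat_nat _ _ _ N)//=; apply: lerD.
    by rewrite mulr_natl -{2}[N]subn0 -sumr_const_nat; apply: ler_sum => i _; exact: c1.
  apply: le_trans (ler_sum _ (fun i _ => c2 i)) _.
  by rewrite -mulr_sumr ler_wpM2l.
elim: n => [|n ih].
  by rewrite mul0r (_ : (fun w => _) = fun=> 0) ?mean_cst//; apply: funext => w; rewrite /psum big_geq// expr0n.
rewrite mean_psum_sqrS// mean_psum_cross// -natr1 mulrDl mul1r.
have := le_trans (ler_norm _) (sumc n); move: ih.
by move: (mean P (fun w => psum n F w ^+ 2)) (\sum_(0 <= _ < _) _) => x y; lra.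
Qed.

(** * Central limit theorem with rate, for functions of finitely many letters *)

Section FiniteRangeCLT.
Variables (H : letters int -> R) (B : R) (m : nat).
Hypotheses (mH : measurable_fun setT H) (HB : forall w, `|H w| <= B)
  (dH : depends (window m) H) (EH : mean P H = 0).

(** The windows [[j-m, j+m)] and [[k-m, k+m)] are disjoint as soon as [k - j >= 2m], so terms at
    distance [r] or more are independent. *)
Let r := (m + m)%N.

Let bH : bdd H. Proof. by split=> //; exists B. Qed.

Let B0 : 0 <= B. Proof. exact: le_trans (HB (fun=> 0%N)). Qed.

Lemma depends_comp (J : pred int) (F : letters int -> R) (g : R -> R) :
  depends J F -> depends J (fun w => g (F w)).
Proof. by move=> dF w w' ww'; rewrite (dF w w'). Qed.

Lemma depends_mul (J : pred int) (F G : letters int -> R) :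
  depends J F -> depends J G -> depends J (fun w => F w * G w).
Proof. by move=> dF dG w w' ww'; rewrite (dF w w')// (dG w w'). Qed.

Lemma depends_shift k : depends (predC (fun i => i < k%:Z - m%:Z)) (fun w => H (shift k w)).
Proof.
move=> w w' ww'; apply: dH => i /andP[i1 i2]; apply: ww' => /=.
by rewrite -leNgt; lia.
Qed.

Lemma depends_psum k : depends (fun i => i < k%:Z + m%:Z) (psum k H).
Proof.
move=> w w' ww'; rewrite /psum; apply: eq_big_nat => j /andP[_ jk].
by apply: dH => i /andP[i1 i2]; apply: ww'; lia.
Qed.

Lemma depends_psum_shift n k : depends (predC (fun i => i < k%:Z - m%:Z)) (fun w => psum n H (shift k w)).
Proof.
move=> w w' ww'; rewrite /psum; apply: eq_big_nat => j _; rewrite !shiftD.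
by apply: dH => i /andP[i1 i2]; apply: ww' => /=; rewrite -leNgt; lia.
Qed.

(** By stationarity the second term is twice the sum of the autocovariances at lags 1 to [r]; the
    later ones vanish. This is the Green-Kubo variance. *)
Definition long_run_var : R := mean P (fun w => H w ^+ 2) +
  2 * mean P (fun w => psum r H w * H (shift r w)).

Let c0 := mean P (fun w => H w ^+ 2).
Let c1 := mean P (fun w => psum r H w * H (shift r w)).

Let bSk n k : bdd (fun w => psum n H (shift k w)).
Proof. by apply: bdd_shift; exact: bdd_psum. Qed.

Let bX k : bdd (fun w => H (shift k w)). Proof. exact: bdd_shift. Qed.

Lemma bdd_smooth_comp (g : R -> R) (L : R) (F : letters int -> R) : continuous g ->
  (forall x, `|g x| <= L) -> bdd F -> bdd (fun w => g (F w)).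
Proof.
move=> cg gL [mF _]; split; last by exists L => w.
by apply: measurableT_comp => //; exact: continuous_measurable_fun.
Qed.

Let norm_mul_le (x y a b : R) : `|x| <= a -> `|y| <= b -> `|x * y| <= a * b.
Proof. by move=> xa yb; rewrite normrM ler_pM. Qed.

(* ga, gb stand for g at S_(k+1), S_k; g1S, g1a for g' at S_k, S_(k-r); g2S, g2a, g2b
   for g'' at S_k, S_(k-r), S_(k-2r); x, y for the increments from S_k, S_(k-r). *)
Let clt_remainder (L b q ga gb g1S g2S g1a g2a g2b x y c d : R) : 0 <= L ->
  `|x| <= b -> `|y| <= q -> `|c| <= b ^+ 2 -> `|d| <= q * b ->
  `|ga - gb - g1S * x - g2S * (x ^+ 2 / 2)| <= L * `|x| ^+ 3 ->
  `|g1S - g1a - g2a * y| <= L * `|y| ^+ 2 ->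
  `|g2S - g2a| <= L * q -> `|g2a - g2b| <= L * q ->
  `|ga - gb - (c / 2 + d) * g2S -
    (g1a * x + 2^-1 * (g2a * (x ^+ 2 - c)) + g2b * (y * x - d))| <= L * (4 * b * (b + q) ^+ 2).
Proof.
move=> L0 xb yq cb db t0 t1 t2 t3.
have b0 : 0 <= b by exact: le_trans xb.
have q0 : 0 <= q by exact: le_trans yq.
have {}t0 : `|ga - gb - g1S * x - g2S * (x ^+ 2 / 2)| <= L * b ^+ 3.
  by apply: le_trans t0 _; rewrite ler_wpM2l// lerXn2r.
have {}t1 : `|g1S - g1a - g2a * y| <= L * q ^+ 2.
  by apply: le_trans t1 _; rewrite ler_wpM2l// lerXn2r.
have x2 : `|x ^+ 2| <= b ^+ 2 by rewrite normrX lerXn2r.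
have h1 := norm_mul_le t1 xb; have h2 := norm_mul_le t3 (norm_mul_le yq xb).
have h3 := norm_mul_le t2 x2; have h4 := norm_mul_le t2 cb.
have h5 := norm_mul_le t2 db; have h6 := norm_mul_le t3 db.
have p1 : 0 <= L * b ^+ 3 by rewrite mulr_ge0 ?exprn_ge0.
have p2 : 0 <= L * b ^+ 2 * q by rewrite !mulr_ge0 ?exprn_ge0.
move: h1 h2 h3 h4 h5 h6 t0; rewrite !ler_norml => /andP[? ?] /andP[? ?] /andP[? ?] /andP[? ?] /andP[? ?] /andP[? ?] /andP[? ?].
by apply/andP; split; lra.
Qed.

Let mean_past_future (j : int) (F G : letters int -> R) : bdd F -> bdd G ->
  depends (fun i => i < j) F -> depends (predC (fun i => i < j)) G -> mean P G = 0 ->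
  mean P (fun w => F w * G w) = 0.
Proof. by move=> bF bG dF dG G0; rewrite (mean_indep iP bF bG dF dG) G0 mulr0. Qed.

(** Taylor expansion at [S_k], where [g'(S_k)] is not independent of the new term [x]. It is
    expanded back to [S_(k-r)], independent of [x]; the correction [g''(S_(k-r)) y x] is in turn
    moved back to [S_(k-2r)], independent of [y x]. Replacing [x^2] and [y x] by their means then
    costs nothing in expectation. *)
Lemma clt_step (g g1 g2 : R -> R) (L e : R) k : smooth L g g1 g2 -> 0 <= e -> (r + r <= k)%N ->
  `|mean P (fun w => g (e * psum k.+1 H w)) - mean P (fun w => g (e * psum k H w)) -
    e ^+ 2 * long_run_var / 2 * mean P (fun w => g2 (e * psum k H w))| <=
  e ^+ 3 * (L * (4 * B ^+ 3 * (1 + r%:R) ^+ 2)).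
Proof.
move=> sg e0 rk; have L0 := smooth_ge0 sg.
have bS n : bdd (fun w => e * psum n H w) by apply: bddZ; exact: bdd_psum.
have b0 n := bdd_smooth_comp (lip_continuous (smooth_lip0 sg)) (smooth_bound0 sg) (bS n).
have b1 n := bdd_smooth_comp (lip_continuous (smooth_lip1 sg)) (smooth_bound1 sg) (bS n).
have b2 n := bdd_smooth_comp (lip_continuous (smooth_lip2 sg)) (smooth_bound2 sg) (bS n).
pose k1 := (k - r)%N; pose k2 := (k - r - r)%N.
have kE1 : k = (k1 + r)%N by rewrite /k1; lia.
have kE2 : k1 = (k2 + r)%N by rewrite /k1 /k2; lia.
pose x w := e * H (shift k w); pose y w := e * psum r H (shift k1 w).
pose c := e ^+ 2 * c0; pose d := e ^+ 2 * c1.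
have SY w : e * psum k H w = e * psum k1 H w + y w by rewrite {1}kE1 psumD mulrDr.
have Y2 w : e * psum k1 H w = e * psum k2 H w + e * psum r H (shift k2 w).
  by rewrite {1}kE2 psumD mulrDr.
have eB (u a : R) : `|u| <= a -> `|e * u| <= e * a by move=> ua; rewrite normrM ger0_norm// ler_wpM2l.
have xB w : `|x w| <= e * B by apply: eB; exact: HB.
have yB w : `|y w| <= e * (r%:R * B) by apply: eB; exact: psum_le.
have bx : bdd x by exact: bddZ. have bY : bdd y by apply: bddZ; exact: bSk.
have bxx : bdd (fun w => x w ^+ 2) by exact: bddX.
have byx : bdd (fun w => y w * x w) by exact: bddM.
have Exx : mean P (fun w => x w ^+ 2) = c.
  rewrite /c /c0 -(mean_shift k (H := fun w => H w ^+ 2)); last exact: measurable_funX.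
  by rewrite -meanZ; [congr mean; apply: funext => w; rewrite /x exprMn|exact/L1_bdd/bddX].
have Eyx : mean P (fun w => y w * x w) = d.
  rewrite /d /c1 -(mean_shift_mul k1 r (L2_bdd P (bdd_psum r bH)) (L2_bdd P bH)) -kE1.
  by rewrite -meanZ; [congr mean; apply: funext => w; rewrite /x /y; ring|exact/L1_bdd/bddM].
have dx : depends (predC (fun i => i < k%:Z - m%:Z)) x.
  by apply: (depends_comp (fun u => e * u)); exact: depends_shift.
(* [S_(k-r)] reads letters below [k1 + m], which is [k - m], the lowest index read by the new
   term. *)
have dk1 (h : R -> R) : depends (fun i => i < k%:Z - m%:Z) (fun w => h (e * psum k1 H w)).
  apply: (depends_comp (fun u => h (e * u))).
  by rewrite (_ : k%:Z - m%:Z = k1%:Z + m%:Z); [exact: depends_psum|rewrite /k1 /r; lia].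
have Z1 : mean P (fun w => g1 (e * psum k1 H w) * x w) = 0.
  apply: (mean_past_future (b1 k1) bx (dk1 g1) dx).
  by rewrite meanZ ?mean_shift ?EH ?mulr0//; exact: L1_bdd.
have bZ2 : bdd (fun w => x w ^+ 2 - c) by apply: bddB => //; exact: bdd_cst.
have Z2 : mean P (fun w => g2 (e * psum k1 H w) * (x w ^+ 2 - c)) = 0.
  apply: (mean_past_future (b2 k1) bZ2 (dk1 g2)); first exact: (depends_comp (fun u => u ^+ 2 - c)).
  by rewrite meanB ?mean_cst ?Exx ?subrr//; [exact: L1_bdd|exact: L1_cst].
have bZ3 : bdd (fun w => y w * x w - d) by apply: bddB => //; exact: bdd_cst.
have Z3 : mean P (fun w => g2 (e * psum k2 H w) * (y w * x w - d)) = 0.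
  apply: (mean_past_future (j := k1%:Z - m%:Z) (b2 k2) bZ3).
  - apply: (depends_comp (fun u => g2 (e * u))).
    by rewrite (_ : k1%:Z - m%:Z = k2%:Z + m%:Z); [exact: depends_psum|rewrite /k2 /k1 /r; lia].
  - apply: (depends_comp (fun u => u - d)); apply: depends_mul.
      by apply: (depends_comp (fun u => e * u)); exact: depends_psum_shift.
    move=> w w' ww'; apply: dx => i /= hi; apply: ww' => /=.
    by apply: contra hi => hi; rewrite (lt_le_trans hi)// /k1; lia.
  by rewrite meanB ?mean_cst ?Eyx ?subrr//; [exact: L1_bdd|exact: L1_cst].
(* [Z] gathers the mean-zero terms; subtracting it under the expectation leaves a remainder that is
   bounded pointwise. *)
pose Z w := g1 (e * psum k1 H w) * x w + 2^-1 * (g2 (e * psum k1 H w) * (x w ^+ 2 - c)) +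
  g2 (e * psum k2 H w) * (y w * x w - d).
have bz1 := bddM (b1 k1) bx; have bz2 := bddZ 2^-1 (bddM (b2 k1) bZ2).
have bz3 := bddM (b2 k2) bZ3; have bZ : bdd Z := bddD (bddD bz1 bz2) bz3.
have EZ : mean P Z = 0.
  rewrite meanD; [|exact/L1_bdd/bddD|exact: L1_bdd]; rewrite meanD; [|exact: L1_bdd..].
  by rewrite meanZ; [rewrite Z1 Z2 Z3 mulr0 !addr0|exact/L1_bdd/bddM].
have -> : e ^+ 2 * long_run_var / 2 = c / 2 + d by rewrite /long_run_var -/c0 -/c1 /c /d; field.
rewrite -meanZ; [|exact: L1_bdd]; rewrite -[X in `|X|]subr0 -EZ.
rewrite -meanB; [|exact: L1_bdd..]; rewrite -meanB; [|exact/L1_bdd/bddB|exact/L1_bdd/bddZ].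
have bT := bddB (bddB (b0 k.+1) (b0 k)) (bddZ (c / 2 + d) (b2 k)).
rewrite -meanB; [|exact: L1_bdd..]; apply: norm_mean_cst; first exact/L1_bdd/bddB.
have -> : e ^+ 3 * (L * (4 * B ^+ 3 * (1 + r%:R) ^+ 2)) =
  L * (4 * (e * B) * (e * B + e * (r%:R * B)) ^+ 2) by ring.
move=> w; apply: (clt_remainder (g1S := g1 (e * psum k H w))) => //.
- rewrite -Exx; apply: norm_mean_cst; first exact: L1_bdd.
  by move=> w'; rewrite normrX lerXn2r ?nnegrE// mulr_ge0.
- by rewrite -Eyx; apply: norm_mean_cst; [exact: L1_bdd|move=> w'; exact: norm_mul_le].
- by rewrite psumS mulrDr; exact: (smooth_taylor0 sg).
- by rewrite SY; exact: (smooth_taylor1 sg).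
- by rewrite SY; apply: le_trans (smooth_lip2 sg _ _) _; rewrite ler_wpM2l.
- by rewrite Y2; apply: le_trans (smooth_lip2 sg _ _) _; rewrite ler_wpM2l//; apply: eB; exact: psum_le.
Qed.

(** Crude bound for the first [2r] steps, where there is no [S_(k-2r)] to go back to; their number
    does not grow with [n]. *)
Lemma clt_small_step (g g1 g2 : R -> R) (L e : R) k : smooth L g g1 g2 -> 0 <= e ->
  `|mean P (fun w => g (e * psum k.+1 H w)) - mean P (fun w => g (e * psum k H w))| <= L * (e * B).
Proof.
move=> sg e0; have L0 := smooth_ge0 sg.
have cg0 : continuous g := lip_continuous (smooth_lip0 sg).
have b0 n : bdd (fun w => g (e * psum n H w)).
  by apply: (bdd_smooth_comp cg0 (smooth_bound0 sg)); apply: bddZ; exact: bdd_psum.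
rewrite -meanB; [|exact: L1_bdd..]; apply: norm_mean_cst; first by apply: L1_bdd; exact: bddB.
move=> w; rewrite psumS mulrDr; apply: le_trans (smooth_lip0 sg _ _) _.
by rewrite ler_wpM2l// normrM ger0_norm// ler_wpM2l.
Qed.

(** From [r] on, each new term adds exactly [long_run_var]. Linear growth identifies its sign and
    any linear upper bound, as the next two lemmas exploit with [n] large. *)
Lemma mean_psum_sqr_eq n :
  mean P (fun w => psum (r + n) H w ^+ 2) = mean P (fun w => psum r H w ^+ 2) + n%:R * long_run_var.
Proof.
have iH := L2_bdd P bH.
elim: n => [|n ih]; first by rewrite addn0 mul0r addr0.
rewrite addnS mean_psum_sqrS// ih -natr1.
suff -> : mean P (fun w => psum (r + n) H w * H (shift (r + n) w)) =
    mean P (fun w => psum r H w * H (shift r w)) by rewrite /long_run_var; ring.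
pose k := (r + n)%N; have kE : k = (n + r)%N by rewrite /k addnC.
rewrite -/k (_ : (fun w => psum k H w * _) =
   fun w => psum n H w * H (shift k w) + psum r H (shift n w) * H (shift k w)); last first.
  by apply: funext => w; rewrite {1}kE psumD mulrDl.
have bS := bdd_psum n bH.
rewrite meanD; [|by apply: L1_bdd; exact: bddM..].
rewrite (mean_indep iP (J := fun i => i < k%:Z - m%:Z) bS (bX k)); last first.
- exact: depends_shift.
- rewrite (_ : k%:Z - m%:Z = n%:Z + m%:Z); first exact: depends_psum.
  by rewrite /k /r; lia.
rewrite mean_shift// EH mulr0 add0r kE.
exact: (mean_shift_mul n r (L2_bdd P (bdd_psum r bH)) iH).
Qed.

Lemma long_run_var_ge0 : 0 <= long_run_var.
Proof.
rewrite leNgt; apply/negP => s0.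
pose a := mean P (fun w => psum r H w ^+ 2).
have [n an] : exists n : nat, a / (- long_run_var) < n%:R.
  by exists (Num.truncn (a / (- long_run_var))).+1; rewrite truncnS_gt.
have := mean_psum_sqr_eq n; rewrite -/a.
have : 0 <= mean P (fun w => psum (r + n) H w ^+ 2) by apply: mean_ge0 => w; exact: sqr_ge0.
move: an; rewrite ltr_pdivrMr ?oppr_gt0//; move: (mean P _) => x; clearbody a; lra.
Qed.

Lemma long_run_var_le (V : R) : (forall n, mean P (fun w => psum n H w ^+ 2) <= n%:R * V) ->
  long_run_var <= V.
Proof.
move=> hV; rewrite leNgt; apply/negP => s0; rewrite -subr_gt0 in s0.
have [n an] : exists n : nat, r%:R * V / (long_run_var - V) < n%:R.
  by exists (Num.truncn (r%:R * V / (long_run_var - V))).+1; rewrite truncnS_gt.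
have := hV (r + n)%N; rewrite mean_psum_sqr_eq natrD.
have : 0 <= mean P (fun w => psum r H w ^+ 2) by apply: mean_ge0 => w; exact: sqr_ge0.
by move: an; rewrite ltr_pdivrMr//; move: (mean P _) => x; lra.
Qed.

(** The variance of the reference Gaussian stays symbolic, hence the division. *)
Definition clt_sd : R := Num.sqrt (long_run_var / gauss_var R).

(** Adding a term and removing one unit of heat time change the expectation by the same second-order
    amount, up to [n^(-3/2)]. The [n] steps cost [n^(-1/2)] in total, and so do the first [2r] crude
    steps. *)
Lemma clt_finite_range_rate (h h1 h2 : R -> R) (L : R) : smooth L h h1 h2 ->
  exists C : R, forall n, (0 < n)%N ->
    `|mean P (fun w => h (psum n H w / Num.sqrt n%:R)) - gauss_avg clt_sd h 0| <= C * (Num.sqrt n%:R)^-1.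
Proof.
move=> sh; have L0 := smooth_ge0 sh.
have v0 : 0 < gauss_var R := mean_gauss_sqr_gt0 R.
have sd0 : 0 <= clt_sd := sqrtr_ge0 _.
have sd2 : clt_sd ^+ 2 * gauss_var R = long_run_var.
  rewrite sqr_sqrtr ?divfK ?gt_eqF// divr_ge0//; [exact: long_run_var_ge0|exact: ltW].
pose C1 := L * (4 * B ^+ 3 * (1 + r%:R) ^+ 2) + L * (clt_sd ^+ 3 * gauss_abs3 R).
pose C2 := L * B + L * (clt_sd * gauss_abs1 R).
have C10 : 0 <= C1.
  by rewrite addr_ge0// !mulr_ge0// ?exprn_ge0 ?addr_ge0 ?gauss_abs3_ge0.
have C20 : 0 <= C2 by rewrite addr_ge0// !mulr_ge0// gauss_abs1_ge0.
exists (C1 + (r + r)%:R * C2) => n n0.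
have sn0 : 0 < Num.sqrt n%:R :> R by rewrite sqrtr_gt0 ltr0n.
pose e := (Num.sqrt n%:R)^-1 : R; have e0 : 0 < e by rewrite invr_gt0.
have e2 : n%:R * e ^+ 2 = 1 by rewrite exprVn sqr_sqrtr// divff// pnatr_eq0 -lt0n.
pose a := e * clt_sd; have a0 : 0 <= a by rewrite mulr_ge0// ltW.
(* [h] averaged over the Gaussian noise of the [j] terms still to be added; [hhS] is the semigroup
   law for one of them. *)
pose hh j := gauss_avg (a * Num.sqrt j%:R) h.
have shh j : smooth L (hh j) (gauss_avg (a * Num.sqrt j%:R) h1) (gauss_avg (a * Num.sqrt j%:R) h2).
  exact: smooth_gauss_avg.
have chh j : continuous (hh j) := lip_continuous (smooth_lip0 (shh j)).
have hhS j : hh j.+1 = gauss_avg a (hh j).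
  apply: funext => x; rewrite gauss_avg_semigroup//.
  - rewrite /hh; congr (gauss_avg _ h x); clear -a0; clearbody a.
    rewrite exprMn sqr_sqrtr// -{1}[a ^+ 2]mulr1 -mulrDr.
    by rewrite sqrtrM ?sqr_ge0// sqrtr_sqr ger0_norm// nat1r.
  - by rewrite mulr_ge0// sqrtr_ge0.
  - exact: lip_continuous (smooth_lip0 sh).
  - by exists L; exact: smooth_bound0 sh.
  - exact: chh.
pose D k := mean P (fun w => hh (n - k)%N (e * psum k H w)).
have Dstep k : (k < n)%N -> `|D k.+1 - D k| <= e ^+ 3 * C1 + (if (k < r + r)%N then e * C2 else 0).
  move=> kn; rewrite /D (_ : (n - k)%N = (n - k.+1).+1); last by lia.
  set j := (n - k.+1)%N; have sg := shh j; set g2 := gauss_avg _ h2 in sg.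
  have bS i : bdd (fun w => e * psum i H w) by apply: bddZ; exact: bdd_psum.
  have b0 (i l : nat) : bdd (fun w => hh l (e * psum i H w)).
    exact: (bdd_smooth_comp (chh l) (smooth_bound0 (shh l)) (bS i)).
  have b2 i : bdd (fun w => g2 (e * psum i H w)).
    exact: (bdd_smooth_comp (lip_continuous (smooth_lip2 sg)) (smooth_bound2 sg) (bS i)).
  have e3 : 0 <= e ^+ 3 * C1 by rewrite mulr_ge0// exprn_ge0// ltW.
  case: ifPn => kr.
    have G : `|mean P (fun w => hh j.+1 (e * psum k H w)) - mean P (fun w => hh j (e * psum k H w))| <=
        L * (a * gauss_abs1 R).
      rewrite -meanB; [|exact: L1_bdd..]; apply: norm_mean_cst; first by apply: L1_bdd; exact: bddB.
      move=> w; rewrite hhS -(gauss_avg0 (hh j)); apply: le_trans (gauss_avg_lip a 0 _ sg) _.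
      by rewrite subr0 ger0_norm.
    have S := clt_small_step k sg (ltW e0).
    rewrite distrC in G; apply: (@le_trans _ _ (L * (e * B) + L * (a * gauss_abs1 R))).
      by have := le_trans (ler_normD _ _) (lerD S G); rewrite addrA subrK.
    rewrite (_ : L * _ + _ = e * C2); first by rewrite lerDr.
    by rewrite /C2 /a; ring.
  rewrite -leqNgt in kr; rewrite addr0; have S := clt_step sg (ltW e0) kr.
  have av : a ^+ 2 * gauss_var R / 2 = e ^+ 2 * long_run_var / 2 by rewrite -sd2 /a; ring.
  have G : `|mean P (fun w => hh j.+1 (e * psum k H w)) - mean P (fun w => hh j (e * psum k H w)) -
      e ^+ 2 * long_run_var / 2 * mean P (fun w => g2 (e * psum k H w))| <= L * (a ^+ 3 * gauss_abs3 R).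
    rewrite -meanZ; last exact: L1_bdd.
    rewrite -meanB; [|exact: L1_bdd..].
    rewrite -meanB; [|by apply: L1_bdd; exact: bddB|by apply: L1_bdd; exact: bddZ].
    apply: norm_mean_cst; first by apply: L1_bdd; apply: bddB; [exact: bddB|exact: bddZ].
    by move=> w; rewrite hhS -av [_ * g2 _]mulrC; exact: gauss_avg_taylor.
  rewrite (_ : e ^+ 3 * C1 = e ^+ 3 * (L * (4 * B ^+ 3 * (1 + r%:R) ^+ 2)) + L * (a ^+ 3 * gauss_abs3 R)); last first.
    by rewrite /C1 /a; ring.
  move: S G.
  move: (mean P (fun w => hh j (e * psum k.+1 H w))) (mean P (fun w => hh j (e * psum k H w)))
    (mean P (fun w => hh j.+1 (e * psum k H w))) (_ * mean P _) => x1 x2 x3 x4 S G.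
  rewrite distrC in G; apply: le_trans (lerD S G); apply: le_trans (ler_normD _ _).
  by rewrite le_eqVlt; apply/orP; left; apply/eqP; congr `|_|; ring.
have Dsum : `|D n - D 0%N| <= \sum_(0 <= k < n) (e ^+ 3 * C1 + (if (k < r + r)%N then e * C2 else 0)).
  rewrite -(telescope_sumr _ (leq0n n)); apply: le_trans (ler_norm_sum _ _ _) _.
  by apply: ler_sum_nat => k /andP[_ kn]; exact: Dstep.
have Dn : D n = mean P (fun w => h (psum n H w / Num.sqrt n%:R)).
  by rewrite /D subnn; congr mean; apply: funext => w; rewrite /hh sqrtr0 mulr0 gauss_avg0 mulrC.
have D0 : D 0%N = gauss_avg clt_sd h 0.
  rewrite /D subn0 (_ : (fun w => _) = fun=> gauss_avg clt_sd h 0) ?mean_cst//.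
  apply: funext => w; rewrite /psum big_geq// mulr0 /hh /a /e.
  by rewrite mulrAC mulVf ?mul1r// gt_eqF.
rewrite -Dn -D0; apply: le_trans Dsum _.
rewrite big_split /= sumr_const_nat subn0 -big_mkcond /=.
have eC2 : 0 <= e * C2 by rewrite mulr_ge0// ltW.
have s2 : \sum_(0 <= k < n | (k < r + r)%N) e * C2 <= (r + r)%:R * (e * C2).
  rewrite -big_filter big_const_seq count_predT iter_addr_0 -[leLHS]mulr_natl ler_wpM2r// ler_nat.
  apply: (@leq_trans (size (iota 0 (r + r)))); last by rewrite size_iota.
  apply: uniq_leq_size; first by rewrite filter_uniq// iota_uniq.
  by move=> k; rewrite mem_filter mem_iota => /andP[-> _].
apply: (@le_trans _ _ (e * C1 + (r + r)%:R * (e * C2))); last first.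
  by rewrite -/e le_eqVlt; apply/orP; left; apply/eqP; ring.
apply: lerD => //; rewrite -[leLHS]mulr_natl exprS [e * _]mulrC.
by rewrite -[_ * e * C1]mulrA [leLHS]mulrA e2 mul1r.
Qed.

End FiniteRangeCLT.

(** * Central limit theorem for regular functions *)

Section RegularCLT.
Variables (K : R) (F : letters int -> R).
Hypotheses (rF : regular K F) (EF : mean P F = 0).

(** The cutoff [N] depends on [K] and [e] only and is fixed before [d]: lags beyond [N] contribute
    at most [e/2], and [d (1 + 2N) = e/2] handles the others. *)
Lemma mean_psum_sqr_small (e : R) : 0 < e -> exists2 d : R, 0 < d &
  forall G, regular (2 * K) G -> mean P G = 0 -> mean P (fun w => G w ^+ 2) <= d ->
  forall n, mean P (fun w => psum n G w ^+ 2) <= n%:R * e.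
Proof.
move=> e0; pose C := (2 * K) ^+ 2 * conv_const alpha.
have C0 : 0 <= C by rewrite mulr_ge0 ?sqr_ge0 ?conv_const_ge0.
have t0 : 0 < e / (4 * (C + 1)) by rewrite divr_gt0//; lra.
have [N tail] := weight_tail t0.
have N0 : 0 <= N%:R :> R by [].
exists (e / (2 * (1 + 2 * N%:R))); first by rewrite divr_gt0//; lra.
move=> G rG EG Gd n.
apply: le_trans (mean_psum_sqr_le rG EG Gd tail n) _.
rewrite ler_wpM2l// -/C.
have -> : e / (2 * (1 + 2 * N%:R)) + 2 * (N%:R * (e / (2 * (1 + 2 * N%:R))) + C * (e / (4 * (C + 1)))) =
    e / 2 + e / 2 * (C / (C + 1)) by field; apply/andP; split; rewrite gt_eqF//; lra.
have : C / (C + 1) <= 1 by rewrite ler_pdivrMr; lra.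
have e2 : 0 <= e / 2 by lra.
by move=> /(ler_wpM2l e2); lra.
Qed.

Lemma centred_approximants (e : R) : 0 < e -> exists H : letters int -> R,
  [/\ bdd H, exists k, depends (window k) H, mean P H = 0 &
      forall n, mean P (fun w => psum n (fun w => F w - H w) w ^+ 2) <= n%:R * e].
Proof.
move=> e0; have [d d0 hd] := mean_psum_sqr_small e0.
have [K0 iF [Fm [bF dF hF cF]]] := rF.
have lFm m := L2_bdd P (bF m).
(* One half is for the L^2 distance to the approximant, the other for subtracting its mean. *)
have sd0 : 0 < Num.sqrt d / 2 by rewrite divr_gt0 ?sqrtr_gt0.
have cE : (fun m => mean P (Fm m)) @ \oo --> 0.
  by rewrite -EF; exact: (cvg_mean_norm2 iF lFm cF).
move/cvgrPdist_lt : (cE) => /(_ _ sd0)[m1 _ h1].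
move/cvgrPdist_lt : (cF) => /(_ _ sd0)[m2 _ h2].
pose m := maxn m1 m2; pose H w := Fm m w - mean P (Fm m).
have bH : bdd H by apply: bddB => //; exact: bdd_cst.
have [k dk] := dF m.
have dH : depends (window k) H by move=> w w' ww'; rewrite /H (dk w w').
have EH : mean P H = 0.
  by rewrite meanB ?mean_cst ?subrr//; [exact: L1_bdd|exact: L1_cst].
have iH : influence H (fun i => K * zweight alpha i).
  move=> i; have := hF m i; congr (mean P2 _ <= _).
  by apply: funext => w; rewrite /resample /H; congr (_ ^+ 2); ring.
exists H; split=> //; first by exists k.
have rFH := regularB_approx rF bH dH iH.
move=> n; apply: hd => //.
  by rewrite meanB ?EF ?EH ?subrr//; [exact: L2_L1|exact: L1_bdd].
rewrite -(sqr_sqrtr (ltW d0)) -norm2_le ?sqrtr_ge0//.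
have a1 := h1 m (leq_maxl _ _); have a2 := h2 m (leq_maxr _ _).
rewrite /= sub0r normrN in a1; rewrite /= sub0r normrN ger0_norm ?norm2_ge0// in a2.
have iD : L2 P (fun w => Fm m w - F w) by exact: L2B.
have -> : norm2 P (fun w => F w - H w) = norm2 P (fun w => (Fm m w - F w) + (- mean P (Fm m))).
  rewrite /norm2; congr (Num.sqrt (mean P _)); apply: funext => w; rewrite /H; ring.
apply: le_trans (norm2_triangle iD (L2_cst P _)) _.
rewrite {2}/norm2 mean_cst sqrtr_sqr normrN; lra.
Qed.

Let norm2_psum_sub H n e : L2 P H -> 0 < e ->
  mean P (fun w => psum n (fun w => F w - H w) w ^+ 2) <= n%:R * e ^+ 2 ->
  mean P (fun w => `|psum n F w - psum n H w|) <= Num.sqrt n%:R * e.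
Proof.
have [_ iF _] := rF => iH e0 h.
rewrite (_ : (fun w => _) = fun w => `|psum n (fun w => F w - H w) w|); last first.
  by apply: funext => w; rewrite psumB.
apply: mean_abs_le; first by apply: L2_psum; exact: L2B.
  by rewrite mulr_ge0// ?sqrtr_ge0// ltW.
by rewrite exprMn sqr_sqrtr.
Qed.

Lemma mean_psum_sqr_linear : exists2 V : R, 0 <= V & forall n, mean P (fun w => psum n F w ^+ 2) <= n%:R * V.
Proof.
have [N tail] := weight_tail (ltr01 : 0 < 1 :> R).
eexists; last by move=> n; exact: (mean_psum_sqr_le rF EF (lexx _) tail n).
have F0 : 0 <= mean P (fun w => F w ^+ 2) by apply: mean_ge0 => w; exact: sqr_ge0.
have K20 : 0 <= K ^+ 2 * conv_const alpha by rewrite mulr_ge0 ?sqr_ge0 ?conv_const_ge0.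
by apply: addr_ge0 => //; apply: mulr_ge0 => //; apply: addr_ge0; rewrite ?mulr1//; exact: mulr_ge0.
Qed.

(** The deviations [s j] of the approximants are bounded, and a cluster value is enough: for a given
    tolerance a single [j] is used, with [s j] near it and error [e j] small. *)
Lemma clt_smooth : exists2 s : R, 0 <= s & forall h, is_smooth h ->
  (fun n => mean P (fun w => h (psum n F w / Num.sqrt n%:R))) @ \oo --> gauss_avg s h 0.
Proof.
have [_ iF _] := rF; have [V V0 hV] := mean_psum_sqr_linear.
pose e (j : nat) : R := j.+1%:R^-1.
have e_gt0 j : 0 < e j by rewrite invr_gt0.
have [H HP] := choice (fun j => centred_approximants (exprn_gt0 2 (e_gt0 j))).
have fin j : exists s : R, [/\ 0 <= s, s ^+ 2 <= (2 * V + 2) / gauss_var R & forall h, is_smooth h -> exists C : R, forall n, (0 < n)%N ->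
    `|mean P (fun w => h (psum n (H j) w / Num.sqrt n%:R)) - gauss_avg s h 0| <= C * (Num.sqrt n%:R)^-1].
  have [bH [k dH] EH hH] := HP j; have [mH [B HB]] := bH.
  exists (clt_sd (H j) k); split; first exact: sqrtr_ge0.
    have v0 := mean_gauss_sqr_gt0 R.
    rewrite sqr_sqrtr; last by rewrite divr_ge0 ?(ltW v0)//; exact: (long_run_var_ge0 mH HB dH EH).
    rewrite ler_wpM2r ?invr_ge0 ?(ltW v0)//.
    apply: (long_run_var_le mH HB dH EH) => n.
    have iH := L2_bdd P bH.
    have i1 := L2_psum n iF; have i2 := L2_psum n (L2B iF iH).
    have [_ i1'] := i1; have [_ i2'] := i2.
    (* From [y^2 <= 2 x^2 + 2 (x - y)^2]; with [e j <= 1] it gives the bound [2V + 2], uniform in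
       [j]. *)
    apply: (@le_trans _ _ (mean P (fun w => 2 * psum n F w ^+ 2 + 2 * psum n (fun w => F w - H j w) w ^+ 2))).
      apply: le_mean; [by case: (L2_psum n iH)|by apply: L1D; exact: L1Z|].
      move=> w; rewrite psumB; set x := psum n F w; set y := psum n (H j) w.
      by have := sqr_ge0 (2 * x - y); rewrite -subr_ge0; nra.
    rewrite meanD; [|exact: L1Z..]; rewrite !meanZ//.
    have := hV n; have := hH n.
    have : e j ^+ 2 <= 1.
      rewrite expr_le1//; last by rewrite ltW.
      by rewrite invf_le1 ?ltr0n// ler1n.
    have n0 : 0 <= n%:R :> R by [].
    move=> /(ler_wpM2l n0); lra.
  by move=> h [L [h1 [h2 sh]]]; exact: (clt_finite_range_rate mH HB dH EH sh).
have [s sP] := choice fin.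
have sM j : 0 <= s j <= (2 * V + 2) / gauss_var R + 1.
  have [s0 s2 _] := sP j; rewrite s0/=; set M := _ / _ in s2 *.
  by have := sqr_ge0 (s j - 1); nra.
have [t [/andP[t0 _] ct]] := cluster_in_segment sM.
exists t => // h sh; have [L [h1 [h2 shL]]] := sh; have L0 := smooth_ge0 shL.
apply/cvgrPdist_le => d d0.
have m1 := gauss_abs1_ge0 R.
pose d1 := d / (3 * (L + 1)); have d10 : 0 < d1 by rewrite divr_gt0// mulr_gt0//; lra.
pose d2 := d / (3 * (L * gauss_abs1 R + 1)).
have Lm0 : 0 < L * gauss_abs1 R + 1 by have := mulr_ge0 L0 m1; lra.
have d20 : 0 < d2 by rewrite divr_gt0// mulr_gt0.
have [j [Nj tj]] := ct d2 (Num.truncn d1^-1) d20.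
have ej : e j <= d1.
  rewrite /e -[leRHS]invrK lef_pV2 ?posrE ?invr_gt0 ?ltr0n//.
  by apply/ltW; apply: lt_le_trans (truncnS_gt _) _; rewrite ler_nat; exact: Nj.
have [_ _ /(_ _ sh)[C hC]] := sP j.
have [bH _ _ hH] := HP j.
pose C' := `|C| + 1; have C'0 : 0 < C' by rewrite /C'; have := normr_ge0 C; lra.
near=> n.
have n0 : (0 < n)%N by near: n; exists 1%N.
have sn0 : 0 < Num.sqrt n%:R :> R by rewrite sqrtr_gt0 ltr0n.
have Cn : C * (Num.sqrt n%:R)^-1 <= d / 3.
  rewrite ler_pdivrMr//; apply: (@le_trans _ _ C'); first by have := ler_norm C; rewrite /C'; lra.
  have d3 : 0 < d / 3 by lra.
  rewrite mulrC -ler_pdivrMr//.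
  have q0 : 0 <= C' / (d / 3) by rewrite divr_ge0 ?ltW.
  rewrite -(ger0_norm q0) -sqrtr_sqr ler_wsqrtr//.
  by near: n; exact: nbhs_infty_ger.
have i1 := L2_psum n iF; have i2 := L2_psum n (L2_bdd P bH).
have ch : continuous h := lip_continuous (smooth_lip0 shL).
have mh : measurable_fun setT h by exact: continuous_measurable_fun.
have i3 (G : letters int -> R) : L2 P G -> L1 P (fun w => h (G w / Num.sqrt n%:R)).
  move=> [mG _]; apply: L1_bdd; split; last by exists L => w; exact: smooth_bound0 shL _.
  by apply: measurableT_comp => //; exact: measurable_funM.
have T1 : `|mean P (fun w => h (psum n F w / Num.sqrt n%:R)) -
    mean P (fun w => h (psum n (H j) w / Num.sqrt n%:R))| <= L * e j.
  rewrite -meanB; [|exact: i3..].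
  have iD : L1 P (fun w => `|psum n F w - psum n (H j) w|).
    by apply: L1_norm; apply: L2_L1; exact: L2B.
  apply: (@le_trans _ _ (mean P (fun w => L / Num.sqrt n%:R * `|psum n F w - psum n (H j) w|))).
    apply: norm_mean_le; [by apply: L1B; exact: i3|exact: L1Z|move=> w].
    have := smooth_lip0 shL (psum n (H j) w / Num.sqrt n%:R) ((psum n F w - psum n (H j) w) / Num.sqrt n%:R).
    rewrite -mulrDl subrKC normrM (@ger0_norm _ (Num.sqrt n%:R)^-1) ?invr_ge0 ?sqrtr_ge0//.
    by rewrite [L * _]mulrA mulrAC.
  rewrite meanZ// -mulrA ler_wpM2l// ler_pdivrMl//.
  exact: (norm2_psum_sub (L2_bdd P bH) (e_gt0 j) (hH n)).
have T2 := hC n n0.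
have T3 : `|gauss_avg (s j) h 0 - gauss_avg t h 0| <= d / 3.
  apply: le_trans (gauss_avg_lip (s j) t 0 shL) _.
  apply: (@le_trans _ _ (L * (d2 * gauss_abs1 R))).
    by rewrite ler_wpM2l// ler_wpM2r// ltW.
  rewrite /d2 (_ : L * _ = d / 3 * (L * gauss_abs1 R / (L * gauss_abs1 R + 1))); last first.
    by field; rewrite gt_eqF.
  rewrite ler_piMr//; first lra.
  by rewrite ler_pdivrMr//; lra.
have T4 : L * e j <= d / 3.
  apply: le_trans (ler_wpM2l L0 ej) _; rewrite /d1.
  rewrite (_ : L * _ = d / 3 * (L / (L + 1))); last by field; rewrite gt_eqF//; lra.
  rewrite ler_piMr//; first lra.
  by rewrite ler_pdivrMr; lra.
rewrite distrC.
move: T1 T2 T3 T4 Cn; move: (mean P _) (mean P _) (gauss_avg _ _ _) (gauss_avg _ _ _) (L * e j) (C * _) => a b c f g k T1 T2 T3 T4 Cn.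
move: T1 T2 T3; rewrite !ler_norml => /andP[? ?] /andP[? ?] /andP[? ?].
by apply/andP; split; lra.
Unshelve. all: by end_near. Qed.

(** The normalised sums have bounded second moments, hence are tight: [h] may be replaced by a
    smooth [g] close to it on a large segment only. *)
Theorem clt_regular : exists2 s : R, 0 <= s & forall h, continuous h ->
  (exists M, forall x, `|h x| <= M) ->
  (fun n => mean P (fun w => h (psum n F w / Num.sqrt n%:R))) @ \oo --> gauss_expect s h.
Proof.
have [s s0 hs] := clt_smooth; exists s => // h ch [M hM].
rewrite gauss_expectE//; last by exists M.
have [_ iF _] := rF; have [V V0 hV] := mean_psum_sqr_linear.
have M0 : 0 <= M by exact: le_trans (hM 0).
have v0 := mean_gauss_sqr_gt0 R; rewrite -/(gauss_var R) in v0.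
apply/cvgrPdist_le => d d0.
have d4 : 0 < d / 8 by lra.
pose W := V + s ^+ 2 * gauss_var R.
have W0 : 0 <= W by rewrite addr_ge0// mulr_ge0 ?sqr_ge0// ltW.
(* [W] bounds the second moments of both the sums and the limit, and this [K2] makes
   [2MW / K2 <= d/8]. *)
pose K2 := 2 * M * W / (d / 8) + 1.
have K20 : 0 < K2 by rewrite ltr_wpDl// divr_ge0 ?mulr_ge0// ltW.
pose K1 := Num.sqrt K2; have K10 : 0 < K1 by rewrite sqrtr_gt0.
have [g [sg gM gh]] := smooth_approx ch hM K10 d4.
have cg : continuous g by case: sg => L [g1 [g2 sg]]; exact: lip_continuous (smooth_lip0 sg).
(* Chebyshev in pointwise form: outside the segment the difference is at most [2M] and
   [x^2 >= K2]. *)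
have pt x : `|h x - g x| <= d / 8 + 2 * M / K2 * x ^+ 2.
  have [xK|Kx] := leP `|x| K1.
    apply: le_trans (gh _ xK) _; rewrite lerDl mulr_ge0 ?sqr_ge0//.
    by rewrite divr_ge0 ?mulr_ge0// ltW.
  have K2x : K2 <= x ^+ 2.
    by rewrite -(sqr_sqrtr (ltW K20)) -(real_normK (num_real x)) lerXn2r ?nnegrE ?sqrtr_ge0// ltW.
  apply: le_trans (ler_normB _ _) _; apply: (@le_trans _ _ (2 * M)).
    by have := hM x; have := gM x; lra.
  rewrite -[leLHS]add0r lerD ?(ltW d4)//.
  by rewrite -mulrA ler_peMr ?mulr_ge0// mulrC ler_pdivlMr// mul1r.
have KW : 2 * M / K2 * W <= d / 8.
  rewrite mulrAC ler_pdivrMr// [leRHS]mulrC -ler_pdivrMr//.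
  by rewrite /K2 lerDl.
have VW : 2 * M / K2 * V <= d / 8.
  apply: le_trans KW; rewrite ler_wpM2l ?divr_ge0 ?mulr_ge0 ?(ltW K20)//.
  by rewrite lerDl mulr_ge0 ?sqr_ge0// ltW.
have GW : 2 * M / K2 * (s ^+ 2 * gauss_var R) <= d / 8.
  apply: le_trans KW; rewrite ler_wpM2l ?divr_ge0 ?mulr_ge0 ?(ltW K20)//.
  by rewrite lerDr.
have cmp d' (T : measurableType d') (Q : probability T R) (Y : T -> R) (U : R) : L2 Q Y ->
    mean Q (fun w => Y w ^+ 2) <= U -> 2 * M / K2 * U <= d / 8 ->
    `|mean Q (fun w => h (Y w)) - mean Q (fun w => g (Y w))| <= d / 4.
  move=> iY YU UW; have [mY iY2] := iY.
  have ib f : continuous f -> (forall x, `|f x| <= M) -> L1 Q (fun w => f (Y w)).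
    move=> cf fM; apply: L1_bdd; split; last by exists M.
    by apply: measurableT_comp => //; exact: continuous_measurable_fun.
  have ih := ib h ch hM; have ig := ib g cg gM.
  rewrite -meanB//.
  apply: (@le_trans _ _ (mean Q (fun w => d / 8 + 2 * M / K2 * Y w ^+ 2))).
    apply: norm_mean_le; [exact: L1B|by apply: L1D; [exact: L1_cst|exact: L1Z]|by move=> w].
  rewrite meanD; [|exact: L1_cst|exact: L1Z]; rewrite mean_cst meanZ//.
  have kk : 0 <= 2 * M / K2 by rewrite divr_ge0 ?mulr_ge0// ltW.
  by have := ler_wpM2l kk YU; lra.
have G1 : `|gauss_avg s h 0 - gauss_avg s g 0| <= d / 4.
  apply: (cmp _ _ (gauss R) (fun z => 0 + s * z) _ _ _ GW).
    split; first by apply: measurable_funD => //; exact: measurable_funM.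
    rewrite (_ : (fun z => _) = fun z => s ^+ 2 * z ^+ 2); first exact/L1Z/L1_gauss_sqr.
    by apply: funext => z; rewrite add0r exprMn.
  rewrite (_ : (fun z => _) = fun z => s ^+ 2 * z ^+ 2); first by rewrite meanZ//; exact: L1_gauss_sqr.
  by apply: funext => z; rewrite add0r exprMn.
have d2 : 0 < d / 2 by lra.
move/cvgrPdist_lt : (hs g sg) => /(_ _ d2)[N _ hN].
exists (N + 1)%N => // n /= Nn1.
have Nn := leq_trans (leq_addr 1 N) Nn1; have n0 := leq_trans (leq_addl N 1) Nn1.
have G2 := hN n Nn; rewrite /= in G2.
have sn0 : 0 < Num.sqrt n%:R :> R by rewrite sqrtr_gt0 ltr0n.
have i1 := L2_psum n iF; have [mS iS2] := i1.
have G3 : `|mean P (fun w => h (psum n F w / Num.sqrt n%:R)) - mean P (fun w => g (psum n F w / Num.sqrt n%:R))| <= d / 4.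
  have E w : (psum n F w / Num.sqrt n%:R) ^+ 2 = n%:R^-1 * psum n F w ^+ 2.
    by rewrite exprMn exprVn sqr_sqrtr// mulrC.
  apply: (cmp _ _ P (fun w => psum n F w / Num.sqrt n%:R) V _ _ VW).
    split; first exact: measurable_funM.
    by rewrite (_ : (fun w => _) = fun w => n%:R^-1 * psum n F w ^+ 2); [exact: L1Z|apply: funext].
  rewrite (_ : (fun w => _) = fun w => n%:R^-1 * psum n F w ^+ 2); last exact: funext.
  by rewrite meanZ// ler_pdivrMl ?ltr0n.
move: G1 G2 G3; move: (mean P _) (mean P _) (gauss_avg _ _ _) (gauss_avg _ _ _) => a b c f.
move=> /[!ler_norml] /andP[? ?] G2 /andP[? ?].
move: G2; rewrite ltr_norml => /andP[? ?].
by apply/andP; split; lra.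
Qed.

End RegularCLT.

End BernoulliShift.

(** * Exponential moments of a letter, and Jensen's inequality *)

Section LetterMoments.
Variables (R : realType) (P : probability (letters int) R).
Hypothesis iP : iid P.

(** Summed over the values of the letter, this is [1/2] times the geometric series of ratio [3/4]; a
    base below 2 is what makes it converge. *)
Lemma mean_letter_geometric (i : int) :
  L1 P (fun w => (3 / 2) ^+ w i) /\ mean P (fun w => (3 / 2) ^+ w i) = 2.
Proof.
pose f (w : letters int) : R := (3 / 2) ^+ w i.
have mf : measurable_fun setT f.
  exact: (measurableT_comp (f := fun k : nat => (3 / 2) ^+ k : R)) (measurable_coord i).
have f0 w : 0 <= f w by rewrite exprn_ge0// divr_ge0.
pose A k : set (letters int) := cylinder [:: i] (fun=> k).
have mA k : measurable (A k) by exact: measurable_cylinder.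
have AP k w : A k w <-> w i = k.
  split=> [Aw|wk j]; first by apply: Aw; rewrite inE.
  by rewrite inE => /eqP ->.
have AU : \bigcup_k A k = setT by apply/seteqP; split=> // w _; exists (w i) => //; exact/AP.
have tA : trivIset setT A.
  apply/trivIsetP => k l _ _ kl; apply/seteqP; split=> // w [/AP wk /AP wl].
  by move: kl; rewrite -wk -wl eqxx.
have fA k : (\int[P]_(w in A k) (f w)%:E = (2^-1 * (3 / 4) ^+ k)%:E)%E.
  rewrite (eq_integral (fun=> ((3 / 2) ^+ k)%:E)); last by move=> w /set_mem/AP wk; rewrite /f wk.
  rewrite integral_cst// [X in (_ * X)%E](_ : _ = (\prod_(j <- [:: i]) geom k)%:E); last exact: iP.
  rewrite big_seq1 -EFinM /geom exprS; congr EFin.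
  rewrite invfM mulrCA -exprVn -exprMn; congr (_ * _ ^+ k); by field.
have e : (\int[P]_w (f w)%:E = 2%:E)%E.
  rewrite -AU ge0_integral_bigcup//; last 2 first.
  - by rewrite AU; exact/measurable_EFinP.
  - by move=> w _; rewrite lee_fin.
  apply/cvg_lim => //; under eq_fun do under eq_bigr do rewrite fA.
  have c := @cvg_geometric_series R 2^-1 (3 / 4).
  rewrite (_ : 2^-1 * (1 - 3 / 4)^-1 = 2) in c; last by field.
  apply: cvg_EFin; first by apply: nearW => n; rewrite sumEFin.
  apply: cvg_trans (c _); last by rewrite ger0_norm; lra.
  by apply: near_eq_cvg; apply: nearW => n; rewrite /series /= sumEFin.
have i1 : L1 P f.
  apply/integrableP; split; first exact/measurable_EFinP.
  under eq_integral => w _ do rewrite /= ger0_norm//.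
  by rewrite e ltry.
by split=> //; move: e; rewrite mean_EFin// => -[].
Qed.

(** Average the tangent line of the exponential at the barycentre [a]. *)
Lemma expR_jensen (I : Type) (s : seq I) (l x : I -> R) : (forall i, 0 <= l i) ->
  \sum_(i <- s) l i = 1 -> expR (\sum_(i <- s) l i * x i) <= \sum_(i <- s) l i * expR (x i).
Proof.
move=> l0 l1; set a := \sum_(i <- s) l i * x i.
rewrite (_ : expR a = \sum_(i <- s) l i * (expR a * (1 + (x i - a)))).
  apply: ler_sum => i _; rewrite ler_wpM2l//.
  have := expR_ge1Dx (x i - a); have := expR_gt0 a => a0 h.
  by rewrite -[x i in leRHS](subrKC a) expRD ler_wpM2l// ltW.
transitivity (expR a * (1 - a) * (\sum_(i <- s) l i) + expR a * a).
  by rewrite l1; ring.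
rewrite mulr_sumr {3}/a mulr_sumr -big_split /=.
by apply: eq_bigr => i _; ring.
Qed.

End LetterMoments.

(** * Strong mixing of the shift *)

Section Mixing.
Variables (R : realType) (P : probability (letters int) R).
Hypothesis iP : iid P.

Let ind (A : set (letters int)) : letters int -> R := \1_A.

Let indD (A B : set (letters int)) w : B `<=` A -> ind (A `\` B) w = ind A w - ind B w.
Proof.
move=> BA; rewrite /ind !indicE in_setD.
have [/set_mem/BA/mem_set ->|_] := boolP (w \in B); rewrite /= ?andbF ?andbT ?subrr// subr0.
by case: (_ \in _).
Qed.

(** Monotone classes can move only one of the two sets at a time. Taking [phi n = id] frees the
    first set against a shifted cylinder, and [phi n = shift n] then frees the other. *)
Lemma cvg_mean_pi_lambda (phi : nat -> letters int -> letters int) (H : nat -> letters int -> R) (c : R) :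
  (forall n, mpres P P (phi n)) -> (forall n, bdd (H n)) -> (forall n w, 0 <= H n w <= 1) ->
  (forall s k, (fun n => mean P (fun w => ind (cylinder s k) (phi n w) * H n w)) @ \oo -->
    c * mean P (ind (cylinder s k))) ->
  forall A, measurable A ->
    (fun n => mean P (fun w => ind A (phi n w) * H n w)) @ \oo --> c * mean P (ind A).
Proof.
move=> pphi bH H01 Hcyl.
have bi A : measurable A -> bdd (ind A) by exact: bdd_indic.
have bp n A : measurable A -> bdd (fun w => ind A (phi n w)).
  by move=> mA; exact: (bdd_comp (pphi n).1 (bi _ mA)).
have iH n A : measurable A -> L1 P (fun w => ind A (phi n w) * H n w).
  by move=> mA; apply: L1_bdd; apply: bddM => //; exact: bp.
have aD n A B : measurable A -> measurable B -> B `<=` A ->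
    mean P (fun w => ind (A `\` B) (phi n w) * H n w) =
    mean P (fun w => ind A (phi n w) * H n w) - mean P (fun w => ind B (phi n w) * H n w).
  move=> mA mB BA; rewrite -meanB; [|exact: iH..].
  by congr mean; apply: funext => w; rewrite indD// mulrBl.
have pD A B : measurable A -> measurable B -> B `<=` A ->
    mean P (ind (A `\` B)) = mean P (ind A) - mean P (ind B).
  move=> mA mB BA; rewrite -meanB; [|exact/L1_bdd/bi..].
  by congr mean; apply: funext => w; rewrite indD.
have a01 n A : measurable A -> 0 <= mean P (fun w => ind A (phi n w) * H n w) <= mean P (ind A).
  move=> mA; have ind0 w : 0 <= ind A w by rewrite /ind indicE ler0n.
  apply/andP; split.
    by apply: mean_ge0 => w; rewrite mulr_ge0//; have /andP[] := H01 n w.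
  rewrite [leRHS](mpres_mean (pphi n)); last by have [] := bi _ mA.
  apply: le_mean; [exact: iH|exact/L1_bdd/bp|move=> w].
  by rewrite -[leRHS]mulr1 ler_wpM2l//; have /andP[] := H01 n w.
pose K := [set A : set (letters int) | measurable A /\
  (fun n => mean P (fun w => ind A (phi n w) * H n w)) @ \oo --> c * mean P (ind A)].
suff : (@measurable _ (letters int) : set (set (letters int))) `<=` K by move=> h A /h[].
apply: (@lambda_system_subset _ (@cylinders int) _ setT) => //.
- exact: setI_closed_cylinders.
- split=> //.
  + split=> //; have -> : [set: letters int] = cylinder [::] (fun=> 0%N) by apply/seteqP; split.
    exact: Hcyl.
  + move=> A B BA [mA cA] [mB cB]; split; first exact: measurableD.
    rewrite pD// mulrBr; apply: (eq_cvgn (fun n => aD n A B mA mB BA)).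
    exact: cvgB.
  + move=> F'; pose F : nat -> set (letters int) := F'; rewrite -[F']/F => ndF KF.
    have mF i : measurable (F i) by case: (KF i).
    have mU : measurable (\bigcup_i F i) by exact: bigcupT_measurable.
    have FU i : F i `<=` \bigcup_i F i by exact: bigcup_sup.
    split=> //.
    have cp : (fun i => mean P (ind (F i))) @ \oo --> mean P (ind (\bigcup_i F i)).
      have h : (fun i => P (F i)) @ \oo --> P (\bigcup_i F i) := nondecreasing_cvg_mu mF mU ndF.
      rewrite (prob_mean P mU) in h.
      by apply: (eq_cvgn _ (fine_cvg h)) => i /=; rewrite prob_mean.
    apply/cvgrPdist_lt => d d0.
    pose q := 2 + `|c|.
    have q0 : 0 < q by rewrite ltr_wpDr.
    have dq : 0 < d / (2 * q) by rewrite divr_gt0// mulr_gt0.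
    move/cvgrPdist_lt : cp => /(_ _ dq)[N _ /(_ N (leqnn N))] hN.
    have [_ cN] := KF N; have d2 : 0 < d / 2 by rewrite divr_gt0.
    move/cvgrPdist_lt : cN => /(_ _ d2); apply: filterS => n hn.
    have mD : measurable (\bigcup_i F i `\` F N) by exact: measurableD.
    (* Invariance under [phi n] bounds the part in the difference by its measure, uniformly in [n];
       this is what allows exchanging the limit in [n] with the increasing union. *)
    have /andP[b0 b1] := a01 n _ mD.
    rewrite aD// pD// in b0 b1.
    move: hn hN b0 b1.
    set a := mean P (fun w => ind (F N) _ * _); set b := mean P (fun w => ind (\bigcup_i F i) _ * _).
    move: a b (mean P (ind (F N))) (mean P (ind (\bigcup_i F i))) => a b x y hn hN b0 b1.
    have -> : c * y - b = (c * x - a) + c * (y - x) - (b - a) by ring.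
    have xy : 0 <= y - x by exact: le_trans b1.
    rewrite ger0_norm// ltr_pdivlMr ?mulr_gt0// in hN.
    apply: le_lt_trans (ler_normB _ _) _; apply: le_lt_trans (lerD (ler_normD _ _) (lexx _)) _.
    rewrite normrM (ger0_norm xy) (ger0_norm b0).
    have : `|c| * (y - x) + (b - a) <= (y - x) * q.
      by rewrite /q [leRHS]mulrDr (mulrC `|c|) addrC lerD2r; apply: le_trans b1 _; rewrite ler_peMr// ler1n.
    rewrite mulrCA in hN; move: hn hN; rewrite -addrA; move: (_ + (b - a)) (`|c * x - a|) ((y - x) * q) => z u v.
    by lra.
- move=> _ [->|[s [k ->]]].
    split=> //; rewrite (_ : ind set0 = fun=> 0) ?mean_cst ?mulr0.
      apply: (@eq_cvgn _ _ (fun=> 0)); last exact: cvg_cst.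
      by move=> n; rewrite -[RHS](mean_cst P 0); congr mean; apply: funext => w; rewrite mul0r.
    by apply: funext => w; rewrite /ind indic0.
  by split; [exact: measurable_cylinder|exact: Hcyl].
Qed.

Lemma shift_mixing (A B : set (letters int)) : measurable A -> measurable B ->
  (fun n => P (A `&` shift n @^-1` B)) @ \oo --> (P A * P B)%E.
Proof.
move=> mA mB.
have bi C : measurable C -> bdd (ind C) by exact: bdd_indic.
have i01 C w : 0 <= ind C w <= 1 by rewrite /ind indicE ler0n lern1 leq_b1.
have ps := mpres_shift iP.
have mid : mpres P P id by split=> // C mC; rewrite preimage_id.
have mcyl s k : measurable (cylinder s k : set (letters int)) by exact: measurable_cylinder.
have cyl s k t l : (fun n => mean P (fun w => ind (cylinder s k) w * ind (cylinder t l) (shift n w))) @ \oo -->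
    mean P (ind (cylinder t l)) * mean P (ind (cylinder s k)).
  apply: cvg_near_cst; exists (\max_(j <- s) absz j + \max_(j <- t) absz j).+1%N => //= n nb.
  rewrite mulrC -(mean_shift iP n (H := ind (cylinder t l))); last by have [] := bi _ (mcyl t l).
  apply: (mean_indep (J := fun i => i \in s)) => //; [exact: bi|exact: (bdd_shift iP n (bi _ _))| |].
    move=> w w' ww'; rewrite /ind !indicE; congr (_%:R); congr nat_of_bool.
    by apply/idP/idP => /set_mem wk; apply/mem_set => i si; rewrite -wk// ww'.
  move=> w w' ww'; rewrite /ind !indicE; congr (_%:R); congr nat_of_bool.
  have nt i : i \in t -> i + n%:Z \notin s.
    move=> it; apply/negP => si.
    move: nb.
    have : (absz (i + n%:Z)%R <= \max_(j <- s) absz j)%N by apply: (@leq_bigmax_seq _ _ predT absz).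
    have : (absz i <= \max_(j <- t) absz j)%N by apply: (@leq_bigmax_seq _ _ predT absz).
    by move: (\max_(j <- s) _) (\max_(j <- t) _) => x y /=; clear; lia.
  by apply/idP/idP => /set_mem wk; apply/mem_set => i it; rewrite -wk//= /shift /= ww'//; exact: nt.
have step1 t l C : measurable C ->
    (fun n => mean P (fun w => ind C w * ind (cylinder t l) (shift n w))) @ \oo -->
    mean P (ind (cylinder t l)) * mean P (ind C).
  move=> mC; apply: (@cvg_mean_pi_lambda (fun=> id) (fun n w => ind (cylinder t l) (shift n w))) => //.
  by move=> n; exact: (bdd_shift iP n (bi _ _)).
have step2 : (fun n => mean P (fun w => ind B (shift n w) * ind A w)) @ \oo --> mean P (ind A) * mean P (ind B).
  apply: (@cvg_mean_pi_lambda shift (fun=> ind A)) => // [n|s k]; first exact: bi.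
  rewrite mulrC; apply: eq_cvgn (step1 s k A mA) => n.
  by congr mean; apply: funext => w; rewrite mulrC.
rewrite !prob_mean// -EFinM.
have mn n : measurable (A `&` shift n @^-1` B).
  by apply: measurableI => //; exact: measurable_preimage (ps n).1 mB.
apply: (@eq_cvgn _ _ (fun n => (mean P (fun w => ind B (shift n w) * ind A w))%:E)).
  move=> n; rewrite prob_mean//; congr (_%:E); congr mean; apply: funext => w.
  by rewrite /ind mulrC indicI.
by apply: cvg_EFin; [exact: nearW|exact: step2].
Qed.

End Mixing.

(** * The random series: convergence, measurability and domination *)

Section Coding.
Variables (R : realType) (alpha : R) (X : completeNormedModType R).
Variables (e : int -> nat -> X) (kappa : nat -> R).
Variable P : probability (letters int) R.
Hypotheses (alpha1 : 1 < alpha) (iP : iid P).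
(** In [kappa_exp], 16 is 8 times 2: the cost is exponentiated with factor 8 and all rows together
    weigh at most [2 zeta_bound]. *)
Hypotheses (kappa0 : forall k, 0 <= kappa k)
  (e_le : forall i k, `|e i k| <= zweight alpha i * kappa k)
  (kappa_exp : forall k, expR (16 * zeta_bound alpha * kappa k) <= (3 / 2) ^+ k).

Definition cost (m : nat) (w : letters int) : R := \sum_(i <- rows m) zweight alpha i * kappa (w i).

Definition vsum (m : nat) (w : letters int) : X := \sum_(i <- rows m) e i (w i).

Lemma costS m w : cost m.+1 w =
  cost m w + (weight alpha m * kappa (w (Posz m)) + weight alpha m * kappa (w (Negz m))).
Proof. by rewrite /cost !sum_rows big_nat_recr. Qed.

Lemma vsumS m w : vsum m.+1 w = vsum m w + (e (Posz m) (w (Posz m)) + e (Negz m) (w (Negz m))).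
Proof. by rewrite /vsum !sum_rows big_nat_recr. Qed.

Lemma cost_ge0 m w : 0 <= cost m w.
Proof. by apply: sumr_ge0 => i _; rewrite mulr_ge0// ltW// zweight_gt0. Qed.

Lemma cost_nd w : nondecreasing_seq (cost ^~ w).
Proof.
apply/nondecreasing_seqP => m; rewrite costS lerDl.
by rewrite addr_ge0// mulr_ge0// ltW// weight_gt0.
Qed.

Lemma norm_vsum_le m w : `|vsum m w| <= cost m w.
Proof. by apply: le_trans (ler_norm_sum _ _ _) _; apply: ler_sum => i _; exact: e_le. Qed.

Lemma cost_eq m w w' : (forall i, i \in rows m -> w i = w' i) -> cost m w = cost m w'.
Proof. by move=> ww'; apply: eq_big_seq => i /ww' ->. Qed.

Lemma vsum_eq m w w' : (forall i, i \in rows m -> w i = w' i) -> vsum m w = vsum m w'.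
Proof. by move=> ww'; apply: eq_big_seq => i /ww' ->. Qed.

Lemma measurable_cost m : measurable_fun setT (cost m).
Proof. by apply: (@measurable_finite_letters_fun _ (rows m)) => w w'; exact: cost_eq. Qed.

Lemma measurable_exp_cost m : measurable_fun setT (fun w => expR (8 * cost m w)).
Proof.
by apply: measurableT_comp => //; apply: measurable_funM => //; exact: measurable_cost.
Qed.

Lemma sum_zweight_rows m : \sum_(i <- rows m) zweight alpha i <= 2 * zeta_bound alpha.
Proof. by apply: sum_zweight_le => //; exact: uniq_rows. Qed.

(* Jensen for the probability weights zweight i / B reduces the exponential moment of
   the cost to that of a single letter. *)
Lemma L1_exp_cost m : L1 P (fun w => expR (8 * cost m w)) /\ mean P (fun w => expR (8 * cost m w)) <= 2.
Proof.
have := measurable_exp_cost m; case: m => [_|m mE].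
  rewrite (_ : (fun w => _) = fun=> 1); first by rewrite mean_cst; split; [exact: L1_cst|rewrite ler1n].
  by apply: funext => w; rewrite /cost big_nil mulr0 expR0.
pose B := \sum_(i <- rows m.+1) zweight alpha i.
have z0 i : 0 <= zweight alpha i by exact/ltW/zweight_gt0.
have B0 : 0 < B.
  rewrite /B sum_rows big_nat_recr//= ltr_wpDl//; last by rewrite addr_gt0// weight_gt0.
  by apply: sumr_ge0 => i _; rewrite addr_ge0// ltW// weight_gt0.
have B2 : B <= 2 * zeta_bound alpha := sum_zweight_rows m.+1.
pose g w := \sum_(i <- rows m.+1) (zweight alpha i / B) * (3 / 2) ^+ w i.
have pt w : expR (8 * cost m.+1 w) <= g w.
  have -> : 8 * cost m.+1 w = \sum_(i <- rows m.+1) (zweight alpha i / B) * (8 * B * kappa (w i)).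
    by rewrite /cost mulr_sumr; apply: eq_bigr => i _; field; rewrite gt_eqF.
  apply: le_trans (expR_jensen _ _ _) _.
  - by move=> i; rewrite divr_ge0// ltW.
  - by rewrite -mulr_suml divff// gt_eqF.
  apply: ler_sum => i _; apply: ler_wpM2l; first by rewrite divr_ge0// ltW.
  apply: le_trans (kappa_exp _); rewrite ler_expR ler_wpM2r//.
  by move: B2; lra.
have iz i : L1 P (fun w => (zweight alpha i / B) * (3 / 2) ^+ w i).
  by apply: L1Z; case: (mean_letter_geometric iP i).
have ig : L1 P g by exact: L1_sum.
have iE : L1 P (fun w => expR (8 * cost m.+1 w)).
  by apply: (L1_le mE ig) => w; rewrite ger0_norm ?expR_ge0.
split=> //; apply: le_trans (le_mean iE ig pt) _.
rewrite /g mean_sum//.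
rewrite (eq_bigr (fun i => zweight alpha i / B * 2)).
  by rewrite -!mulr_suml divff ?mul1r// gt_eqF.
move=> i _; have [i1 e1] := mean_letter_geometric iP i.
by rewrite meanZ// e1.
Qed.

(** By monotone convergence it inherits the moment bound 2, so it is almost surely finite; where it
    is finite the costs are bounded and the series of vectors converges absolutely. *)
Definition exp_cost_lim (w : letters int) : \bar R := limn (fun m => (expR (8 * cost m w))%:E).

Lemma exp_cost_nd w : nondecreasing_seq (fun m => (expR (8 * cost m w))%:E).
Proof. by move=> m n mn; rewrite lee_fin ler_expR ler_wpM2l//; exact: cost_nd. Qed.

Lemma exp_cost_le_lim m w : ((expR (8 * cost m w))%:E <= exp_cost_lim w)%E.
Proof.
rewrite /exp_cost_lim (cvg_lim _ (ereal_nondecreasing_cvgn (exp_cost_nd w)))//.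
by apply: ereal_sup_ubound; exists m.
Qed.

Lemma measurable_exp_cost_lim : measurable_fun setT exp_cost_lim.
Proof.
apply: (emeasurable_fun_cvg (fun m w => (expR (8 * cost m w))%:E)).
  by move=> m; apply/measurable_EFinP; exact: measurable_exp_cost.
by move=> w _; apply: ereal_nondecreasing_is_cvgn; exact: exp_cost_nd.
Qed.

Lemma exp_cost_lim_ge0 w : (0 <= exp_cost_lim w)%E.
Proof. by apply: le_trans (exp_cost_le_lim 0 w); rewrite lee_fin expR_ge0. Qed.

Lemma integrable_exp_cost_lim : P.-integrable setT exp_cost_lim.
Proof.
apply/integrableP; split; first exact: measurable_exp_cost_lim.
under eq_integral do rewrite gee0_abs ?exp_cost_lim_ge0//.
rewrite monotone_convergence//.
- apply: (@le_lt_trans _ _ 2%:E); last exact: ltry.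
  apply: lime_le.
    apply: ereal_nondecreasing_is_cvgn => m n mn; apply: ge0_le_integral => //.
    + by apply/measurable_EFinP; exact: measurable_exp_cost.
    + by apply/measurable_EFinP; exact: measurable_exp_cost.
    + by move=> w _; exact: exp_cost_nd.
  apply: nearW => m; have [i1 e1] := L1_exp_cost m.
  by rewrite mean_EFin// lee_fin.
- by move=> m; apply/measurable_EFinP; exact: measurable_exp_cost.
- by move=> w _; exact: exp_cost_nd.
Qed.

Definition good : set (letters int) := [set w | (exp_cost_lim w < +oo)%E].

Lemma measurable_good : measurable good.
Proof.
rewrite /good -[X in measurable X]setTI; apply: emeasurable_fun_infty_o => //.
exact: measurable_exp_cost_lim.
Qed.

Lemma full_good : full P good.
Proof.
split; first exact: measurable_good.
have [N [mN N0 NS]] := integrable_ae measurableT integrable_exp_cost_lim.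
apply: (subset_measure0 _ _ _ N0) => //; first exact: measurableC measurable_good.
move=> w ngw; apply: NS => /= H; apply: ngw; rewrite /good /=.
by rewrite -ge0_fin_numE ?exp_cost_lim_ge0//; exact: H.
Qed.

(** On [good], one integrable function dominating all [expR (8 * cost m w)] at once; it serves in
    every dominated convergence below. *)
Definition dom (w : letters int) : R := fine (exp_cost_lim w).

Lemma dom_ge0 w : 0 <= dom w. Proof. exact/fine_ge0/exp_cost_lim_ge0. Qed.

Lemma L1_dom : L1 P dom.
Proof.
have md : measurable_fun setT dom.
  by apply: (measurableT_comp (f := fine)) => //; exact: measurable_exp_cost_lim.
apply: (le_integrable _ _ _ integrable_exp_cost_lim) => //; first exact/measurable_EFinP.
move=> w _; rewrite /= ger0_norm ?dom_ge0// gee0_abs ?exp_cost_lim_ge0//.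
have := exp_cost_lim_ge0 w; rewrite /dom; by case: (exp_cost_lim w) => [r| |] //= _; rewrite ?lexx ?leey.
Qed.

Lemma exp_cost_le_dom m w : good w -> expR (8 * cost m w) <= dom w.
Proof.
move=> gw; rewrite -lee_fin /dom fineK; first exact: exp_cost_le_lim.
by rewrite ge0_fin_numE// exp_cost_lim_ge0.
Qed.

Lemma cost_le_dom m w : good w -> cost m w <= dom w.
Proof.
move=> gw; apply: le_trans (exp_cost_le_dom m gw).
by have := expR_ge1Dx (8 * cost m w); have := cost_ge0 m w; lra.
Qed.

Lemma is_cvg_cost w : good w -> cvgn (cost ^~ w).
Proof.
move=> gw; apply: nondecreasing_is_cvgn; first exact: cost_nd.
by exists (dom w) => _ [m _ <-]; exact: cost_le_dom.
Qed.

Lemma cost_term_cvg0 w : good w ->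
  (fun m => weight alpha m * kappa (w (Posz m)) + weight alpha m * kappa (w (Negz m))) @ \oo --> (0 : R).
Proof.
move=> gw; have c := is_cvg_cost gw.
have c1 : [sequence cost m.+1 w]_m @ \oo --> limn (cost ^~ w).
  by rewrite (cvg_shiftS (cost ^~ w)); exact: c.
have c2 := cvgB c1 c; rewrite subrr in c2.
rewrite (_ : (fun m => _) = fun m => cost m.+1 w - cost m w); first exact: c2.
by apply: funext => m; rewrite costS [RHS]addrC addKr.
Qed.

Lemma is_cvg_vsum w : good w -> cvgn (vsum ^~ w).
Proof.
move=> gw; pose u m := e (Posz m) (w (Posz m)) + e (Negz m) (w (Negz m)).
pose v m := weight alpha m * kappa (w (Posz m)) + weight alpha m * kappa (w (Negz m)).
have -> : vsum ^~ w = series u by apply: funext => m; rewrite /vsum sum_rows.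
apply: normed_cvg.
apply: (@series_le_cvg _ _ v).
- by move=> m; exact: normr_ge0.
- by move=> m; rewrite addr_ge0// mulr_ge0// ltW// weight_gt0.
- by move=> m; apply: le_trans (ler_normD _ _) _; apply: lerD; exact: e_le.
- by have := is_cvg_cost gw; rewrite (_ : cost ^~ w = series v)//; apply: funext => m; rewrite /cost sum_rows.
Qed.

Definition code (w : letters int) : X := if w \in good then limn (vsum ^~ w) else 0.

Lemma code_cvg w : good w -> vsum ^~ w @ \oo --> code w.
Proof. by move=> gw; rewrite /code mem_set//; exact: is_cvg_vsum. Qed.

(** The limit lies in an open [U] exactly when, for some [k], the partial sums eventually stay where
    the ball of radius [1/(k+1)] is inside [U]. This is a countable combination of events on
    finitely many letters. *)
Lemma measurable_code : measurable_fun setT (code : letters int -> borelX X).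
Proof.
apply: (@measurability _ _ _ (borelX X) setT code (@open X)) => // _ [U oU <-]; rewrite setTI.
pose V k : set X := [set x | ball x k.+1%:R^-1 `<=` U].
have VE w : good w -> (U (code w) <-> exists k N, forall m, (N <= m)%N -> V k (vsum m w)).
  move=> gw; have c := code_cvg gw; split.
    move=> Uc; have /nbhs_ballP[d /= d0 dU] : nbhs (code w) U by exact: open_nbhs_nbhs.
    have d2 : 0 < d / 2 by rewrite divr_gt0.
    have [k _ /(_ k (leqnn k)) /= kd] := near_infty_natSinv_lt (PosNum d2).
    have k0 : 0 < k.+1%:R^-1 :> R by rewrite invr_gt0.
    have /cvgrPdist_lt/(_ _ k0)[N _ hN] := c.
    exists k, N => m Nm y; rewrite -ball_normE /ball_/= => ym; apply: dU; rewrite -ball_normE /ball_/=.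
    have h := hN m Nm; apply: le_lt_trans (ler_distD (vsum m w) _ _) _.
    apply: lt_trans (ltrD h ym) _; rewrite /= in kd.
    by rewrite (splitr d) ltrD.
  move=> [k [N VN]]; have k0 : 0 < k.+1%:R^-1 :> R by rewrite invr_gt0.
  have /cvgrPdist_lt/(_ _ k0)[N' _ hN'] := c.
  apply: (VN (N + N')%N (leq_addr _ _)); rewrite -ball_normE /ball_/= distrC.
  exact: (hN' _ (leq_addl _ _)).
rewrite [X in measurable X](_ : _ = (good `&` \bigcup_k \bigcup_N \bigcap_(m in [set m | (N <= m)%N]) [set w | V k (vsum m w)])
   `|` (~` good `&` [set w | U 0])).
  apply: measurableU.
    apply: measurableI; first exact: measurable_good.
    apply: bigcupT_measurable => k; apply: bigcupT_measurable => N; apply: bigcap_measurable.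
      by exists N => /=.
    move=> m _; apply: (@measurable_finite_letters _ (rows m)) => w w' ww' /=.
    by rewrite (vsum_eq ww').
  apply: measurableI; first exact: measurableC measurable_good.
  have [U0|U0] := pselect (U 0).
    by rewrite (_ : [set w | _] = setT)//; apply/seteqP; split.
  by rewrite (_ : [set w | _] = set0)//; apply/seteqP; split.
apply/seteqP; split=> w /=.
  move=> Uw; have [gw|ngw] := pselect (good w).
    left; split=> //; have [k [N VN]] := (VE w gw).1 Uw.
    by exists k => //; exists N => //.
  by right; split=> //; move: Uw; rewrite /code memNset.
case=> [[gw [k _ [N _ VN]]]|[ngw U0]].
  by apply/(VE w gw); exists k, N => m Nm; exact: VN.
by rewrite /code memNset.
Qed.

Lemma norm_code_dom w : good w -> expR (8 * `|code w|) <= dom w.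
Proof.
move=> gw; have c : (fun m => `|vsum m w|) @ \oo --> `|code w| by apply: cvg_norm; exact: code_cvg.
rewrite -ler_ln ?posrE ?expR_gt0//; last by apply: lt_le_trans (exp_cost_le_dom 0 gw); exact: expR_gt0.
rewrite expRK; rewrite -ler_pdivlMl// -(cvg_lim _ c)//.
apply: limr_le; first by apply/cvg_ex; eexists; exact: c.
apply: nearW => m; apply: le_trans (norm_vsum_le m w) _.
rewrite ler_pdivlMl// -ler_expR lnK ?exp_cost_le_dom// posrE.
by apply: lt_le_trans (exp_cost_le_dom 0 gw); exact: expR_gt0.
Qed.

Variable P2 : probability (letters (bool * int)%type) R.
Hypothesis iP2 : iid P2.

(** * Observables with exponential growth are regular *)

Section RegularObservables.
Variables (f : X -> R) (M : R).
Hypotheses (M0 : 0 <= M) (f_le : forall x, `|f x| <= M * expR `|x|)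
  (f_lip : forall r x y, `|x| <= r -> `|y| <= r -> `|f x - f y| <= M * expR r * `|x - y|).

(** Truncating the series makes it local and clamping makes it bounded; as [clamp] is 1-Lipschitz,
    increments of [f] are not enlarged. *)
Let fm (m : nat) (w : letters int) : R := clamp m%:R (f (vsum m w)).

Let bdd_fm m : bdd (fm m).
Proof.
split; last by exists m%:R => w; exact: norm_clamp_le.
by apply: (@measurable_finite_letters_fun _ (rows m)) => w w' ww'; rewrite /fm (vsum_eq ww').
Qed.

Let depends_fm m : depends (window m) (fm m).
Proof.
move=> w w' ww'; rewrite /fm (@vsum_eq _ w w')// => i.
by rewrite mem_rows; exact: ww'.
Qed.

Lemma vsum_resample_le m i w :
  `|vsum m (mix predT w) - vsum m (mix (predC1 i) w)| <=
  zweight alpha i * (kappa (mix predT w i) + kappa (mix (predC1 i) w i)).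
Proof.
set u := mix predT w; set v := mix _ w.
have uv j : j != i -> u j = v j by move=> ji; rewrite /u /v /mix /= ji.
have h0 : 0 <= zweight alpha i * (kappa (u i) + kappa (v i)).
  by rewrite mulr_ge0 ?addr_ge0// ltW// zweight_gt0.
rewrite /vsum -sumrB; have [ir|ir] := boolP (i \in rows m); last first.
  rewrite big_seq big1 ?normr0// => j jr; rewrite uv ?subrr//.
  by apply: contraNneq ir => <-.
rewrite (bigD1_seq i)//=; last exact: uniq_rows.
rewrite big1 => [|j ji]; last by rewrite uv// subrr.
rewrite addr0 mulrDr; apply: le_trans (ler_normB _ _) _.
by apply: lerD; exact: e_le.
Qed.

Lemma kappa_pow4_le k : kappa k ^+ 4 <= 24 * (3 / 2) ^+ k.
Proof.
have h := expR_ge1Dxn 3 (kappa0 k).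
have h2 : expR (kappa k) <= (3 / 2) ^+ k.
  apply: le_trans (kappa_exp k); rewrite ler_expR -[leLHS]mul1r ler_wpM2r//.
  by have := zeta_bound_ge1 alpha1; lra.
by rewrite (_ : 4`!%:R = 24) in h; [lra|].
Qed.

(** Both points lie in the ball of radius [cu + cv], where [f_lip] applies, and they differ by one
    letter, at distance at most [zweight i] times the two sizes [kappa]. *)
Let influence_fm m : influence P2 (fm m) (fun i => 20 * (M + 1) * zweight alpha i).
Proof.
move=> i; pose b := zweight alpha i.
have b0 : 0 <= b by exact/ltW/zweight_gt0.
pose g0 (w : letters int) := expR (8 * cost m w).
pose g1 (w : letters int) : R := (3 / 2) ^+ w i.
have [ig0 eg0] := L1_exp_cost m.
have [ig1 eg1] := mean_letter_geometric iP i.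
have mg0 : measurable_fun setT g0 := L1_measurable ig0.
have mg1 : measurable_fun setT g1 := L1_measurable ig1.
(* AM-GM gives half of [e^(4 cu) e^(4 cv) + kk^4]. The first term is at most half of
   [e^(8 cu) + e^(8 cv)], whence 1/4; the second at most [8 * 24] times the sum of the two [g1],
   whence 96. *)
pose g w := M ^+ 2 * b ^+ 2 * (4^-1 * g0 w + 96 * g1 w).
have ig : L1 P g by apply: L1Z; apply: L1D; exact: L1Z.
have mg := L1_measurable ig.
have eg : mean P g <= M ^+ 2 * b ^+ 2 * 193.
  rewrite meanZ; last by apply: L1D; exact: L1Z.
  rewrite ler_wpM2l ?mulr_ge0 ?sqr_ge0// meanD; [|exact: L1Z..].
  by rewrite !meanZ// eg1; move: eg0; rewrite -/g0; lra.
have igm A : L1 P2 (fun w => g (mix A w)) by apply/(mpres_L1 (mpres_mix iP iP2 A) mg).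
have pt w : resample i (fm m) w ^+ 2 <= g (mix predT w) + g (mix (predC1 i) w).
  set u := mix predT w; set v := mix (predC1 i) w.
  pose cu := cost m u; pose cv := cost m v.
  have cu0 : 0 <= cu by exact: cost_ge0. have cv0 : 0 <= cv by exact: cost_ge0.
  have ur : `|vsum m u| <= cu + cv by apply: le_trans (norm_vsum_le m u) _; rewrite lerDl.
  have vr : `|vsum m v| <= cu + cv by apply: le_trans (norm_vsum_le m v) _; rewrite lerDr.
  pose kk := kappa (u i) + kappa (v i); have kk0 : 0 <= kk by rewrite addr_ge0.
  have d1 : `|resample i (fm m) w| <= M * b * (expR (cu + cv) * kk).
    apply: le_trans (clamp_lip _ _ (ler0n _ m)) _; apply: le_trans (f_lip ur vr) _.
    have := vsum_resample_le m i w; rewrite -/u -/v -/b -/kk => h.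
    rewrite -mulrA -[leRHS]mulrA ler_wpM2l// mulrCA ler_wpM2l ?expR_ge0//.
  have d2 : resample i (fm m) w ^+ 2 <= (M * b) ^+ 2 * (expR (cu + cv) * kk) ^+ 2.
    rewrite -(real_normK (num_real (resample i (fm m) w))) -exprMn lerXn2r ?nnegrE//.
    by rewrite !mulr_ge0// expR_ge0.
  apply: le_trans d2 _; rewrite exprMn /g -mulrDr ler_wpM2l ?mulr_ge0 ?sqr_ge0//.
  have e0 : g0 u = expR (4 * cu) ^+ 2 by rewrite -expRM_natl /g0 -/cu; congr expR; ring.
  have e1 : g0 v = expR (4 * cv) ^+ 2 by rewrite -expRM_natl /g0 -/cv; congr expR; ring.
  have e2 : expR (cu + cv) ^+ 2 ^+ 2 = expR (4 * cu) * expR (4 * cv).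
    by rewrite -exprM -expRM_natl -expRD; congr expR; ring.
  have k0 := kappa_pow4_le (u i); have k1 := kappa_pow4_le (v i).
  rewrite -/(g1 u) in k0; rewrite -/(g1 v) in k1.
  rewrite e0 e1 exprMn.
  have kk4 := pow4_add_le (kappa (u i)) (kappa (v i)); rewrite -/kk in kk4.
  have amgm : (expR (cu + cv)) ^+ 2 * kk ^+ 2 <= 2^-1 * ((expR (cu + cv)) ^+ 2 ^+ 2 + kk ^+ 2 ^+ 2).
    by have := sqr_ge0 ((expR (cu + cv)) ^+ 2 - kk ^+ 2); move: (expR (cu + cv) ^+ 2) (kk ^+ 2) => x y; rewrite !expr2; lra.
  rewrite e2 in amgm; apply: le_trans amgm _.
  move: (expR (4 * cu)) (expR (4 * cv)) (kk ^+ 2 ^+ 2) (g1 u) (g1 v) kk4 k0 k1 => x y z a c.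
  move: (kappa (u i) ^+ 4) (kappa (v i) ^+ 4) => ku kv kk4 k0 k1.
  by have := sqr_ge0 (x - y); rewrite !expr2; lra.
have iR : L1 P2 (fun w => resample i (fm m) w ^+ 2).
  by apply: L1_bdd; apply: bddX; exact: (bdd_resample iP iP2 i (bdd_fm m)).
(* Each copy contributes at most 193, from [2/4 + 96 * 2], and twice 193 is below [20^2]. *)
apply: le_trans (le_mean iR (L1D (igm _) (igm _)) pt) _.
rewrite meanD; [|exact: igm..]; rewrite !(mean_mix iP iP2)//.
rewrite -/b !exprMn; have M2 : M ^+ 2 <= (M + 1) ^+ 2 by rewrite lerXn2r ?nnegrE ?addr_ge0// lerDl.
have b2 : 0 <= b ^+ 2 by exact: sqr_ge0.
have h := ler_wpM2r b2 M2; have := mulr_ge0 (sqr_ge0 M) b2.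
by move: eg; move: (mean P g) => x; nra.
Qed.

Let sqr_f_le x (c : R) : expR (8 * `|x|) <= c -> f x ^+ 2 <= M ^+ 2 * c.
Proof.
move=> xc; rewrite -(real_normK (num_real (f x))).
apply: (@le_trans _ _ ((M * expR `|x|) ^+ 2)).
  by rewrite lerXn2r ?nnegrE// mulr_ge0// expR_ge0.
rewrite exprMn ler_wpM2l ?sqr_ge0//; apply: le_trans xc.
by rewrite -expRM_natl ler_expR; have := normr_ge0 x; lra.
Qed.

Lemma measurable_observable : measurable_fun setT (fun w => f (code w)).
Proof.
have := continuous_measurable_borel (growth_continuous f_lip M0).
move=> mf; apply: (measurableT_comp mf).
exact: measurable_code.
Qed.

Lemma L2_observable : L2 P (fun w => f (code w)).
Proof.
have mf := measurable_observable; split=> //.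
have iD := L1Z (M ^+ 2) L1_dom.
have mf2 : measurable_fun setT (fun w => f (code w) ^+ 2) by exact: measurable_funX.
(* Applied to a constant sequence: what is extracted is integrability from almost sure
   domination. *)
apply: (proj1 (full_cvg_mean (H := fun=> fun w => f (code w) ^+ 2) full_good (fun=> mf2) mf2 iD _ _)) => [w gw|_ w gw].
  exact: cvg_cst.
rewrite ger0_norm ?sqr_ge0//; apply: sqr_f_le.
exact: (norm_code_dom gw).
Qed.

Theorem regular_observable : regular P P2 alpha (20 * (M + 1)) (fun w => f (code w)).
Proof.
split; [by rewrite mulr_gt0 // ltr_wpDl|exact: L2_observable|exists fm; split=> //].
  by move=> m; exists m.
have mf := measurable_observable.
have mfm m : measurable_fun setT (fm m) by case: (bdd_fm m).
have iD := L1Z (4 * M ^+ 2) L1_dom.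
have vdom m w : good w -> expR (8 * `|vsum m w|) <= dom w.
  move=> gw; apply: le_trans (exp_cost_le_dom m gw).
  by rewrite ler_expR ler_wpM2l//; exact: norm_vsum_le.
have fcvg w : good w -> (fun m => fm m w) @ \oo --> f (code w).
  move=> gw.
  have c1 : (fun m => f (vsum m w)) @ \oo --> f (code w).
    apply: continuous_cvg; first exact: (growth_continuous f_lip M0).
    exact: (code_cvg gw).
  apply: cvg_trans c1; apply: near_eq_cvg.
  near=> m; rewrite /fm clamp_id//.
  apply: (@le_trans _ _ (M * dom w)).
    apply: le_trans (f_le _) _; rewrite ler_wpM2l//; apply: le_trans (vdom m w gw).
    by rewrite ler_expR; have := normr_ge0 (vsum m w); lra.
  by near: m; exact: nbhs_infty_ger.
have iS : (fun m => mean P (fun w => (fm m w - f (code w)) ^+ 2)) @ \oo --> (0 : R).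
  have mS m : measurable_fun setT (fun w => (fm m w - f (code w)) ^+ 2).
    by apply: measurable_funX; exact: measurable_funB.
  have m0 : measurable_fun setT ((fun=> 0) : letters int -> R) by [].
  have [||_] := full_cvg_mean full_good mS m0 iD; [move=> w gw|move=> m w gw|by rewrite mean_cst].
    have c0 : (fun m => fm m w - f (code w)) @ \oo --> (0 : R).
      by rewrite -(subrr (f (code w))); apply: cvgB; [exact: fcvg|exact: cvg_cst].
    rewrite [X in X @ _](_ : _ = (fun m => fm m w - f (code w)) \* (fun m => fm m w - f (code w))).
      by rewrite -[X in _ --> X](mulr0 (0 : R)); exact: cvgM.
    by apply: funext => m; rewrite expr2.
  rewrite ger0_norm ?sqr_ge0//.
  have h1 := sqr_f_le (vdom m w gw).
  have h2 := sqr_f_le (norm_code_dom gw).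
  have h3 : fm m w ^+ 2 <= f (vsum m w) ^+ 2.
    rewrite -(real_normK (num_real (fm m w))) -(real_normK (num_real (f _))).
    by rewrite lerXn2r ?nnegrE//; exact: norm_clamp_le_norm.
  move: (fm m w) (f (code w)) (f (vsum m w)) (dom w) h1 h2 h3 => a b c d h1 h2 h3.
  by have := sqr_ge0 (a + b); rewrite !expr2 in h1 h2 h3 *; lra.
rewrite /norm2 -[X in _ --> X](@sqrtr0 R).
by apply: continuous_cvg => //; exact: sqrt_continuous.
Unshelve. all: by end_near. Qed.

End RegularObservables.

(** * Transport from the shift to [T] *)

Section CodedDynamics.
Variable T : {linear X -> X}.
Hypotheses (cT : continuous T) (eT : forall i k, T (e i k) = e (i - 1) k).

Let term m (w : letters int) : R :=
  weight alpha m * kappa (w (Posz m)) + weight alpha m * kappa (w (Negz m)).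

Let shiftP k w : shift 1 w (Posz k) = w (Posz k.+1). Proof. by rewrite /shift /=; congr w; lia. Qed.

Let shiftN k w : shift 1 w (Negz k.+1) = w (Negz k). Proof. by rewrite /shift /=; congr w; lia. Qed.

(** [T] lowers orbit indices by one, so both sums run over [e j (w (j+1))], with [j] in [[-m-2, m)]
    on one side and [[-m-1, m+1)] on the other; the added vectors are the two mismatched ends. *)
Lemma vsum_shift m w : T (vsum m.+1 w) + e (Posz m) (w (Posz m.+1)) =
  vsum m.+1 (shift 1 w) + e (Negz m.+1) (w (Negz m)).
Proof.
have eN k x : T (e (Negz k) x) = e (Negz k.+1) x by rewrite eT; congr e; lia.
have eP k x : T (e (Posz k.+1) x) = e (Posz k) x by rewrite eT; congr e; lia.
have s0 : shift 1 w (Negz 0) = w (Posz 0) by rewrite /shift /=; congr w; lia.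
have e0 x : T (e (Posz 0) x) = e (Negz 0) x by rewrite eT; congr e; lia.
elim: m => [|m ih].
  rewrite !vsumS /vsum !big_nil !add0r linearD/= eN e0 shiftP s0.
  by rewrite [LHS]addrC addrA.
rewrite vsumS (vsumS m.+1) !linearD/= eN eP shiftP shiftN addrA addrA ih -!addrA.
by congr (_ + _); rewrite [RHS]addrC addrA.
Qed.

(** The two ends in [vsum_shift] are dominated by general terms of the convergent cost series of
    [shift 1 w], hence tend to 0. *)
Lemma code_shift1 w : good w -> good (shift 1 w) -> T (code w) = code (shift 1 w).
Proof.
move=> gw gs.
have c1 : (fun m => T (vsum m.+1 w)) @ \oo --> T (code w).
  apply: continuous_cvg; first exact: cT.
  have := code_cvg gw; rewrite -(cvg_shiftS (vsum ^~ w)); exact.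
have c2 : (fun m => vsum m.+1 (shift 1 w)) @ \oo --> code (shift 1 w).
  have := code_cvg gs; rewrite -(cvg_shiftS (vsum ^~ _)); exact.
have c3 : (fun m => T (vsum m.+1 w) - vsum m.+1 (shift 1 w)) @ \oo --> T (code w) - code (shift 1 w).
  exact: cvgB.
have t0 := cost_term_cvg0 gs; rewrite -/(term _ _) in t0.
have t1 : (fun m => term m.+1 (shift 1 w)) @ \oo --> (0 : R).
  by move: t0; rewrite -(cvg_shiftS (fun m => term m (shift 1 w))); exact.
have c4 : (fun m => T (vsum m.+1 w) - vsum m.+1 (shift 1 w)) @ \oo --> (0 : X).
  apply/cvgrPdist_lt => d d0; have d2 : 0 < d / 2 by rewrite divr_gt0.
  move/cvgrPdist_lt : t0 => /(_ _ d2) t0; move/cvgrPdist_lt : t1 => /(_ _ d2) t1.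
  near=> m; rewrite sub0r normrN.
  rewrite (_ : _ - _ = e (Negz m.+1) (w (Negz m)) - e (Posz m) (w (Posz m.+1))); last first.
    by apply/eqP; rewrite subr_eq addrAC eq_sym subr_eq vsum_shift addrC.
  apply: le_lt_trans (ler_normB _ _) _; rewrite [ltRHS]splitr; apply: ltrD.
    apply: (@le_lt_trans _ _ (term m.+1 (shift 1 w))).
      by apply: le_trans (e_le _ _) _; rewrite /term shiftN lerDr mulr_ge0// ltW// weight_gt0.
    by apply: le_lt_trans (ler_norm _) _; rewrite -normrN -sub0r; near: m.
  apply: (@le_lt_trans _ _ (term m (shift 1 w))).
    by apply: le_trans (e_le _ _) _; rewrite /term shiftP lerDl mulr_ge0// ltW// weight_gt0.
  by apply: le_lt_trans (ler_norm _) _; rewrite -normrN -sub0r; near: m.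
by apply/eqP; rewrite -subr_eq0; apply/eqP; rewrite -(cvg_lim (@norm_hausdorff _ _) c3); exact: (cvg_lim (@norm_hausdorff _ _) c4).
Unshelve. all: by end_near. Qed.

Definition orbit_good : set (letters int) := \bigcap_k shift k @^-1` good.

Lemma full_orbit_good : full P orbit_good.
Proof.
have mg k : measurable (shift k @^-1` good).
  exact: measurable_preimage (mpres_shift iP k).1 full_good.1.
split; first exact: bigcapT_measurable.
rewrite setC_bigcap; apply: measure_negligible; first by apply: bigcupT_measurable => k; exact: measurableC.
apply: negligible_bigcup => k; exists (~` (shift k @^-1` good)); split=> //; first exact: measurableC.
by rewrite preimage_setC; exact: (etrans (esym ((mpres_shift iP k).2 _ (measurableC full_good.1))) full_good.2).
Qed.

Lemma iter_code n w : orbit_good w -> iter n T (code w) = code (shift n w).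
Proof.
move=> gw; elim: n => [|n ih] /=.
  by congr code; apply: funext => i; rewrite /shift /= addr0.
rewrite ih code_shift1 ?shiftD ?add1n//; first exact: gw.
exact: gw.
Qed.

Definition code_law : probability (borelX X) R := law P measurable_code.

Lemma measurable_iter n : measurable_fun setT (iter n T : borelX X -> borelX X).
Proof.
elim: n => [|n ih] /=; first exact: measurable_id.
by apply: (measurableT_comp _ ih); exact: continuous_measurable_borelX.
Qed.

Lemma mean_code_law (h : X -> R) : measurable_fun setT (h : borelX X -> R) ->
  mean code_law h = mean P (fun w => h (code w)).
Proof. by move=> mh; rewrite (mpres_mean (mpres_law P measurable_code)). Qed.

Lemma code_law_invariant (A : set (borelX X)) : measurable A ->
  code_law ((T : borelX X -> borelX X) @^-1` A) = code_law A.
Proof.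
move=> mA; have ms := (mpres_shift iP 1).1.
transitivity (P (shift 1 @^-1` (code @^-1` A))).
  apply: (full_measure_eq full_orbit_good) => [||w gw].
  - exact: measurable_preimage (measurableT_comp (measurable_iter 1) measurable_code) mA.
  - exact: measurable_preimage (measurableT_comp measurable_code ms) mA.
  - by have /= := iter_code 1 gw => <-.
by apply: esym; apply: (mpres_shift iP 1).2; exact: measurable_preimage measurable_code mA.
Qed.

Lemma code_law_mixing (A B : set (borelX X)) : measurable A -> measurable B ->
  (fun n => code_law (A `&` (iter n (T : borelX X -> borelX X)) @^-1` B))
    @ \oo --> (code_law A * code_law B)%E.
Proof.
move=> mA mB; have pA := measurable_preimage measurable_code mA.
have h := shift_mixing iP pA (measurable_preimage measurable_code mB).
apply: eq_cvgn h => n.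
apply: (full_measure_eq full_orbit_good) => [||w gw].
- by apply: measurableI => //; exact: measurable_preimage (measurableT_comp (measurable_iter n) measurable_code) mB.
- by apply: measurableI => //; exact: measurable_preimage (measurableT_comp measurable_code (mpres_shift iP n).1) mB.
- by have /= <- := iter_code n gw.
Qed.

Variable omega : nat -> R.
Hypothesis omega1 : forall k, 1 < omega k.

Local Notation mu := code_law.

Lemma E_omega_measurable (f : X -> R) : E_omega omega f -> measurable_fun setT (f : borelX X -> R).
Proof.
move=> /(E_omega_growth omega1)[M [M0 _ fl]].
by apply: continuous_measurable_borel; exact: (growth_continuous fl M0).
Qed.

Lemma regular_E_omega (f : X -> R) : E_omega omega f ->
  exists K, regular P P2 alpha K (fun w => f (code w)).
Proof.
move=> /(E_omega_growth omega1)[M [M0 fb fl]]; exists (20 * (M + 1)).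
exact: (regular_observable M0 fb fl).
Qed.

Lemma E_omega_sqr_integrable (f : X -> R) : E_omega omega f ->
  mu.-integrable setT (fun x : borelX X => (f x ^+ 2)%:E).
Proof.
move=> Ef; have mf := E_omega_measurable Ef; have [K [_ [_ i2] _]] := regular_E_omega Ef.
have mf2 : measurable_fun setT (fun x : borelX X => f x ^+ 2) by exact: measurable_funX.
exact: (proj2 (mpres_L1 (mpres_law P measurable_code) mf2) i2).
Qed.

Let measurable_shift_code n : measurable_fun setT (fun w => code (shift n w) : borelX X).
Proof. exact: (measurableT_comp measurable_code (mpres_shift iP n).1). Qed.

Let mean_orbit (h : X -> R) (H : letters int -> R) : measurable_fun setT (h : borelX X -> R) ->
  measurable_fun setT H -> (forall w, orbit_good w -> h (code w) = H w) -> mean mu h = mean P H.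
Proof.
move=> mh mH hH; rewrite mean_code_law//; apply: (full_mean_eq full_orbit_good) => //.
exact: (measurableT_comp mh measurable_code).
Qed.

Lemma E_omega_correlations (f g : X -> R) : E_omega omega f -> E_omega omega g ->
  exists C : R, forall n, (1 <= n)%N ->
    `|cov mu (fun x : borelX X => f (iter n T x)) g| <= C * n%:R `^ (- alpha).
Proof.
move=> Ef Eg; have mf := E_omega_measurable Ef; have mg := E_omega_measurable Eg.
have [K1 rf] := regular_E_omega Ef; have [K2 rg] := regular_E_omega Eg.
exists (K1 * K2 * conv_const alpha) => n n1.
have mfi : measurable_fun setT (fun x : borelX X => f (iter n T x)) := measurableT_comp mf (measurable_iter n).
have mfs := measurableT_comp mf (measurable_shift_code n).
have mfc := measurableT_comp mf measurable_code.
have mgc := measurableT_comp mg measurable_code.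
have -> : cov mu (fun x : borelX X => f (iter n T x)) g =
    mean P (fun w => f (code (shift n w)) * g (code w)) -
    mean P (fun w => f (code w)) * mean P (fun w => g (code w)).
  congr (_ - _ * _).
  - apply: (@mean_orbit (fun x => f (iter n T x) * g x)) => [||w /(iter_code n) ->//]; exact: measurable_funM.
  - rewrite -(mean_shift iP n mfc).
    by apply: (@mean_orbit (fun x => f (iter n T x))) => // w /(iter_code n) ->.
  - exact: mean_orbit.
by rewrite -mulrA; exact: (cov_regular iP iP2 alpha1 rf rg n1).
Qed.

Lemma E_omega_clt (f : X -> R) : E_omega omega f -> Rintegral mu setT (f : borelX X -> R) = 0 ->
  exists sigma : R, 0 <= sigma /\ cvg_dist_gauss mu
    (fun n (x : borelX X) => (\sum_(0 <= k < n) f (iter k T x)) / Num.sqrt n%:R) sigma.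
Proof.
move=> Ef f0; have mf := E_omega_measurable Ef; have [K rf] := regular_E_omega Ef.
have Ef0 : mean P (fun w => f (code w)) = 0.
  by rewrite -f0; apply/esym/mean_orbit => //; exact: (measurableT_comp mf measurable_code).
have [s s0 hs] := clt_regular iP iP2 alpha1 rf Ef0.
exists s; split=> // h ch hb; apply: eq_cvgn (hs h ch hb) => n.
have mh : measurable_fun setT h by exact: continuous_measurable_fun.
apply: mean_orbit => [||w gw].
- apply: (measurableT_comp mh); apply: measurable_funM => //; apply: measurable_sum => k.
  exact: (measurableT_comp mf (measurable_iter k)).
- apply: (measurableT_comp mh); apply: measurable_funM => //; apply: measurable_sum => k.
  exact: (measurableT_comp mf (measurable_shift_code k)).
- by congr (h (_ / _)); apply: eq_bigr => k _; rewrite iter_code.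
Qed.

End CodedDynamics.

(** * Full support of the law *)

Section FullSupport.
Hypothesis kappa00 : kappa 0%N = 0.

Let cost_tail N m w : (N <= m)%N -> cost m w - cost N w =
  \sum_(N <= k < m) (weight alpha k * kappa (w (Posz k)) + weight alpha k * kappa (w (Negz k))).
Proof. by move=> Nm; rewrite /cost !sum_rows (big_cat_nat (leq0n N) Nm)/= addrAC subrr add0r. Qed.

Let norm_vsum_tail N m w : (N <= m)%N -> `|vsum m w - vsum N w| <= cost m w - cost N w.
Proof.
move=> Nm; rewrite cost_tail// /vsum !sum_rows (big_cat_nat (leq0n N) Nm)/= addrAC subrr add0r.
apply: le_trans (ler_norm_sum _ _ _) _; apply: ler_sum => k _.
by apply: le_trans (ler_normD _ _) _; apply: lerD; exact: e_le.
Qed.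

Let L1_cost m : L1 P (cost m).
Proof.
apply: (L1_le (measurable_cost m) (L1_exp_cost m).1) => w.
have c0 := cost_ge0 m w; rewrite ger0_norm//.
by have := expR_ge1Dx (8 * cost m w); lra.
Qed.

Let mean_cost_tail d : 0 < d -> exists2 N, (0 < N)%N &
  forall m, (N <= m)%N -> mean P (fun w => cost m w - cost N w) <= d.
Proof.
move=> d0; pose a m := mean P (cost m).
have a_nd : nondecreasing_seq a.
  by move=> m n mn; apply: le_mean => // w; exact: cost_nd.
have a_le m : a m <= 2.
  have [i1 e2] := L1_exp_cost m.
  apply: le_trans e2; apply: le_mean => // w; have c0 := cost_ge0 m w.
  by have := expR_ge1Dx (8 * cost m w); lra.
have ca : cvgn a by apply: nondecreasing_is_cvgn => //; exists 2 => _ [m _ <-].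
move/cvgrPdist_lt : (ca) => /(_ _ d0)[N _ hN]; exists N.+1 => // m Nm.
rewrite meanB//; have := hN N.+1 (leqnSn N) => /(le_lt_trans (ler_norm _)).
by have := nondecreasing_cvgn_le a_nd ca m; rewrite -/(a _) -/(a _); lra.
Qed.

(** Prescribing the letters in [rows N] and bounding the cost beyond [N] are independent events. The
    first has positive probability [p], the second at least 1/2, and together they keep the sum
    within [r] of [e 0 k]. *)
Lemma code_law_open_gt0 (U : set X) k : open U -> U (e 0 k) -> (0 < code_law U)%E.
Proof.
move=> oU Uk; have /nbhs_ballP[r /= r0 rU] : nbhs (e 0 k) U by exact: open_nbhs_nbhs.
have r4 : 0 < r / 4 by rewrite divr_gt0.
have [N N0 hN] := mean_cost_tail r4.
pose F : set (letters int) := cylinder (rows N) (fun i => if i == 0 then k else 0%N).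
pose E m : set (letters int) := [set w | cost m w - cost N w <= r / 2].
have mF : measurable F by exact: measurable_cylinder.
have mE m : measurable (E m).
  apply: (@measurable_finite_letters _ (rows m ++ rows N)) => w w' ww'.
  rewrite /E /= (@cost_eq m w w') ?(@cost_eq N w w')// => i ir; apply: ww'.
    by rewrite mem_cat ir orbT.
  by rewrite mem_cat ir.
pose p : R := mean P \1_F.
have p0 : 0 < p.
  have := iP (fun i => if i == 0 then k else 0%N) (uniq_rows N); rewrite prob_mean// => -[].
  rewrite /p /F => ->; apply: prodr_gt0 => i _.
  by rewrite invr_gt0 exprn_gt0.
have pE m : (N <= m)%N -> p / 2 <= mean P \1_(F `&` E m).
  move=> Nm.
  have -> : mean P \1_(F `&` E m) = p * mean P \1_(E m).
    rewrite -(mean_indep (J := fun i => i \in rows N) iP (bdd_indic R mF) (bdd_indic R (mE m))).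
    - by congr mean; apply: funext => w; rewrite indicI.
    - move=> w w' ww'; rewrite !indicE; congr (_%:R); congr nat_of_bool.
      by apply/idP/idP => /set_mem wk; apply/mem_set => i si; rewrite -wk// ww'.
    - move=> w w' ww'; rewrite !indicE; congr (_%:R); congr nat_of_bool.
      suff -> : (w \in E m) = (w' \in E m) by [].
      suff ec : cost m w - cost N w = cost m w' - cost N w' by apply/idP/idP => /set_mem h; apply/mem_set; rewrite /E /= -?ec// ec.
      rewrite !cost_tail//; apply: eq_big_nat => j /andP[Nj _].
      by rewrite !ww'//= mem_rows /window; lia.
  rewrite ler_wpM2l ?(ltW p0)//.
  have l1 : L1 P (fun w => 1 - 2 / r * (cost m w - cost N w)).
    by apply: L1B; [exact: L1_cst|apply: L1Z; exact: L1B].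
  (* Markov's inequality: the mean tail is at most [r/4], half of the threshold [r/2], which leaves
     probability 1/2. *)
  apply: le_trans (_ : mean P (fun w => 1 - 2 / r * (cost m w - cost N w)) <= _).
    rewrite meanB; [|exact: L1_cst|by apply: L1Z; exact: L1B].
    rewrite mean_cst meanZ; last exact: L1B.
    have := hN m Nm; move: (mean _ _) => x xr.
    have : 2 / r * x <= 2 / r * (r / 4) by rewrite ler_wpM2l// divr_ge0// ltW.
    have -> : 2 / r * (r / 4) = 1 / 2 by field; rewrite gt_eqF.
    by lra.
  apply: le_mean => //; first exact/L1_bdd/bdd_indic.
  move=> w; rewrite indicE; have [_|/negP wE] := boolP (w \in E m).
    by rewrite gerBl mulr_ge0 ?divr_ge0 ?(ltW r0)// subr_ge0; exact: cost_nd.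
  have : r / 2 < cost m w - cost N w.
    by rewrite ltNge; apply/negP => h; apply: wE; exact: mem_set.
  rewrite mulr0n subr_le0 -ler_pdivrMl ?divr_gt0// invf_div mulr1.
  exact: ltW.
(* The sets decrease with [m] and all have measure at least [p/2], so the intersection does too. *)
pose A : set (letters int) := \bigcap_m (F `&` E (N + m)%N).
have mFE m : measurable (F `&` E m) by exact: measurableI.
have mA : measurable A by exact: bigcapT_measurable.
have PA : ((p / 2)%:E <= P A)%E.
  have niA : nonincreasing_seq (fun m => F `&` E (N + m)%N).
    apply/nonincreasing_seqP => m; apply/subsetPset => w [Fw Ew]; split=> //; apply: le_trans Ew.
    by rewrite lerD2r; apply: cost_nd => //; rewrite addnS.
  have c : (fun m => P (F `&` E (N + m)%N)) @ \oo --> P A.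
    by apply: nonincreasing_cvg_mu => //; apply: le_lt_trans (probability_le1 _ _) _; rewrite ?ltry.
  rewrite -(cvg_lim _ c)//; apply: lime_ge; first by apply/cvg_ex; eexists; exact: c.
  by apply: nearW => m; rewrite prob_mean// lee_fin pE// leq_addr.
have mU : measurable (code @^-1` U : set (letters int)).
  exact: measurable_preimage measurable_code (measurable_open oU).
change (0 < P (code @^-1` U))%E.
have p2 : (0 < (p / 2)%:E)%E by rewrite lte_fin divr_gt0.
apply: lt_le_trans p2 _; apply: le_trans PA _.
rewrite (full_measure_eq (B := A `&` good) full_good)//; [|by apply: measurableI => //; exact: full_good.1|by move=> w gw; split=> [|[]]].
apply: le_measure; rewrite ?inE//; first by apply: measurableI => //; exact: full_good.1.
move=> w [Aw gw] /=; apply: rU; rewrite -ball_normE /ball_/=.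
have r2 : 0 < r / 2 by rewrite divr_gt0.
move/cvgrPdist_lt : (code_cvg gw) => /(_ _ r2)[M _ /(_ (N + M)%N (leq_addl _ _)) hM].
have [Fw Ew] := Aw M I.
(* Letter 0 has [kappa 0 = 0], so it stands for the zero orbit and only row 0 contributes. *)
have vN : vsum N w = e 0 k.
  have r0N : 0 \in rows N by rewrite mem_rows /window; lia.
  rewrite /vsum (bigD1_seq _ r0N (uniq_rows N))/= (Fw _ r0N) eqxx big1_seq ?addr0// => i /andP[i0 ir].
  rewrite (Fw _ ir) (negbTE i0); apply/eqP; rewrite -normr_eq0 eq_le normr_ge0 andbT.
  by apply: le_trans (e_le _ _) _; rewrite kappa00 mulr0.
rewrite -vN distrC -(subrKA (vsum (N + M) w)).
apply: le_lt_trans (ler_normD _ _) _; rewrite [ltRHS]splitr; apply: ltr_leD => //.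
by apply: le_trans (norm_vsum_tail _ (leq_addr M N)) _.
Qed.

End FullSupport.

End Coding.

(** * Choice of the alphabet of orbits *)

Section Letters.
Variables (R : realType) (alpha : R) (X : completeNormedModType R).
Variables (T : {linear X -> X}) (D : set X) (S : nat -> X -> X).
Hypotheses (alpha1 : 1 < alpha) (dD : dense D).

(** The given dense sequence need not meet [D]; each of its points is approached by points of [D] at
    distances below [1/(n+1)], and the pairs are enumerated. *)
Lemma dense_seq_in : (exists s : nat -> X, dense (range s)) ->
  exists2 y : nat -> X, (forall i, D (y i)) & dense (range y).
Proof.
move=> [s ds].
have /choice[z zP] (p : nat * nat) : exists x, D x /\ `|s p.1 - x| < p.2.+1%:R^-1.
  have p0 : 0 < p.2.+1%:R^-1 :> R by rewrite invr_gt0.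
  have [||x [bx Dx]] := @dD (ball (s p.1) p.2.+1%:R^-1).
  - by exists (s p.1); exact: ballxx.
  - exact: ball_open.
  by exists x; split=> //; move: bx; rewrite -ball_normE.
exists (fun i => z (odflt (0, 0)%N (unpickle i))) => [i|U [x Ux] oU]; first by have [] := zP (odflt (0, 0)%N (unpickle i)).
have /nbhs_ballP[r /= r0 rU] : nbhs x U by exact: open_nbhs_nbhs.
have r2 : 0 < r / 2 by rewrite divr_gt0.
have [||x1 [bx [j _ jx]]] := @ds (ball x (r / 2)); first by exists x; exact: ballxx.
  exact: ball_open.
rewrite -jx in bx.
pose n := Num.truncn (r / 2)^-1.
have hn : n.+1%:R^-1 < r / 2.
  by rewrite invf_plt ?posrE// truncnS_gt.
exists (z (j, n)); split; last by exists (pickle (j, n)) => //; rewrite pickleK.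
apply: rU; move: bx; rewrite -ball_normE /ball_/= => bx.
have [_ /= bz] := zP (j, n).
rewrite -(subrKA (s j)); apply: le_lt_trans (ler_normD _ _) _; rewrite [ltRHS]splitr.
by apply: ltrD => //; exact: lt_trans hn.
Qed.

(** The finitely many terms before [N] are absorbed by adding all their ratios to the constant. *)
Lemma weight_dominate (u : nat -> R) (C : R) N : (forall n, 0 <= u n) ->
  (forall n, (N <= n)%N -> u n <= C * weight alpha n) ->
  exists2 C', 0 < C' & forall n, u n <= C' * weight alpha n.
Proof.
move=> u0 uC; have w0 n : 0 < weight alpha n by exact: weight_gt0.
have q0 n : 0 <= u n / weight alpha n by rewrite divr_ge0// ltW.
pose B : R := \sum_(n < N) u n / weight alpha n.
have B0 : 0 <= B by exact: sumr_ge0.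
exists (1 + `|C| + B); first by rewrite ltr_wpDr// ltr_wpDr.
move=> n; have [/uC h|nN] := leqP N n.
  apply: le_trans h _; rewrite ler_wpM2r// ?ltW//; have := ler_norm C; lra.
rewrite -ler_pdivrMr//; apply: (@le_trans _ _ B).
  by rewrite /B (bigD1 (Ordinal nN))//= lerDl sumr_ge0.
by have := normr_ge0 C; lra.
Qed.

Lemma powRN_weight (n : nat) : (0 < n)%N -> n%:R `^ (- alpha) <= 2 `^ alpha * weight alpha n.
Proof.
move=> n0; have h : (0 : R) < n.+1%:R / 2 by rewrite divr_gt0.
apply: (le_trans (powRN_homo alpha1 h (y := n%:R) _)).
  by rewrite ler_pdivrMr// -natrM ler_nat muln2 -addnn -addn1 leq_add2l.
by rewrite powRM ?invr_ge0// mulrC -powR_inv1// -powRrM mulN1r opprK.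
Qed.

Hypotheses (TSn : forall x, D x -> forall n, iter n T (S n x) = x)
  (TSm : forall x, D x -> forall n m, (m < n)%N -> iter m T (S n x) = S (n - m)%N x)
  (T_le : forall x, D x -> exists C : R, exists N : nat, forall n, (N <= n)%N ->
     `|iter n T x| <= C * n%:R `^ (- alpha))
  (S_le : forall x, D x -> exists C : R, exists N : nat, forall n, (N <= n)%N ->
     `|S n x| <= C * n%:R `^ (- alpha)).

Let orbit (i : int) (x : X) : X :=
  match i with Posz n => S n x | Negz n => iter n.+1 T x end.

Let T_orbit i x : D x -> T (orbit i x) = orbit (i - 1) x.
Proof.
move=> Dx; case: i => [[|n]|n].
- by have /= S0 := TSn Dx 0; rewrite /= S0.
- rewrite (_ : Posz n.+1 - 1 = Posz n); last by lia.
  case: n => [|n]; last by have := TSm Dx (isT : 1 < n.+2)%N; rewrite subn1.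
  (* [TSm] requires [m < n], so [T (S 1 x) = S 0 x] is read off from [TSn]: both sides equal [x]. *)
  by have /= -> := TSn Dx 1; apply/esym; exact: (TSn Dx 0).
- by rewrite (_ : Negz n - 1 = Negz n.+1); last by lia.
Qed.

Let orbit_le x : D x -> exists2 C, 0 < C & forall i, `|orbit i x| <= zweight alpha i * C.
Proof.
move=> Dx; have [C1 [N1 h1]] := T_le Dx; have [C2 [N2 h2]] := S_le Dx.
have [|n Nn|B1 B10 hB1] := @weight_dominate (fun n => `|iter n.+1 T x|) C1 N1; first by [].
  by apply: h1; exact: leqW.
have [|n Nn|B2 B20 hB2] := @weight_dominate (fun n => `|S n x|) (`|C2| * 2 `^ alpha) N2.+1; first by [].
  apply: le_trans (h2 _ (ltnW Nn)) _; rewrite -mulrA.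
  apply: (@le_trans _ _ (`|C2| * n%:R `^ (- alpha))).
    by rewrite ler_wpM2r ?powR_ge0// ler_norm.
  by rewrite ler_wpM2l// powRN_weight//; exact: leq_trans Nn.
exists (B1 + B2) => [|i]; first exact: addr_gt0.
rewrite mulrC; case: i => n /=.
  by apply: le_trans (hB2 n) _; rewrite ler_wpM2r ?ltW ?weight_gt0// ltrDr.
by apply: le_trans (hB1 n) _; rewrite ler_wpM2r ?ltW ?weight_gt0// ltrDl.
Qed.

(* Letter [k] stands for the orbit of [y (logn 2 k)], so that every point of the
   dense sequence is used by arbitrarily large letters; letters too small for the
   size of their orbit stand for the zero orbit. *)
Lemma exists_letters : (exists s : nat -> X, dense (range s)) ->
  exists (e : int -> nat -> X) (kappa : nat -> R),
  [/\ [/\ forall k, 0 <= kappa k, kappa 0%N = 0 &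
          forall k, expR (16 * zeta_bound alpha * kappa k) <= (3 / 2) ^+ k],
      forall i k, `|e i k| <= zweight alpha i * kappa k,
      forall i k, T (e i k) = e (i - 1) k &
      forall U : set X, open U -> U !=set0 -> exists k, U (e 0 k)].
Proof.
move=> /dense_seq_in[y Dy dy].
have /choice[C CP] i : exists C : R, 0 < C /\ forall j, `|orbit j (y i)| <= zweight alpha j * C.
  by have [C ? ?] := orbit_le (Dy i); exists C.
pose z := 16 * zeta_bound alpha.
have z0 : 0 < z by rewrite mulr_gt0//; have := zeta_bound_ge1 alpha1; lra.
have l0 : 0 < ln (3 / 2) :> R by rewrite ln_gt0; lra.
(* The logarithm of the moment condition on [kappa k]. *)
pose ok k := z * C (logn 2 k) <= k%:R * ln (3 / 2).
exists (fun i k => if ok k then orbit i (y (logn 2 k)) else 0).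
exists (fun k => if ok k then C (logn 2 k) else 0).
split; [split|..].
- by move=> k; case: ifP => // _; have [/ltW] := CP (logn 2 k).
(* [ok 0] fails because its left side is positive, so letter 0 is the zero orbit. *)
- by rewrite /ok mul0r leNgt mulr_gt0//; have [] := CP (logn 2 0).
- move=> k; case: ifP => [okk|_]; last by rewrite mulr0 expR0 exprn_ege1//; lra.
  have -> : (3 / 2 : R) ^+ k = expR (k%:R * ln (3 / 2)).
    by rewrite expRM_natl lnK// posrE divr_gt0.
  by rewrite ler_expR.
- move=> i k; case: ifP => _; last by rewrite normr0 mulr0.
  by have [_] := CP (logn 2 k).
- by move=> i k; case: ifP => _; [exact: T_orbit|exact: linear0].
move=> U oU U0; have [x [Uy [i _ yi]]] := dy _ U0 oU.
pose m := Num.truncn (z * C i / ln (3 / 2)).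
(* The 2-adic valuation selects the orbit of [y i], while the odd factor makes the letter large
   enough to be [ok]. *)
exists (2 ^ i * 3 ^ m.+1)%N.
have li : logn 2 (2 ^ i * 3 ^ m.+1) = i.
  by rewrite lognM ?expn_gt0// pfactorK// lognX muln0 addn0.
have -> : ok (2 ^ i * 3 ^ m.+1)%N.
  rewrite /ok li -ler_pdivrMr//; apply: ltW; apply: (lt_le_trans (truncnS_gt _)).
  rewrite ler_nat; apply: leq_trans (ltnW (ltn_expl m.+1 (isT : 1 < 3)%N)) _.
  by rewrite leq_pmull// expn_gt0.
by rewrite li; have /= -> := TSn (Dy i) 0; rewrite yi.
Qed.

End Letters.

Theorem theorem2p3 (R : realType) (X : completeNormedModType R)
  (T : {linear X -> X}) (omega : nat -> R) (alpha : R)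
  (D : set X) (S : nat -> X -> X) :
  (exists s : nat -> X, dense (range s)) ->
  continuous T ->
  (forall k, 1 < omega k) ->
  omega @ \oo --> +oo ->
  1 < alpha ->
  dense D ->
  (forall x, D x -> forall n, iter n T (S n x) = x) ->
  (forall x, D x -> forall n m, (m < n)%N -> iter m T (S n x) = S (n - m)%N x) ->
  (forall x, D x -> exists C : R, exists N : nat, forall n, (N <= n)%N ->
     `|iter n T x| <= C * n%:R `^ (- alpha)) ->
  (forall x, D x -> exists C : R, exists N : nat, forall n, (N <= n)%N ->
     `|S n x| <= C * n%:R `^ (- alpha)) ->
  exists mu : probability (borelX X) R,
    (* T-invariant *)
    (forall A : set (borelX X), measurable A ->
       mu ((T : borelX X -> borelX X) @^-1` A) = mu A) /\
    (* full support *)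
    (forall U : set X, open U -> U !=set0 -> (0 < mu U)%E) /\
    (* strongly mixing *)
    (forall A B : set (borelX X), measurable A -> measurable B ->
       (fun n => mu (A `&` (iter n (T : borelX X -> borelX X)) @^-1` B))
         @ \oo --> (mu A * mu B)%E) /\
    (* E_omega is contained in L^2(mu) *)
    (forall f : X -> R, E_omega omega f ->
       measurable_fun setT (f : borelX X -> R) /\
       mu.-integrable setT (fun x : borelX X => (f x ^+ 2)%:E)) /\
    (* decay of correlations *)
    (forall f g : X -> R, E_omega omega f -> E_omega omega g ->
       exists C : R, forall n, (1 <= n)%N ->
         `|cov mu (fun x : borelX X => f (iter n T x)) g|
           <= C * n%:R `^ (- alpha)) /\
    (* central limit theorem *)
    (forall f : X -> R, E_omega omega f ->
       Rintegral mu setT (f : borelX X -> R) = 0 ->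
       exists sigma : R, 0 <= sigma /\
         cvg_dist_gauss mu
           (fun n (x : borelX X) =>
              (\sum_(0 <= k < n) f (iter k T x)) / Num.sqrt n%:R) sigma).
Proof.
move=> sep cT omega1 _ alpha1 dD TSn TSm T_le S_le.
have [e [kappa [[kappa0 kappa00 kappa_exp] e_le eT e_dense]]] :=
  exists_letters alpha1 dD TSn TSm T_le S_le sep.
have [P iP] := exists_iid R int.
have [P2 iP2] := exists_iid R (bool * int)%type.
exists (code_law P kappa0 e_le); split.
  exact: (code_law_invariant alpha1 iP kappa0 e_le kappa_exp cT eT).
split.
  move=> U oU /(e_dense _ oU)[k Uk].
  exact: (code_law_open_gt0 alpha1 iP kappa0 e_le kappa_exp kappa00 oU Uk).
split; first by move=> A B mA mB; exact: code_law_mixing.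
split.
  move=> f Ef; split; first exact: (E_omega_measurable omega1).
  exact: (E_omega_sqr_integrable alpha1 iP kappa0 e_le kappa_exp iP2 omega1).
split.
  move=> f g Ef Eg.
  exact: (E_omega_correlations alpha1 iP kappa0 e_le kappa_exp iP2 cT eT omega1 Ef Eg).
move=> f Ef f0.
exact: (E_omega_clt alpha1 iP kappa_exp iP2 cT eT omega1 Ef f0).
Qed.
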